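(* Let $\nu>-1$. Let $f:\mathbb{R}\to\mathbb{R}$ be locally of bounded variation and right continuous. Assume that its total variation function $V_f:\mathbb{R}\to\mathbb{R}$ satisfies $$\int_{-\infty}^\infty|E_\nu(\xi)|^{-2}\,dV_f(\xi)<\infty .$$ Define, for $x\in\mathbb{R}$, $$L_1(x)=f(x)-\frac12\int_{-\infty}^\infty\{\operatorname{sgn}(x-\xi)-\ell_\xi(x)\}\,df(\xi)-\frac12\int_{-\infty}^\infty k_\xi^2(x)\,dV_f(\xi),$$ $$M_1(x)=f(x)-\frac12\int_{-\infty}^\infty\{\operatorname{sgn}(x-\xi)-\ell_\xi(x)\}\,df(\xi)+\frac12\int_{-\infty}^\infty k_\xi^2(x)\,dV_f(\xi).$$ Then: (i) The integrals defining $L_1(x)$ and $M_1(x)$ are absolutely convergent for all $x\in\mathbb{R}$. (ii) There exists a pair of entire functions $L:\mathbb{C}\to\mathbb{C}$ and $M:\mathbb{C}\to\mathbb{C}$ of exponential type at most $2$ such that $L(x)=L_1(x)$ and $M(x)=M_1(x)$ for almost all $x\in\mathbb{R}$. (iii) The restrictions of $L$ and $M$ to $\mathbb{R}$ satisfy $L(x)\le f(x)\le M(x)$ for all $x\in\mathbb{R}$ and $$\int_{-\infty}^\infty\{M(x)-L(x)\}\,|E_\nu(x)|^{-2}\,dx\le\int_{-\infty}^\infty\frac{1}{K_\nu(\xi,\xi)}\,dV_f(\xi)<\infty .$$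
   Context: An entire function $F$, not identically zero, has exponential type at most $\delta$ if $\limsup_{|z|\to\infty}|z|^{-1}\log|F(z)|\le\delta$; the zero function is regarded as having exponential type at most $\delta$. Real entire means entire and real valued on $\mathbb{R}$. For $\nu>-1$, $$A_\nu(z)=\sum_{n\ge0}\frac{(-1)^n(z/2)^{2n}}{n!(\nu+1)\cdots(\nu+n)},\quad B_\nu(z)=\sum_{n\ge0}\frac{(-1)^n(z/2)^{2n+1}}{n!(\nu+1)\cdots(\nu+n+1)},\quad E_\nu=A_\nu-iB_\nu .$$ $K_\nu$ is the reproducing kernel of the de Branges space $\mathcal{H}(E_\nu)$ (inner product $\int F\overline{G}|E_\nu|^{-2}dx$): $\pi(z-\overline w)K_\nu(w,z)=B_\nu(z)A_\nu(\overline w)-A_\nu(z)B_\nu(\overline w)$; one has $K_\nu(\xi,\xi)>0$ for real $\xi$. For $\xi\in\mathbb{R}$ put $k_\xi(z)=K_\nu(\xi,z)/K_\nu(\xi,\xi)$. For each $\xi\in\mathbb{R}$, $\ell_\xi:\mathbb{C}\to\mathbb{C}$ is the real entire function of exponential type at most $2$ constructed by Holt and Vaaler, satisfying $$|\operatorname{sgn}(x-\xi)-\ell_\xi(x)|\le k_\xi^2(x)\quad\text{for all }x\in\mathbb{R},$$ with $\operatorname{sgn}(0)=0$; $(\xi,x)\mapsto\ell_\xi(x)$ is taken to be Borel measurable on $\mathbb{R}^2$. (These are the only properties of $\ell_\xi$ to be used.) $f$ is locally of bounded variation if it has bounded variation on every compact interval. With $V(f)|_{(a,b]}$ the total variation of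 $f$ on $(a,b]$, set $V_f(x)=V(f)|_{(0,x]}$ for $x>0$, $V_f(0)=0$, $V_f(x)=-V(f)|_{(x,0]}$ for $x<0$. $V_f$ is nondecreasing and right continuous; $dV_f$ denotes the Borel measure with mass $V_f(b)-V_f(a)$ on $(a,b]$, and $df$ the signed measure on bounded Borel sets with mass $f(b)-f(a)$ on $(a,b]$. Integrals against $df$ over $\mathbb{R}$ are limits of integrals over $[-R,R]$ as $R\to\infty$; absolute convergence means convergence of the integral of the absolute value against $dV_f$. *)

(* Defs.v *)
(* The real line is an arbitrary R : realType of MathComp-Analysis, the complex
   plane is R[i]. MathComp-Analysis has its topology on the alias R[i]^o only, so
   limits and derivatives are taken there. *)
From HB Require Import structures.
From mathcomp Require Import all_boot all_order all_algebra.
From mathcomp Require Import all_classical all_reals all_analysis.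
From mathcomp Require Import complex lra.

Set Implicit Arguments.
Unset Strict Implicit.
Unset Printing Implicit Defensive.

Import Order.TTheory GRing.Theory Num.Theory.
Import numFieldNormedType.Exports.

Local Open Scope classical_set_scope.
Local Open Scope complex_scope.
Local Open Scope ring_scope.

Section entire_functions.
Context {R : realType}.
Local Notation C := R[i].
Implicit Types (F G E P Q : C -> C) (D : set C) (z w : C) (x y : R).

(* The norm [`|z|] of MathComp lives in R[i]; this is the same norm in R. *)
Definition cabs z : R := ComplexField.Normc.normc z.

Definition holomorphic_on D F := forall z, D z -> derivable (F : C^o -> C^o) z 1.

Definition entire F := holomorphic_on [set: C] F.

Definition real_on_reals F := forall x, complex.Im (F x%:C) = 0.

Definition complex_infty : set_system C :=
  filter_from [set: R] (fun r => [set z | r < cabs z]).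

(* [lne] is the extended logarithm with [lne 0 = -oo]; for the zero function
   the upper limit is therefore [-oo] and the condition holds. *)
Definition exponential_type_le (delta : R) F :=
  (limf_esup (fun z : C^o => ((cabs z)^-1)%:E * lne (cabs (F z))%:E) complex_infty
     <= delta%:E)%E.

Definition upper_half_plane : set C := [set z | 0 < complex.Im z].

(* F = P / Q on the upper half-plane with P, Q bounded and analytic there and
   Q not identically zero; the quotient is cleared because Q may have zeros. *)
Definition bounded_type F := exists P Q,
  [/\ holomorphic_on upper_half_plane P,
      holomorphic_on upper_half_plane Q,
      exists c : R, forall z, upper_half_plane z -> cabs (P z) <= c /\ cabs (Q z) <= c,
      exists2 z, upper_half_plane z & Q z != 0 &
      forall z, upper_half_plane z -> F z * Q z = P z].

Definition nonpositive_mean_type F :=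
  (limf_esup (fun y : R => (y^-1)%:E * lne (cabs (F (0 +i* y)))%:E) (pinfty_nbhs R)
     <= 0)%E.

(* F^*(z), the complex conjugate of F at the conjugate point. *)
Definition sharp F z : C := (F z^*)^*.

Definition weight E x : R := cabs (E x%:C) ^- 2.

(* F belongs to H(E). *)
Definition de_Branges E F :=
  [/\ entire F,
      (\int[lebesgue_measure]_x (cabs (F x%:C) ^+ 2 * weight E x)%:E < +oo)%E,
      bounded_type (fun z => F z / E z) /\
        nonpositive_mean_type (fun z => F z / E z) &
      bounded_type (fun z => sharp F z / E z) /\
        nonpositive_mean_type (fun z => sharp F z / E z)].

Definition de_Branges_inner E F G : C :=
  (\int[lebesgue_measure]_x (complex.Re (F x%:C * (G x%:C)^*) * weight E x))%R +i*
  (\int[lebesgue_measure]_x (complex.Im (F x%:C * (G x%:C)^*) * weight E x))%R.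

Definition reproducing_kernel E (K : C -> C -> C) := forall w,
  de_Branges E (K w) /\
  forall F, de_Branges E F -> F w = de_Branges_inner E F (K w).

End entire_functions.

Section homogeneous_space.
Context {R : realType}.
Local Notation C := R[i].
Implicit Types (nu xi x : R) (z : C) (K : C -> C -> C).

Definition A_ nu z : C :=
  limn (series (fun n : nat => (-1) ^+ n * (z / 2) ^+ (2 * n)
    / (n`!%:R * \prod_(1 <= j < n.+1) (nu + j%:R)%:C) : C^o)).

Definition B_ nu z : C :=
  limn (series (fun n : nat => (-1) ^+ n * (z / 2) ^+ (2 * n).+1
    / (n`!%:R * \prod_(1 <= j < n.+2) (nu + j%:R)%:C) : C^o)).

Definition E_ nu z : C := A_ nu z - 'i * B_ nu z.

Definition k_ K xi z : C := K xi%:C z / K xi%:C xi%:C.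

(* [K] is real on the real axis, hence so is [k_]; the squares are read off as
   elements of R. *)
Definition ksq K xi x : R := complex.Re (k_ K xi x%:C ^+ 2).

Definition Kdiag K xi : R := complex.Re (K xi%:C xi%:C).

End homogeneous_space.

Section variation.
Context {R : realType}.
Implicit Types (f g : R -> R) (a b x : R).

Definition locally_bounded_variation f :=
  forall a b, a < b -> bounded_variation a b f.

(* [total_variation a b f] is the supremum over the partitions of [a, b]; for a
   right continuous f it is also the total variation on (a, b]. *)
Definition V_ f x : R :=
  if 0 <= x then fine (total_variation 0 x f)
  else - fine (total_variation x 0 f).

Lemma V_diff f a b : locally_bounded_variation f -> a <= b ->
  V_ f b - V_ f a = fine (total_variation a b f).
Proof.
move=> bvf ab.
have fin c d : c <= d -> total_variation c d f \is a fin_num.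
  rewrite le_eqVlt => /predU1P[->|cd]; first by rewrite total_variationxx.
  by apply/(bounded_variationP _ (ltW cd)); exact: bvf.
have TVD c d e : c <= d -> d <= e ->
    fine (total_variation c e f) =
    fine (total_variation c d f) + fine (total_variation d e f).
  by move=> cd de; rewrite (total_variationD f cd de) fineD// fin.
rewrite /V_; case: (leP 0 b) => b0; case: (leP 0 a) => a0.
- by rewrite (TVD 0 a b)// addrAC subrr add0r.
- by rewrite opprK addrC -TVD// ltW.
- by have := lt_le_trans b0 (le_trans a0 ab); rewrite ltxx.
- by rewrite opprK addrC (TVD a b 0) ?(ltW b0)// addrK.
Qed.

Section measures.
Variable f : R -> R.
Hypotheses (fbv : locally_bounded_variation f) (frc : right_continuous f).

Lemma V_ge a b : a <= b -> `|f b - f a| <= V_ f b - V_ f a.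
Proof.
move=> ab; rewrite V_diff//.
have := total_variation_ge f ab; rewrite -lee_fin => /le_trans; apply.
rewrite fineK//; move: ab; rewrite le_eqVlt => /predU1P[->|ab].
  by rewrite total_variationxx.
by apply/(bounded_variationP _ (ltW ab)); exact: fbv.
Qed.

Lemma V_nondecreasing : {homo V_ f : x y / x <= y}.
Proof.
by move=> a b ab; rewrite -subr_ge0; apply: le_trans (V_ge ab); exact: normr_ge0.
Qed.

Lemma V_right_continuous : right_continuous (V_ f).
Proof.
move=> x.
have H : (fun y => V_ f x + fine (total_variation x y f)) @ x^'+ --> V_ f x.
  rewrite -[X in _ --> X]addr0; apply: cvgD; first exact: cvg_cst.
  have := @total_variation_right_continuous R x (x + 1) x f (lexx _).
  rewrite ltrDl ltr01 total_variationxx /= => /(_ isT (@frc x)).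
  by apply; apply: fbv; rewrite ltrDl.
apply: cvg_trans H; apply: near_eq_cvg; near=> y.
have xy : x <= y by near: y; exact: nbhs_right_ge.
by rewrite -(V_diff fbv xy) addrC subrK.
Unshelve. all: by end_near. Qed.

(* f = pos_var - neg_var and V_f = pos_var + neg_var. *)
Definition pos_var x : R := (V_ f x + f x) / 2.
Definition neg_var x : R := (V_ f x - f x) / 2.

Lemma pos_var_nondecreasing : {homo pos_var : x y / x <= y}.
Proof.
move=> a b ab; rewrite ler_pM2r ?invr_gt0//.
by have := V_ge ab; rewrite ler_norml => /andP[]; lra.
Qed.

Lemma neg_var_nondecreasing : {homo neg_var : x y / x <= y}.
Proof.
move=> a b ab; rewrite ler_pM2r ?invr_gt0//.
by have := V_ge ab; rewrite ler_norml => /andP[]; lra.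
Qed.

Lemma pos_var_right_continuous : right_continuous pos_var.
Proof.
by move=> x; apply: cvgMl; apply: cvgD; [exact: V_right_continuous|exact: frc].
Qed.

Lemma neg_var_right_continuous : right_continuous neg_var.
Proof.
by move=> x; apply: cvgMl; apply: cvgB; [exact: V_right_continuous|exact: frc].
Qed.

Definition V_cumulative : cumulative R R := HB.pack (V_ f)
  (isCumulative.Build R _ R (V_ f) V_nondecreasing V_right_continuous).

Definition pos_var_cumulative : cumulative R R := HB.pack pos_var
  (isCumulative.Build R _ R pos_var
    pos_var_nondecreasing pos_var_right_continuous).

Definition neg_var_cumulative : cumulative R R := HB.pack neg_var
  (isCumulative.Build R _ R neg_var
    neg_var_nondecreasing neg_var_right_continuous).

Definition dV := lebesgue_stieltjes_measure V_cumulative.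
Definition dpos := lebesgue_stieltjes_measure pos_var_cumulative.
Definition dneg := lebesgue_stieltjes_measure neg_var_cumulative.

(* The signed measure of f, meaningful on bounded Borel sets; [dpos] and [dneg]
   are its positive and negative variations. *)
Definition df (A : set R) : R := fine (dpos A) - fine (dneg A).

Lemma stieltjes_itv (g : cumulative R R) a b : a <= b ->
  lebesgue_stieltjes_measure g `]a, b]%classic = (g b - g a)%:E.
Proof.
move=> ab; rewrite /lebesgue_stieltjes_measure /measure_extension/=.
rewrite measurable_mu_extE/=; last exact: is_ocitv.
move: ab; rewrite le_eqVlt => /predU1P[->|ab].
  by rewrite set_itv_ge ?bnd_simp ?ltxx// wlength0 subrr.
by rewrite wlength_itv_bnd// ltW.
Qed.

Lemma dV_itv a b : a <= b -> dV `]a, b]%classic = (V_ f b - V_ f a)%:E.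
Proof. exact: stieltjes_itv. Qed.

Lemma df_itv a b : a <= b -> df `]a, b]%classic = f b - f a.
Proof.
move=> ab; rewrite /df /dpos /dneg !stieltjes_itv//= /pos_var /neg_var; lra.
Qed.

(* The integral against the signed measure [df] over a bounded set D, through its
   Jordan decomposition. *)
Definition df_integral_on (D : set R) g : R :=
  (\int[dpos]_(x in D) g x)%R - (\int[dneg]_(x in D) g x)%R.

Definition df_integral g : R :=
  lim (df_integral_on `[- r, r] g @[r --> +oo]).

Section extremal_functions.
Variables (K : R[i] -> R[i] -> R[i]) (ell : R -> R[i] -> R[i]).

Definition sgn_err x xi : R := Num.sg (x - xi) - complex.Re (ell xi x%:C).

Definition L1 x : R :=
  f x - 2^-1 * df_integral (sgn_err x) - 2^-1 * (\int[dV]_xi ksq K xi x)%R.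

Definition M1 x : R :=
  f x - 2^-1 * df_integral (sgn_err x) + 2^-1 * (\int[dV]_xi ksq K xi x)%R.

End extremal_functions.
End measures.
End variation.

(* Main.v *)
(* On the real line, pi K(x,x) = A B' - A' B is positive and lies
   between c |E(x)|^2 and C (1 + x^2): with h = pi K(x,x), the system satisfied
   by A and B gives (x^(2 nu + 2) h)' = x^(2 nu + 1) |E|^2.  Cauchy-Schwarz in
   H(E) then bounds k_xi(x)^2 by C (1 + x^2) / K(xi,xi).

   Let s(xi) be the sign of xi, with s(0) = -1.  Then l_xi + s(xi) has the same
   bound, because sgn(x - xi) + s(xi) vanishes for |xi| > |x|.  By
   Phragmen-Lindelof both functions are of size (1 + |z|)^2 e^(2|z|) / K(xi,xi)
   in the plane, and so are their Taylor coefficients (Cauchy's estimate).  As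
   1 / K(xi,xi) <= C |E(xi)|^-2 is dV_f-integrable, their Taylor series can be
   integrated term by term in xi, and the integrals are entire of type 2.

   Outside the atoms of dV_f, the integral of sgn(x - xi) + s(xi) against df is
   2 (f(x) - f(0)), which turns L_1 and M_1 into such integrals.  The bounds
   L <= f <= M hold there and extend to all x by right continuity; the integral
   inequality is Tonelli together with |K(xi, .)|^2 |E|^-2 having integral
   K(xi,xi). *)
Require Import Defs.
From HB Require Import structures.
From mathcomp Require Import all_boot all_order all_algebra.
From mathcomp Require Import all_classical all_reals all_analysis.
From mathcomp Require Import measurable_realfun complex ring lra.

Set Implicit Arguments.
Unset Strict Implicit.
Unset Printing Implicit Defensive.

Import Order.TTheory GRing.Theory Num.Theory.
Import numFieldNormedType.Exports.

Local Open Scope classical_set_scope.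
Local Open Scope complex_scope.
Local Open Scope ring_scope.

(** * Modulus and holomorphy *)

(** Holomorphy here is pointwise differentiability, without continuity of the derivative, so
    Cauchy's theory starts from Goursat's bisection. In the coordinate w = log z circles become
    vertical segments and annuli become rectangles; rectangles are the only contours.

    The shift by s(xi) answers an obstacle: l_xi(x) approximates a sign and need not be integrable
    in xi when dV_f has infinite mass, whereas l_xi + s(xi) is controlled by 1 / K(xi,xi).

    In xi, only the values of l_xi at real points are known to be measurable. This is why Taylor
    coefficients are integrated instead of complex values: each coefficient is a limit of
    expressions in real values, hence measurable. The Cauchy estimates, for all radii r at once,
    pass to the integrated coefficients with the same dependence on n and r, and they give back the
    exponential type.

    The signed measure df is treated through its positive and negative variations. Both are
    dominated by dV_f, so each yields an entire function by itself. *)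

Section cabs_theory.
Context {R : realType}.
Local Notation C := R[i].
Implicit Types (z w : C) (x y : R).

Lemma normE z : `|z| = (cabs z)%:C.
Proof. by case: z => a b; rewrite normc_def. Qed.

Lemma cabs_ge0 z : 0 <= cabs z.
Proof. by rewrite -ler0c -normE. Qed.

Lemma cabs0 : cabs (0 : C) = 0.
Proof. by rewrite /cabs ComplexField.Normc.normc0. Qed.

Lemma cabs1 : cabs (1 : C) = 1.
Proof. by rewrite /cabs ComplexField.Normc.normc1. Qed.

Lemma cabs_eq0 z : (cabs z == 0) = (z == 0).
Proof.
apply/eqP/eqP => [/ComplexField.Normc.eq0_normc//|->]; exact: cabs0.
Qed.

Lemma cabs_gt0 z : (0 < cabs z) = (z != 0).
Proof. by rewrite lt_def cabs_eq0 cabs_ge0 andbT. Qed.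

Lemma cabsM z w : cabs (z * w) = cabs z * cabs w.
Proof. exact: ComplexField.Normc.normcM. Qed.

Lemma cabsV z : cabs z^-1 = (cabs z)^-1.
Proof. exact: ComplexField.Normc.normcV. Qed.

Lemma cabs_div z w : cabs (z / w) = cabs z / cabs w.
Proof. by rewrite cabsM cabsV. Qed.

Lemma cabsX z n : cabs (z ^+ n) = cabs z ^+ n.
Proof. by elim: n => [|n IH]; rewrite ?expr0 ?cabs1// !exprS cabsM IH. Qed.

Lemma cabsN z : cabs (- z) = cabs z.
Proof. by apply: complexI; rewrite -!normE normrN. Qed.

Lemma cabsC z w : cabs (z - w) = cabs (w - z).
Proof. by rewrite -cabsN opprB. Qed.

Lemma cabsD z w : cabs (z + w) <= cabs z + cabs w.
Proof. by rewrite -lecR rmorphD -!normE; exact: ler_normD. Qed.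

Lemma cabsB z w : cabs (z - w) <= cabs z + cabs w.
Proof. by rewrite -[cabs w]cabsN; exact: cabsD. Qed.

Lemma cabs_real x : cabs x%:C = `|x|.
Proof. by rewrite /cabs /= expr0n/= addr0 sqrtr_sqr. Qed.

Lemma cabs_sqr z : cabs z ^+ 2 = complex.Re z ^+ 2 + complex.Im z ^+ 2.
Proof. by case: z => a b /=; rewrite sqr_sqrtr// addr_ge0// sqr_ge0. Qed.

Lemma ge_cabs_Re z : `|complex.Re z| <= cabs z.
Proof. by rewrite -lecR -normE; exact: normc_ge_Re. Qed.

Lemma ge_cabs_Im z : `|complex.Im z| <= cabs z.
Proof.
by rewrite -ler_sqr ?nnegrE ?cabs_ge0// cabs_sqr real_normK ?num_real// lerDr sqr_ge0.
Qed.

Lemma cabs_le_ReIm z : cabs z <= `|complex.Re z| + `|complex.Im z|.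
Proof.
rewrite -ler_sqr ?nnegrE ?cabs_ge0 ?addr_ge0// cabs_sqr sqrrD.
by rewrite !real_normK ?num_real// lerD2r lerDl mulrn_wge0// mulr_ge0.
Qed.

Lemma Re_le_cabs z : complex.Re z <= cabs z.
Proof. exact: le_trans (ler_norm _) (ge_cabs_Re z). Qed.

Lemma ReD z w : complex.Re (z + w) = complex.Re z + complex.Re w.
Proof. by case: z w => a b [c d]. Qed.

Lemma ImD z w : complex.Im (z + w) = complex.Im z + complex.Im w.
Proof. by case: z w => a b [c d]. Qed.

Lemma ReN z : complex.Re (- z) = - complex.Re z.
Proof. by case: z. Qed.

Lemma ImN z : complex.Im (- z) = - complex.Im z.
Proof. by case: z. Qed.

Lemma ReM z w :
  complex.Re (z * w) = complex.Re z * complex.Re w - complex.Im z * complex.Im w.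
Proof. by case: z w => a b [c d]. Qed.

Lemma ImM z w :
  complex.Im (z * w) = complex.Re z * complex.Im w + complex.Im z * complex.Re w.
Proof. by case: z w => a b [c d]. Qed.

Lemma cplxE z : z = complex.Re z +i* complex.Im z.
Proof. by case: z. Qed.

Lemma cplx_eq z w :
  complex.Re z = complex.Re w -> complex.Im z = complex.Im w -> z = w.
Proof. by case: z w => a b [c d] /= -> ->. Qed.

Lemma conj_mul_self z : z^* * z = (cabs z ^+ 2)%:C.
Proof. by rewrite cabs_sqr; case: z => a b; apply: cplx_eq => /=; ring. Qed.

End cabs_theory.

Local Notation hol F z := (derivable (F : _[i]^o -> _[i]^o) z 1).

Section holomorphy.
Context {R : realType}.
Local Notation C := R[i].
Implicit Types (F G : C -> C) (z w : C).

Lemma nbhsC_cabs (z : C) (P : set C) :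
  nbhs (z : C^o) P <-> exists2 d : R, 0 < d & forall w, cabs (w - z) < d -> P w.
Proof.
split=> [/nbhs_ballP[e /= e0 zP]|[d d0 zP]].
- exists (complex.Re e); first by move: e0; rewrite ltcE => /andP[].
  move=> w wz; apply: zP; rewrite -ball_normE /= distrC normE ltcE /=.
  by rewrite wz andbT; move: e0; rewrite ltcE => /andP[].
- apply/nbhs_ballP; exists d%:C; first by rewrite /= ltcR.
  by move=> w; rewrite -ball_normE /= distrC normE ltcR; exact: zP.
Qed.

Lemma cvgC_cabs (T : Type) (X : set_system T) (FX : Filter X) (f : T -> C) (l : C) :
  (f t @[t --> X] --> (l : C^o)) <->
  (forall e : R, 0 < e -> \forall t \near X, cabs (f t - l) < e).
Proof.
split=> [fl e e0|fl].
- apply: (fl [set w | cabs (w - l) < e]); apply/nbhsC_cabs.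
  by exists e.
- move=> A /nbhsC_cabs[d d0 lA]; have := fl d d0.
  by apply: filterS => t; exact: lA.
Qed.

Lemma contC_cabs F z : {for z, continuous (F : C^o -> C^o)} <->
  (forall e : R, 0 < e ->
    exists2 d : R, 0 < d & forall w, cabs (w - z) < d -> cabs (F w - F z) < e).
Proof.
have cF := @cvgC_cabs C^o (nbhs (z : C^o)) (nbhs_filter (z : C^o)) F (F z).
split=> [/cF Fz e e0|Fz].
  by have /nbhsC_cabs[d d0 zF] := Fz _ e0; exists d.
by apply/cF => e /Fz[d d0 zF]; apply/nbhsC_cabs; exists d.
Qed.

Lemma hol_cont F z : hol F z -> {for z, continuous (F : C^o -> C^o)}.
Proof. by move=> /derivable1_diffP /differentiable_continuous. Qed.

(** Clearing the denominator of the difference quotient makes the estimate hold at [w = z] as well,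
    which saves a case split at each later use. *)
Lemma holP F z : hol F z <-> exists D : C, forall e : R, 0 < e ->
  exists2 d : R, 0 < d & forall w, cabs (w - z) < d ->
    cabs (F w - F z - D * (w - z)) <= e * cabs (w - z).
Proof.
split.
- move=> /cvg_ex[D FD]; exists D => e e0.
  have /cvgC_cabs/(_ _ e0) := FD.
  rewrite near_withinE => /nbhsC_cabs[d d0 zF]; exists d => // w wz.
  have [->|wNz] := eqVneq w z; first by rewrite !subrr mulr0 subr0 cabs0 mulr0.
  have wz0 : w - z != 0 by rewrite subr_eq0.
  have := zF (w - z); rewrite subr0 => /(_ wz wz0) /ltW.
  have -> : (w - z)^-1 *: ((F \o shift z) ((w - z) *: 1) - F z : C^o) - D =
     (F w - F z - D * (w - z)) / (w - z).
    rewrite /= /GRing.scale /= mulr1 subrK mulrBl mulfK//; congr (_ - _).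
    by rewrite mulrC.
  by rewrite cabs_div ler_pdivrMr ?cabs_gt0.
- move=> [D FD]; apply/cvg_ex; exists D; apply/cvgC_cabs => e e0.
  have [d d0 zF] := FD _ (divr_gt0 e0 (ltr0n R 2)).
  rewrite near_withinE; apply/nbhsC_cabs; exists d => // h; rewrite subr0 => hd h0.
  have := zF (h + z); rewrite addrK => /(_ hd).
  have -> : h^-1 *: ((F \o shift z) (h *: 1) - F z : C^o) - D =
     (F (h + z) - F z - D * h) / h.
    rewrite /= /GRing.scale /= mulr1 mulrBl mulfK//; congr (_ - _).
    by rewrite mulrC.
  rewrite cabs_div -ler_pdivrMr ?cabs_gt0// => /le_lt_trans; apply.
  by rewrite ltr_pdivrMr// mulr_natr mulr2n ltrDr.
Qed.

Lemma hol_cst (c : C) z : hol (fun=> c) z.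
Proof. exact: derivable_cst. Qed.

Lemma hol_id z : hol id z.
Proof. exact: derivable_id. Qed.

Lemma holD F G z : hol F z -> hol G z -> hol (fun w => F w + G w) z.
Proof. exact: derivableD. Qed.

Lemma holN F z : hol F z -> hol (fun w => - F w) z.
Proof. exact: derivableN. Qed.

Lemma holB F G z : hol F z -> hol G z -> hol (fun w => F w - G w) z.
Proof. exact: derivableB. Qed.

Lemma holM F G z : hol F z -> hol G z -> hol (fun w => F w * G w) z.
Proof. exact: derivableM. Qed.

Lemma holX F n z : hol F z -> hol (fun w => F w ^+ n) z.
Proof.
move=> hF; elim: n => [|n IH]; first exact: hol_cst.
by under eq_fun do rewrite exprS; exact: holM.
Qed.

Lemma holV F z : F z != 0 -> hol F z -> hol (fun w => (F w)^-1) z.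
Proof. exact: derivableV. Qed.

Lemma hol_comp F G z : hol F z -> hol G (F z) -> hol (fun w => G (F w)) z.
Proof.
move=> /derivable1_diffP hF /derivable1_diffP hG.
by apply/derivable1_diffP; exact: (differentiable_comp hF hG).
Qed.

End holomorphy.

(** * The complex exponential *)

Section complex_exponential.
Context {R : realType}.
Local Notation C := R[i].

Lemma derive_littleo (f : R -> R) (x D : R) : is_derive x 1 f D ->
  forall e, 0 < e -> exists2 d, 0 < d & forall y, `|y - x| < d ->
    `|f y - f x - D * (y - x)| <= e * `|y - x|.
Proof.
move=> [/cvg_ex[D' fD'] fD] e e0.
have DE : D' = D by rewrite -fD; apply/esym/cvg_lim.
move/cvgrPdist_lt: fD' => /(_ _ e0); rewrite near_withinE DE.
move=> /nbhs_ballP[d /= d0 zF]; exists d => // y yx.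
have [->|yNx] := eqVneq y x; first by rewrite !subrr mulr0 subr0 normr0 mulr0.
have yx0 : y - x != 0 by rewrite subr_eq0.
have := zF (y - x); rewrite -ball_normE /= sub0r normrN => /(_ yx yx0) /ltW.
rewrite /GRing.scale /= mulr1 subrK => H.
have -> : f y - f x - D * (y - x) = - (D - (y - x)^-1 * (f y - f x)) * (y - x).
  by rewrite mulNr mulrBl mulrAC mulVf// mul1r; ring.
by rewrite normrM normrN ler_wpM2r.
Qed.

Definition cexp (z : C) : C :=
  (expR (complex.Re z) * cos (complex.Im z)) +i* (expR (complex.Re z) * sin (complex.Im z)).

Lemma cexpD z w : cexp (z + w) = cexp z * cexp w.
Proof.
by apply: cplx_eq; rewrite /= ?ReM ?ImM ReD ImD expRD ?cosD ?sinD /=; ring.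
Qed.

Lemma cexp0 : cexp 0 = 1.
Proof. by rewrite /cexp /= expR0 cos0 sin0 mulr1 mulr0. Qed.

Lemma cexp_neq0 z : cexp z != 0.
Proof.
apply/eqP => z0; have /eqP := cexpD z (- z).
by rewrite subrr cexp0 z0 mul0r oner_eq0.
Qed.

Lemma cabs_cexp z : cabs (cexp z) = expR (complex.Re z).
Proof.
apply/eqP; rewrite -(@eqrXn2 _ 2) ?cabs_ge0 ?expR_ge0// cabs_sqr /=.
by rewrite !exprMn -mulrDr cos2Dsin2 mulr1.
Qed.

Lemma cexp_real (x : R) : cexp x%:C = (expR x)%:C.
Proof. by rewrite /cexp /= cos0 sin0 mulr1 mulr0. Qed.

Lemma cexp_periodic z : cexp (z + 0 +i* (2 * pi)) = cexp z.
Proof. by rewrite cexpD [cexp (0 +i* _)]/cexp /= expR0 mulr_natl cos2pi sin2pi !mul1r mulr1. Qed.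

(** At 0 the derivative comes from the first-order expansions of [expR], [cos] and [sin]; the
    functional equation [cexpD] transports it to every other point. *)
Lemma hol_cexp z : hol cexp z.
Proof.
have cexp_at0 : hol cexp 0.
  apply/holP; exists 1 => e e0.
  (* The error is at most 3 e' |w| in the real part and 5 e' |w| in the imaginary part, hence the
     8. *)
  pose e' := Num.min 1 (e / 8).
  have e'0 : 0 < e' by rewrite lt_min ltr01/= divr_gt0.
  have e'1 : e' <= 1 by rewrite ge_min lexx.
  have e'e : e' <= e / 8 by rewrite ge_min lexx orbT.
  have [d1 d10 Hexp] := derive_littleo (is_derive_expR (0 : R)) e'0.
  have [d2 d20 Hcos] := derive_littleo (is_derive_cos (0 : R)) e'0.
  have [d3 d30 Hsin] := derive_littleo (is_derive_sin (0 : R)) e'0.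
  pose d := Num.min (Num.min d1 d2) (Num.min d3 (e' / 2)).
  exists d; first by rewrite !lt_min d10 d20 d30 divr_gt0.
  move=> w; rewrite subr0 cexp0 mul1r.
  rewrite !lt_min => /andP[/andP[wd1 wd2] /andP[wd3 wd4]].
  pose x := complex.Re w; pose y := complex.Im w.
  have xw : `|x| <= cabs w := ge_cabs_Re w.
  have yw : `|y| <= cabs w := ge_cabs_Im w.
  have := Hexp x; rewrite subr0 expR0 mul1r => /(_ (le_lt_trans xw wd1)) {}Hexp.
  have := Hcos y; rewrite subr0 cos0 sin0 oppr0 mul0r subr0 => /(_ (le_lt_trans yw wd2)) {}Hcos.
  have := Hsin y; rewrite subr0 cos0 sin0 mul1r subr0 => /(_ (le_lt_trans yw wd3)) {}Hsin.
  have := cabs_ge0 w; move: (cabs w) xw yw wd4 => c xw yw wd4 c0.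
  apply: (le_trans (cabs_le_ReIm _)).
  rewrite !(ReD, ImD, ReN, ImN) /= -/x -/y.
  rewrite oppr0 addr0.
  move: (expR x) (cos y) (sin y) (cos_max y) Hexp Hcos Hsin => E Co Si Coy Hexp Hcos Hsin.
  have E1 : `|E * Co - 1 - x| <= `|E - 1 - x| + (1 + `|x|) * `|Co - 1|.
    have -> : E * Co - 1 - x = (E - 1 - x) * Co + (1 + x) * (Co - 1) by ring.
    apply: (le_trans (ler_normD _ _)); rewrite !normrM lerD//.
      by rewrite ler_piMr.
    by rewrite ler_wpM2r// (le_trans (ler_normD _ _))// normr1.
  have E2 : `|E * Si - y| <= `|E - 1| * `|Si| + `|Si - y|.
    have -> : E * Si - y = (E - 1) * Si + (Si - y) by ring.
    by apply: (le_trans (ler_normD _ _)); rewrite normrM.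
  have E3 : `|E - 1| <= `|E - 1 - x| + `|x|.
    by rewrite -{1}[E - 1](subrK x) ler_normD.
  have E4 : `|Si| <= `|Si - y| + `|y|.
    by rewrite -{1}[Si](subrK y) ler_normD.
  move: (normr_ge0 x) (normr_ge0 y) (normr_ge0 Si) (normr_ge0 (E - 1)) (normr_ge0 (Co - 1)).
  move: `|x| `|y| `|E * Co - 1 - x| `|E * Si - y| `|E - 1| `|E - 1 - x|
    `|Si| `|Si - y| `|Co - 1| xw yw Hexp Hcos Hsin E1 E2 E3 E4.
  move=> X Y t1 t2 u1 u2 v1 v2 s xw yw Hexp Hcos Hsin E1 E2 E3 E4 X0 Y0 v0 u0 s0.
  have X1 : X <= 1 by lra.
  have e'X : e' * X <= e' * c by rewrite ler_wpM2l// ltW.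
  have e'Y : e' * Y <= e' * c by rewrite ler_wpM2l// ltW.
  have e'c : e' * c <= e / 8 * c by rewrite ler_wpM2r.
  have p1 : (1 + X) * s <= 2 * s by rewrite ler_wpM2r//; lra.
  have v1c : v1 <= 2 * c.
    have : e' * Y <= Y by rewrite ler_piMl.
    lra.
  have u1e : u1 <= 2 * e'.
    have : e' * X <= e' * 1 by rewrite ler_wpM2l// ltW.
    lra.
  have p2 : u1 * v1 <= 2 * e' * (2 * c) by rewrite ler_pM.
  have : 2 * e' * (2 * c) = 4 * (e' * c) by ring.
  lra.
apply/holP; move/holP : cexp_at0 => [D FD]; exists (cexp z * D) => e e0.
have [|d d0 {}FD] := FD (e / expR (complex.Re z)); first by rewrite divr_gt0 ?expR_gt0.
exists d => // w wz; have := FD (w - z); rewrite subr0 => /(_ wz) H.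
have -> : cexp w - cexp z - cexp z * D * (w - z) =
    cexp z * (cexp (w - z) - cexp 0 - D * (w - z)).
  have -> : cexp w = cexp z * cexp (w - z) by rewrite -cexpD subrKC.
  by rewrite cexp0; ring.
rewrite cabsM cabs_cexp mulrC -ler_pdivlMr ?expR_gt0//.
by rewrite mulrAC.
Qed.

End complex_exponential.

(** * Integrals over segments and nested rectangles *)

Section interval_integral.
Context {R : realType}.
Implicit Types (a b m k e : R) (f g : R -> R).

Definition itg a b f : R := \int[lebesgue_measure]_(x in `[a, b]) f x.

Definition cont_on a b f := forall x, a <= x <= b -> {for x, continuous f}.

Lemma cont_on_integrable a b f : cont_on a b f ->
  lebesgue_measure.-integrable `[a, b]%classic (EFin \o f).
Proof.
move=> cf; apply: continuous_compact_integrable; first exact: segment_compact.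
apply: continuous_in_subspaceT => x; rewrite inE /= in_itv /= => xab.
exact: cf.
Qed.

Lemma itg_split a m b f : a <= m -> m <= b -> cont_on a b f ->
  itg a b f = itg a m f + itg m b f.
Proof.
move=> am mb /cont_on_integrable cf.
have := Rintegral_itvB cf (x := m); rewrite !bnd_simp => /(_ am mb).
rewrite Rintegral_itv_obnd_cbnd; last first.
  by apply: integrableS cf => //; apply: subset_itvr; rewrite bnd_simp.
by rewrite /itg => <-; rewrite addrC subrK.
Qed.

Lemma itgD a b f g : cont_on a b f -> cont_on a b g ->
  itg a b (fun x => f x + g x) = itg a b f + itg a b g.
Proof. by move=> /cont_on_integrable cf /cont_on_integrable cg; exact: RintegralD. Qed.

Lemma itgZ a b k f : cont_on a b f ->
  itg a b (fun x => k * f x) = k * itg a b f.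
Proof. by move=> /cont_on_integrable cf; exact: RintegralZl. Qed.

Lemma cont_on_cst a b k : cont_on a b (fun=> k).
Proof. by move=> x _; exact: cvg_cst. Qed.

Lemma cont_onB a b f g : cont_on a b f -> cont_on a b g ->
  cont_on a b (fun x => f x - g x).
Proof. by move=> cf cg x xab; apply: cvgB; [exact: cf|exact: cg]. Qed.

Lemma itg_cst a b k : a <= b -> itg a b (fun=> k) = k * (b - a).
Proof.
move=> ab; rewrite /itg Rintegral_cst//; congr (_ * _).
have := @lebesgue_measure_itv R `[a, b]; rewrite /= => ->.
rewrite lte_fin.
by move: ab; rewrite le_eqVlt => /predU1P[->|->//]; rewrite ltxx subrr.
Qed.

Lemma itg_le a b f g : cont_on a b f -> cont_on a b g ->
  (forall x, a <= x <= b -> f x <= g x) -> itg a b f <= itg a b g.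
Proof.
by move=> /cont_on_integrable cf /cont_on_integrable cg fg; exact: le_Rintegral.
Qed.

Lemma itg_near_cst a b f k e : a <= b -> cont_on a b f ->
  (forall x, a <= x <= b -> `|f x - k| <= e) -> `|itg a b f - k * (b - a)| <= e * (b - a).
Proof.
move=> ab cf fke; rewrite ler_norml lerBrDr lerBlDr -mulNr -!mulrDl -!itg_cst//.
by apply/andP; split; apply: itg_le => //; try exact: cont_on_cst;
  move=> x /fke; rewrite ler_norml; lra.
Qed.

Lemma eq_itg a b f g : (forall x, a <= x <= b -> f x = g x) -> itg a b f = itg a b g.
Proof.
by move=> fg; apply: eq_Rintegral => x; rewrite inE /= in_itv; exact: fg.
Qed.

End interval_integral.

Section bisection.
Context {R : realType}.
Implicit Types (a b c d w h : R).

(* The halving step of Goursat's proof: [Q n a c] speaks about the rectangle of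
   sides [w / 2 ^ n] and [h / 2 ^ n] with lower left corner [(a, c)]. *)
Lemma bisection (Q : nat -> R -> R -> Prop) a c w h :
  0 <= w -> 0 <= h -> Q 0%N a c ->
  (forall n a' c', a <= a' -> a' + w / 2 ^+ n <= a + w ->
     c <= c' -> c' + h / 2 ^+ n <= c + h -> Q n a' c' ->
     exists a'' c'', [/\ a'' = a' \/ a'' = a' + w / 2 ^+ n.+1,
       c'' = c' \/ c'' = c' + h / 2 ^+ n.+1 & Q n.+1 a'' c'']) ->
  exists x y, [/\ a <= x <= a + w, c <= y <= c + h &
    forall n, exists a' c', [/\ a' <= x <= a' + w / 2 ^+ n,
      c' <= y <= c' + h / 2 ^+ n, a <= a' /\ a' + w / 2 ^+ n <= a + w,
      c <= c' /\ c' + h / 2 ^+ n <= c + h & Q n a' c']].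
Proof.
move=> w0 h0 Q0 step.
pose ok n (p : R * R) := [/\ a <= p.1, p.1 + w / 2 ^+ n <= a + w,
  c <= p.2, p.2 + h / 2 ^+ n <= c + h & Q n p.1 p.2].
have half (t : R) n : t / 2 ^+ n = t / 2 ^+ n.+1 + t / 2 ^+ n.+1.
  rewrite -mulrDl exprS invfM mulrA [in RHS]mulrDl; congr (_ * _); lra.
have pos (t : R) n : 0 <= t -> 0 <= t / 2 ^+ n by move=> t0; rewrite divr_ge0// exprn_ge0.
(* The successor map is total so that [choice] applies; it is constrained only on pairs satisfying
   the invariant [ok]. *)
have /choice[nxt nxtP] : forall np : nat * (R * R), exists q : R * R,
    ok np.1 np.2 -> ok np.1.+1 q /\
    ((q.1 = np.2.1 \/ q.1 = np.2.1 + w / 2 ^+ np.1.+1) /\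
     (q.2 = np.2.2 \/ q.2 = np.2.2 + h / 2 ^+ np.1.+1)).
  move=> [n [a' c']] /=; have [nok|nok] := pselect (ok n (a', c')); last first.
    by exists (a', c') => /nok.
  case: (nok) => /= h1 h2 h3 h4 h5; have [a'' [c'' [ea ec q]]] := step _ _ _ h1 h2 h3 h4 h5.
  exists (a'', c'') => _; split => //; split => //=.
  - by case: ea => ->//; rewrite (le_trans h1)// lerDl pos.
  - have := half w n; have := pos w n.+1 w0; case: ea => ->; lra.
  - by case: ec => ->//; rewrite (le_trans h3)// lerDl pos.
  - have := half h n; have := pos h n.+1 h0; case: ec => ->; lra.
pose fix p n := if n is m.+1 then nxt (m, p m) else (a, c).
have okp n : ok n (p n).
  elim: n => [|n IH]; first by split; rewrite //= expr0 divr1.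
  by have [] := nxtP (n, p n) IH.
have stp n : ((p n.+1).1 = (p n).1 \/ (p n.+1).1 = (p n).1 + w / 2 ^+ n.+1) /\
     ((p n.+1).2 = (p n).2 \/ (p n.+1).2 = (p n).2 + h / 2 ^+ n.+1).
  by have [] := nxtP (n, p n) (okp n).
(* The common point of the nested intervals is the supremum of their left ends. *)
have nest (u : nat -> R) (t : R) : 0 <= t ->
    (forall n, u n.+1 = u n \/ u n.+1 = u n + t / 2 ^+ n.+1) ->
    exists x, forall n, u n <= x <= u n + t / 2 ^+ n.
  move=> t0 su.
  have mono n k : u n <= u (n + k)%N /\ u (n + k)%N + t / 2 ^+ (n + k) <= u n + t / 2 ^+ n.
    elim: k => [|k [IH1 IH2]]; first by rewrite addn0.
    rewrite addnS; have := half t (n + k)%N; have := pos t (n + k).+1 t0.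
    by case: (su (n + k)%N) => ->; lra.
  have ub n : ubound (range u) (u n + t / 2 ^+ n).
    move=> _ [m _ <-]; have [nm|mn] := leqP n m.
      have [_] := mono n (m - n)%N; rewrite subnKC//; have := pos t m t0; lra.
    have [+ _] := mono m (n - m)%N; rewrite subnKC 1?ltnW//; have := pos t n t0; lra.
  exists (sup (range u)) => n; apply/andP; split.
    by apply: ub_le_sup; [exists (u 0%N + t / 2 ^+ 0); exact: ub|exists n].
  by apply: ge_sup; [exists (u 0%N); exists 0%N|exact: ub].
have [x xP] := nest (fun n => (p n).1) w w0 (fun n => (stp n).1).
have [y yP] := nest (fun n => (p n).2) h h0 (fun n => (stp n).2).
exists x, y; split.
- by have := xP 0%N; rewrite expr0 divr1.
- by have := yP 0%N; rewrite expr0 divr1.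
- move=> n; exists (p n).1, (p n).2; have [h1 h2 h3 h4 h5] := okp n.
  by split.
Qed.

End bisection.

(** * Goursat's lemma and the mean value property *)

Section goursat.
Context {R : realType}.
Local Notation C := R[i].
Implicit Types (g h : C -> C) (a b c d u v x y : R) (z w : C).

Lemma cont_ReIm_line g (l : R -> C) x : (forall y, cabs (l y - l x) <= `|y - x|) ->
  {for l x, continuous (g : C^o -> C^o)} ->
  {for x, continuous (fun y => complex.Re (g (l y)))} /\
  {for x, continuous (fun y => complex.Im (g (l y)))}.
Proof.
move=> lx /contC_cabs cg.
have H e : 0 < e -> \forall y \near x, cabs (g (l x) - g (l y)) < e.
  move=> /cg[d d0 zd]; apply/nbhs_ballP; exists d => // y.
  by rewrite /ball /= => xy; rewrite cabsC zd// (le_lt_trans (lx y))// distrC.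
by split; apply/cvgrPdist_lt => e /H; apply: filterS => y; apply: le_lt_trans;
  rewrite -?ReN -?ReD -?ImN -?ImD ?ge_cabs_Re ?ge_cabs_Im.
Qed.

Lemma cont_v g u v : {for u +i* v, continuous (g : C^o -> C^o)} ->
  {for v, continuous (fun y => complex.Re (g (u +i* y)))} /\
  {for v, continuous (fun y => complex.Im (g (u +i* y)))}.
Proof.
apply: (@cont_ReIm_line g (fun y => u +i* y)) => y.
by apply: (le_trans (cabs_le_ReIm _)); rewrite /= subrr normr0 add0r.
Qed.

Lemma cont_u g u v : {for u +i* v, continuous (g : C^o -> C^o)} ->
  {for u, continuous (fun x => complex.Re (g (x +i* v)))} /\
  {for u, continuous (fun x => complex.Im (g (x +i* v)))}.
Proof.
apply: (@cont_ReIm_line g (fun x => x +i* v)) => y.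
by apply: (le_trans (cabs_le_ReIm _)); rewrite /= subrr normr0 addr0.
Qed.

(** The imaginary part of the counterclockwise contour integral of [g]. On the vertical sides dz = i
    dy, so the real part of [g] appears there, which is the quantity averaged in [mean]. *)
Definition rect_int g a b c d : R :=
  itg a b (fun x => complex.Im (g (x +i* c)) - complex.Im (g (x +i* d))) +
  itg c d (fun y => complex.Re (g (b +i* y)) - complex.Re (g (a +i* y))).

Definition hol_rect g a b c d := forall x y, a <= x <= b -> c <= y <= d -> hol g (x +i* y).

Lemma hol_rect_cont_u g a b c d y : hol_rect g a b c d -> c <= y <= d ->
  cont_on a b (fun x => complex.Im (g (x +i* y))).
Proof. by move=> hg cyd x axb; apply: (cont_u _).2; apply: hol_cont; exact: hg. Qed.

Lemma hol_rect_cont_v g a b c d x : hol_rect g a b c d -> a <= x <= b ->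
  cont_on c d (fun y => complex.Re (g (x +i* y))).
Proof. by move=> hg axb y cyd; apply: (cont_v _).1; apply: hol_cont; exact: hg. Qed.

Lemma rect_int_splitx g a b c d m : a <= m <= b -> c <= d -> hol_rect g a b c d ->
  rect_int g a b c d = rect_int g a m c d + rect_int g m b c d.
Proof.
move=> /andP[am mb] cd hg; have ab := le_trans am mb.
have cu y (cyd : c <= y <= d) := hol_rect_cont_u hg cyd.
have cv x (axb : a <= x <= b) := hol_rect_cont_v hg axb.
rewrite /rect_int (@itg_split _ a m b)//; last first.
  by apply: cont_onB; apply: cu; rewrite lexx cd.
rewrite addrACA; congr (_ + _).
rewrite -itgD; last 2 first.
- by apply: cont_onB; apply: cv; rewrite ?lexx ?am ?mb ?ab.
- by apply: cont_onB; apply: cv; rewrite ?lexx ?am ?mb ?ab.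
by apply: eq_itg => y _; ring.
Qed.

Lemma rect_int_splity g a b c d m : a <= b -> c <= m <= d -> hol_rect g a b c d ->
  rect_int g a b c d = rect_int g a b c m + rect_int g a b m d.
Proof.
move=> ab /andP[cm md] hg; have cd := le_trans cm md.
have cu y (cyd : c <= y <= d) := hol_rect_cont_u hg cyd.
have cv x (axb : a <= x <= b) := hol_rect_cont_v hg axb.
rewrite /rect_int [X in _ + X](@itg_split _ c m d)//; last first.
  by apply: cont_onB; apply: cv; rewrite lexx ab.
rewrite addrACA; congr (_ + _).
rewrite -itgD; last 2 first.
- by apply: cont_onB; apply: cu; rewrite ?lexx ?cm ?md ?cd.
- by apply: cont_onB; apply: cu; rewrite ?lexx ?cm ?md ?cd.
by apply: eq_itg => y _; ring.
Qed.

(** An affine function has contour integral 0: its differences across opposite sides contribute Re D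
    (c - d)(b - a) and Re D (b - a)(d - c), which cancel. What is left is the remainder, at most e
    times the half perimeter at each boundary point. *)
Lemma rect_int_small g a b c d z0 D e : a <= b -> c <= d -> hol_rect g a b c d ->
  a <= complex.Re z0 <= b -> c <= complex.Im z0 <= d -> 0 <= e ->
  (forall w, a <= complex.Re w <= b -> c <= complex.Im w <= d ->
    cabs (g w - g z0 - D * (w - z0)) <= e * cabs (w - z0)) ->
  `|rect_int g a b c d| <= 2 * e * (b - a + (d - c)) ^+ 2.
Proof.
move=> ab cd hg z0x z0y e0 H.
have cu y (cyd : c <= y <= d) := hol_rect_cont_u hg cyd.
have cv x (axb : a <= x <= b) := hol_rect_cont_v hg axb.
set s := b - a + (d - c).
have s0 : 0 <= s by rewrite /s; lra.
have Hs w : a <= complex.Re w <= b -> c <= complex.Im w <= d ->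
    cabs (g w - g z0 - D * (w - z0)) <= e * s.
  move=> wx wy; apply: (le_trans (H w wx wy)); rewrite ler_wpM2l//.
  apply: (le_trans (cabs_le_ReIm _)); rewrite ReD ImD ReN ImN /s lerD// ler_norml.
    by apply/andP; split; lra.
  by apply/andP; split; lra.
have H1 : `|itg a b (fun x => complex.Im (g (x +i* c)) - complex.Im (g (x +i* d)))
    - complex.Re D * (c - d) * (b - a)| <= 2 * (e * s) * (b - a).
  apply: itg_near_cst => //; first by apply: cont_onB; apply: cu; rewrite lexx cd.
  move=> x axb.
  have h1 : cabs (g (x +i* c) - g z0 - D * (x +i* c - z0)) <= e * s.
    by apply: Hs; rewrite //= lexx cd.
  have h2 : cabs (g (x +i* d) - g z0 - D * (x +i* d - z0)) <= e * s.
    by apply: Hs; rewrite //= lexx cd.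
  have -> : complex.Im (g (x +i* c)) - complex.Im (g (x +i* d)) - complex.Re D * (c - d) =
    complex.Im ((g (x +i* c) - g z0 - D * (x +i* c - z0)) -
      (g (x +i* d) - g z0 - D * (x +i* d - z0))).
    rewrite !(ImD, ImN, ImM, ReD, ReN) /=; ring.
  rewrite (le_trans (ge_cabs_Im _))// (le_trans (cabsB _ _))//; lra.
have H2 : `|itg c d (fun y => complex.Re (g (b +i* y)) - complex.Re (g (a +i* y)))
    - complex.Re D * (b - a) * (d - c)| <= 2 * (e * s) * (d - c).
  apply: itg_near_cst => //; first by apply: cont_onB; apply: cv; rewrite lexx ab.
  move=> y cyd.
  have h1 : cabs (g (b +i* y) - g z0 - D * (b +i* y - z0)) <= e * s.
    by apply: Hs; rewrite //= lexx ab.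
  have h2 : cabs (g (a +i* y) - g z0 - D * (a +i* y - z0)) <= e * s.
    by apply: Hs; rewrite //= lexx ab.
  have -> : complex.Re (g (b +i* y)) - complex.Re (g (a +i* y)) - complex.Re D * (b - a) =
    complex.Re ((g (b +i* y) - g z0 - D * (b +i* y - z0)) -
      (g (a +i* y) - g z0 - D * (a +i* y - z0))).
    rewrite !(ImD, ImN, ReM, ReD, ReN) /=; ring.
  rewrite (le_trans (ge_cabs_Re _))// (le_trans (cabsB _ _))//; lra.
rewrite /rect_int.
move: (itg a b _) (itg c d _) H1 H2 => I1 I2 H1 H2.
have -> : I1 + I2 = (I1 - complex.Re D * (c - d) * (b - a)) +
  (I2 - complex.Re D * (b - a) * (d - c)) by ring.
rewrite (le_trans (ler_normD _ _))// (le_trans (lerD H1 H2))// -mulrDr -/s.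
by rewrite le_eqVlt; apply/orP; left; apply/eqP; ring.
Qed.

(** Some quarter of each rectangle carries at least a quarter of the integral. At the limit point of
    the chosen quarters differentiability bounds the integral by an arbitrarily small multiple of
    the squared half perimeter, which also drops by a factor 4 at each step. *)
Theorem goursat g a b c d : a <= b -> c <= d -> hol_rect g a b c d ->
  rect_int g a b c d = 0.
Proof.
move=> ab cd hg; apply/eqP; rewrite -normr_eq0 eq_le normr_ge0 andbT.
set w := b - a; set h := d - c.
have w0 : 0 <= w by rewrite subr_ge0.
have h0 : 0 <= h by rewrite subr_ge0.
have bE : b = a + w by rewrite /w; ring.
have dE : d = c + h by rewrite /h; ring.
have half (t : R) n : t / 2 ^+ n = t / 2 ^+ n.+1 + t / 2 ^+ n.+1.
  rewrite -mulrDl exprS invfM mulrA [in RHS]mulrDl; congr (_ * _); lra.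
have pos (t : R) n : 0 <= t -> 0 <= t / 2 ^+ n.
  by move=> t0; rewrite divr_ge0// exprn_ge0.
set J0 := `|rect_int g a b c d|.
pose Q n a' c' :=
  J0 <= 4 ^+ n * `|rect_int g a' (a' + w / 2 ^+ n) c' (c' + h / 2 ^+ n)|.
have hsub a' b' c' d' : a <= a' -> b' <= b -> c <= c' -> d' <= d -> hol_rect g a' b' c' d'.
  move=> aa bb cc dd x y /andP[? ?] /andP[? ?]; apply: hg; apply/andP; split; lra.
have Q0 : Q 0%N a c by rewrite /Q !expr0 !divr1 mul1r -bE -dE.
have step n a' c' : a <= a' -> a' + w / 2 ^+ n <= a + w ->
     c <= c' -> c' + h / 2 ^+ n <= c + h -> Q n a' c' ->
     exists a'' c'', [/\ a'' = a' \/ a'' = a' + w / 2 ^+ n.+1,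
       c'' = c' \/ c'' = c' + h / 2 ^+ n.+1 & Q n.+1 a'' c''].
  move=> h1 h2 h3 h4; rewrite /Q; set w' := w / 2 ^+ n.+1; set h' := h / 2 ^+ n.+1.
  have w'0 : 0 <= w' by exact: pos.
  have h'0 : 0 <= h' by exact: pos.
  move: h2 h4; rewrite (half w) (half h) -/w' -/h' !addrA => h2 h4.
  rewrite (@rect_int_splitx g _ _ _ _ (a' + w')); last 3 first.
  - by apply/andP; split; lra.
  - lra.
  - by apply: hsub; lra.
  rewrite (@rect_int_splity g a' _ _ _ (c' + h')); last 3 first.
  - lra.
  - by apply/andP; split; lra.
  - by apply: hsub; lra.
  rewrite (@rect_int_splity g (a' + w') _ _ _ (c' + h')); last 3 first.
  - lra.
  - by apply/andP; split; lra.
  - by apply: hsub; lra.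
  set r1 := rect_int _ a' _ _ _; set r2 := rect_int _ a' _ _ _.
  set r3 := rect_int _ _ _ _ _; set r4 := rect_int _ _ _ _ _ => JQ.
  have E4 : (4 : R) ^+ n.+1 = 4 ^+ n * 4 by rewrite exprSr.
  have P4 : 0 <= (4 : R) ^+ n by rewrite exprn_ge0.
  apply: contrapT => nex.
  have n1 : 4 ^+ n.+1 * `|r1| < J0.
    by rewrite ltNge; apply/negP => ?; apply: nex; exists a', c'; split; auto.
  have n2 : 4 ^+ n.+1 * `|r2| < J0.
    by rewrite ltNge; apply/negP => ?; apply: nex; exists a', (c' + h'); split; auto.
  have n3 : 4 ^+ n.+1 * `|r3| < J0.
    by rewrite ltNge; apply/negP => ?; apply: nex; exists (a' + w'), c'; split; auto.
  have n4 : 4 ^+ n.+1 * `|r4| < J0.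
    by rewrite ltNge; apply/negP => ?; apply: nex; exists (a' + w'), (c' + h'); split; auto.
  have : `|r1 + r2 + (r3 + r4)| <= `|r1| + `|r2| + (`|r3| + `|r4|).
    by rewrite (le_trans (ler_normD _ _))// lerD// ler_normD.
  move=> /(ler_wpM2l P4); move: n1 n2 n3 n4 JQ; rewrite E4.
  move: (4 ^+ n) `|r1| `|r2| `|r3| `|r4| `|r1 + r2 + (r3 + r4)| => q t1 t2 t3 t4 t5.
  rewrite -![q * 4 * _]mulrA ![q * (4 * _)]mulrCA !mulrDr; lra.
have [x0 [y0 [x0P y0P subP]]] := bisection w0 h0 Q0 step.
have /holP[D HD] : hol g (x0 +i* y0) by apply: hg; rewrite ?bE ?dE.
apply/ler_addgt0Pr => e e0; rewrite add0r.
(* The factor 4 ^ n of the bisection cancels against the squared sides, so that 2 e' (w + h)^2 <= e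
   remains to be arranged; the added 1 covers the rectangle reduced to a point. *)
pose e' := e / (2 * (w + h) ^+ 2 + 1).
have den0 : 0 < 2 * (w + h) ^+ 2 + 1 by rewrite ltr_wpDl// mulr_ge0// sqr_ge0.
have e'0 : 0 < e' by rewrite divr_gt0.
have [r r0 Hr] := HD _ e'0.
have [n Hn] : exists n, (w + h) / 2 ^+ n < r.
  have h2 : `|2^-1 : R| < 1 by rewrite ger0_norm ?invr_ge0// invf_lt1// ltr1n.
  have /cvgrPdist_lt/(_ _ r0)[n _ /(_ n (leqnn n))] := cvg_geometric (w + h) h2.
  rewrite sub0r normrN /= exprVn => H.
  by exists n; exact: le_lt_trans (ler_norm _) H.
have [a' [c' [xa yc [aa' bb'] [cc' dd'] QJ]]] := subP n.
have wn := pos w n w0; have hn := pos h n h0.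
have small : `|rect_int g a' (a' + w / 2 ^+ n) c' (c' + h / 2 ^+ n)| <=
    2 * e' * (a' + w / 2 ^+ n - a' + (c' + h / 2 ^+ n - c')) ^+ 2.
  apply: (@rect_int_small g _ _ _ _ (x0 +i* y0) D) => //.
  - by rewrite lerDl.
  - by rewrite lerDl.
  - by apply: hsub => //; rewrite ?bE ?dE.
  - exact: ltW.
  move=> z zx zy; apply: Hr; apply: (le_lt_trans (cabs_le_ReIm _)).
  apply: le_lt_trans Hn; rewrite ReD ImD ReN ImN /= mulrDl lerD// ler_norml.
    by apply/andP; split; lra.
  by apply/andP; split; lra.
apply: (le_trans QJ); rewrite (le_trans (ler_wpM2l _ small)) ?exprn_ge0//.
have -> : 4 ^+ n * (2 * e' * (a' + w / 2 ^+ n - a' + (c' + h / 2 ^+ n - c')) ^+ 2) =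
    2 * e' * (w + h) ^+ 2.
  have -> : a' + w / 2 ^+ n - a' + (c' + h / 2 ^+ n - c') = (w + h) / 2 ^+ n by ring.
  rewrite expr_div_n -exprM mulnC exprM (_ : 2 ^+ 2 = 4); last by ring.
  by rewrite mulrCA; congr (_ * _); rewrite mulrCA divff ?mulr1// expf_neq0.
have -> : 2 * e' * (w + h) ^+ 2 = e * (2 * (w + h) ^+ 2) / (2 * (w + h) ^+ 2 + 1).
  by rewrite /e'; ring.
rewrite ler_pdivrMr//.
by rewrite ler_wpM2l ?(ltW e0)//; lra.
Qed.


End goursat.

(** * Circle means in the logarithmic coordinate *)

Section circle_means.
Context {R : realType}.
Local Notation C := R[i].
Implicit Types (g h F : C -> C) (u v x y r k : R) (z w : C).

(* In the coordinate [w = log z] the circle of radius [expR u] is the segment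
   [u + i [0, 2 pi]]. *)
Definition mean g u : R := itg 0 (2 * pi) (fun v => complex.Re (g (u +i* v))).

Lemma twopi_gt0 : 0 < 2 * pi :> R.
Proof. by rewrite mulr_gt0// pi_gt0. Qed.

Definition cont_line g u := forall v, {for u +i* v, continuous (g : C^o -> C^o)}.

Lemma cont_line_on g u a b : cont_line g u ->
  cont_on a b (fun v => complex.Re (g (u +i* v))).
Proof. by move=> cg v _; exact: (cont_v _).1. Qed.

(** Goursat's theorem on the rectangle between the two segments: the contributions of the horizontal
    sides cancel by periodicity. *)
Lemma mean_const g u1 u2 : u1 <= u2 ->
  (forall u v, u1 <= u <= u2 -> hol g (u +i* v)) ->
  (forall u, g (u +i* (2 * pi)) = g (u +i* 0)) ->
  mean g u1 = mean g u2.
Proof.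
move=> u12 hg pg; have t0 := ltW twopi_gt0.
have := @goursat R g _ _ _ _ u12 t0 (fun x y xu _ => hg x y xu).
rewrite /rect_int (@eq_itg _ _ _ _ (fun=> 0)); last by move=> x _; rewrite pg subrr.
rewrite itg_cst// mul0r add0r.
have cv u : u1 <= u <= u2 -> cont_on 0 (2 * pi) (fun v => complex.Re (g (u +i* v))).
  by move=> uu; apply: cont_line_on => v; apply: hol_cont; exact: hg.
have -> : (fun y => complex.Re (g (u2 +i* y)) - complex.Re (g (u1 +i* y))) =
    (fun y => complex.Re (g (u2 +i* y)) + (-1) * complex.Re (g (u1 +i* y))).
  by apply/funext => y; rewrite mulN1r.
rewrite itgD ?itgZ; last 3 first.
- by apply: cv; rewrite lexx u12.
- by apply: cv; rewrite lexx u12.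
- by move=> y yy; apply: cvgMr; apply: cv; rewrite ?lexx ?u12.
by rewrite /mean; lra.
Qed.

Lemma mean_near g u k e : 0 <= e -> cont_line g u ->
  (forall v, 0 <= v <= 2 * pi -> cabs (g (u +i* v) - k%:C) <= e) ->
  `|mean g u - k * (2 * pi)| <= e * (2 * pi).
Proof.
move=> e0 cg H; rewrite -[X in _ * X]subr0 -[X in _ <= _ * X]subr0.
apply: itg_near_cst; [exact: ltW twopi_gt0|exact: cont_line_on|].
move=> v /H; apply: le_trans; rewrite -[k]/(complex.Re k%:C) -ReN -ReD.
exact: ge_cabs_Re.
Qed.

Lemma polar_translate z w : cabs (z + cexp w - z) = expR (complex.Re w).
Proof. by rewrite addrC addKr cabs_cexp. Qed.

Lemma log_periodic (f : C -> C) u :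
  f (cexp (u +i* (2 * pi))) = f (cexp (u +i* 0)).
Proof. by rewrite -(cexp_periodic (u +i* 0)); congr (f (cexp _)); apply: cplx_eq => /=; ring. Qed.

(** The mean does not depend on the radius, so it can be evaluated on a circle so small that [h]
    differs from [h w0] by less than e / (2 pi) on it. *)
Lemma mean_value h w0 r : 0 < r ->
  (forall w, cabs (w - w0) <= r -> hol h w) ->
  mean (fun w => h (w0 + cexp w)) (ln r) = complex.Re (h w0) * (2 * pi).
Proof.
move=> r0 hh; set g := fun w => _.
have hg u v : u <= ln r -> hol g (u +i* v).
  move=> ur; apply: (@hol_comp _ (fun w => w0 + cexp w) h).
    by apply: holD; [exact: hol_cst|exact: hol_cexp].
  by apply: hh; rewrite polar_translate /= -[r]lnK ?posrE// ler_expR.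
have cl u : u <= ln r -> cont_line g u.
  by move=> ur v; apply: hol_cont; exact: hg.
have mc u : u <= ln r -> mean g u = mean g (ln r).
  move=> ur; apply: mean_const => // [x y /andP[_]|x]; first exact: hg.
  exact: (log_periodic (fun z => h (w0 + z))).
apply/eqP; rewrite -subr_eq0 -normr_eq0 eq_le normr_ge0 andbT.
apply/ler_addgt0Pr => e e0; rewrite add0r.
have /contC_cabs : {for w0, continuous (h : C^o -> C^o)}.
  by apply: hol_cont; apply: hh; rewrite subrr cabs0 ltW.
move=> /(_ (e / (2 * pi)))[|d d0 Hd]; first by rewrite divr_gt0 ?twopi_gt0.
pose u := Num.min (ln r) (ln (d / 2)).
have d20 : 0 < d / 2 by rewrite divr_gt0.
have ur : u <= ln r by rewrite ge_min lexx.
have ud : expR u < d.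
  apply: (@le_lt_trans _ _ (d / 2)); last by rewrite ltr_pdivrMr// mulr_natr mulr2n ltrDr.
  by rewrite -[leRHS]lnK ?posrE// ler_expR ge_min lexx orbT.
rewrite -(mc u ur).
pose K := complex.Re (h w0).
have := @itg_near_cst R 0 (2 * pi) (fun v => complex.Re (g (u +i* v))) K (e / (2 * pi)).
rewrite subr0 divfK ?gt_eqF ?twopi_gt0//; apply; first exact: ltW twopi_gt0.
  by apply: cont_line_on; exact: cl.
move=> v _; rewrite /K -ReN -ReD; apply: le_trans (ge_cabs_Re _) _.
by apply/ltW/Hd; rewrite polar_translate.
Qed.

Lemma mean_value_le h w0 r k : 0 < r ->
  (forall w, cabs (w - w0) <= r -> hol h w) ->
  (forall w, cabs (w - w0) = r -> complex.Re (h w) <= k) ->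
  complex.Re (h w0) <= k.
Proof.
move=> r0 hh hk; have := mean_value r0 hh.
rewrite -(ler_pM2r twopi_gt0) => <-.
rewrite -[X in _ * X]subr0 -itg_cst ?(ltW twopi_gt0)//.
apply: itg_le => [||v _].
- apply: (@cont_line_on (fun w => h (w0 + cexp w)) (ln r)) => v; apply: hol_cont.
  apply: (@hol_comp _ (fun w => w0 + cexp w) h).
    by apply: holD; [exact: hol_cst|exact: hol_cexp].
  by apply: hh; rewrite polar_translate /= lnK ?posrE.
- exact: cont_on_cst.
by apply: hk; rewrite polar_translate /= lnK ?posrE.
Qed.

End circle_means.

(** * Maximum principle and Phragmen-Lindelof *)

Section maximum_principle.
Context {R : realType}.
Local Notation C := R[i].
Implicit Types (G H : C -> C) (a b c d u v x y r : R) (z w : C).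

Lemma rect_EVT_max (f : R -> R -> R) a b c d : a <= b -> c <= d ->
  (forall x y, a <= x <= b -> c <= y <= d -> forall e, 0 < e ->
    exists2 r, 0 < r & forall x' y', `|x' - x| < r -> `|y' - y| < r ->
      `|f x' y' - f x y| < e) ->
  exists x y, [/\ a <= x <= b, c <= y <= d &
    forall x' y', a <= x' <= b -> c <= y' <= d -> f x' y' <= f x y].
Proof.
move=> ab cd cf; pose A : set (R * R) := `[a, b]%classic `*` `[c, d]%classic.
have A0 : A !=set0 by exists (a, c); split; rewrite /= in_itv /= lexx.
have cA : compact A by apply: compact_setX; exact: segment_compact.
have fA : {within A, continuous (fun p : R * R => f p.1 p.2)}.
  apply: continuous_in_subspaceT => -[x y]; rewrite inE => -[/=].
  rewrite !in_itv /= => axb cyd; apply/cvgrPdist_lt => e e0.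
  have [r r0 H] := cf _ _ axb cyd _ e0.
  exists (ball x r, ball y r); first by split; exact: nbhsx_ballx.
  move=> [x' y'] [/=]; rewrite /ball /= => xx yy.
  by rewrite distrC H// distrC.
have [[x y] + fM] := compact_EVT_max A0 cA fA.
rewrite inE => -[/=]; rewrite !in_itv /= => axb cyd.
exists x, y; split => // x' y' x'P y'P.
by apply: (fM (x', y')); rewrite inE; split; rewrite /= in_itv.
Qed.

Lemma cabs_dist z w : `|cabs z - cabs w| <= cabs (z - w).
Proof.
have h1 : cabs z <= cabs (z - w) + cabs w by rewrite -{1}(subrK w z) cabsD.
have h2 : cabs w <= cabs (z - w) + cabs z by rewrite cabsC -{1}(subrK z w) cabsD.
by rewrite ler_norml; apply/andP; split; lra.
Qed.

(** If |G| exceeded [M] inside, then so would |G| at a maximum point [w0] of |G| + eta |w|^2, for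
    small eta. The added term makes the maximum strict enough to contradict the mean value property
    on a circle of radius r around [w0]. *)
Lemma maximum_principle G a b c d M : a <= b -> c <= d -> 0 <= M ->
  hol_rect G a b c d ->
  (forall x y, a <= x <= b -> c <= y <= d ->
    [\/ x = a, x = b, y = c | y = d] -> cabs (G (x +i* y)) <= M) ->
  forall x y, a <= x <= b -> c <= y <= d -> cabs (G (x +i* y)) <= M.
Proof.
move=> ab cd M0 hG GM p q pab qcd; rewrite leNgt; apply/negP => Mp.
pose S := (`|a| + `|b|) ^+ 2 + (`|c| + `|d|) ^+ 2 + 1.
have S0 : 0 < S by rewrite ltr_wpDl// addr_ge0// sqr_ge0.
have SP x y : a <= x <= b -> c <= y <= d -> x ^+ 2 + y ^+ 2 <= S.
  have sq (t l m : R) : l <= t <= m -> t ^+ 2 <= (`|l| + `|m|) ^+ 2.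
    move=> /andP[lt tm]; rewrite -(@real_normK _ t) ?num_real//.
    rewrite ler_sqr ?nnegrE ?addr_ge0// ler_norml.
    have := normr_ge0 l; have := normr_ge0 m.
    have := ler_norm m; have := ler_norm (- l); rewrite normrN => *.
    by apply/andP; split; lra.
  by move=> /sq h1 /sq h2; rewrite /S; lra.
(* [S] bounds |w|^2 on the rectangle, so the perturbation uses up at most half of the excess over
   [M], and |G| still exceeds [M] at the maximum point, which is therefore interior. *)
pose eta := (cabs (G (p +i* q)) - M) / (2 * S).
have eta0 : 0 < eta by rewrite divr_gt0 ?subr_gt0// mulr_gt0.
have etaS : eta * S < cabs (G (p +i* q)) - M.
  have -> : eta * S = (cabs (G (p +i* q)) - M) / 2.
    by rewrite /eta invfM mulrA divfK// gt_eqF.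
  by rewrite ltr_pdivrMr// mulr_natr mulr2n ltrDr subr_gt0.
pose phi x y := cabs (G (x +i* y)) + eta * (x ^+ 2 + y ^+ 2).
have [x0 [y0 [x0P y0P phiM]]] : exists x y, [/\ a <= x <= b, c <= y <= d &
    forall x' y', a <= x' <= b -> c <= y' <= d -> phi x' y' <= phi x y].
  apply: rect_EVT_max => // x y xP yP e e0.
  have e20 : 0 < e / 2 by rewrite divr_gt0.
  have /hol_cont/contC_cabs/(_ _ e20)[d1 d10 H1] := hG _ _ xP yP.
  have cq (t : R) : exists2 r, 0 < r & forall t', `|t' - t| < r -> `|eta * t' ^+ 2 - eta * t ^+ 2| < e / 4.
    have : {for t, continuous (fun s : R => eta * s ^+ 2)}.
      by apply: cvgMr; exact: exprn_continuous.
    move=> /cvgrPdist_lt/(_ (e / 4))[|r /= r0 H]; first by rewrite divr_gt0.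
    by exists r => // t' tt; rewrite distrC; apply: H; rewrite /= distrC.
  have [d2 d20 H2] := cq x; have [d3 d30 H3] := cq y.
  pose r := Num.min (d1 / 2) (Num.min d2 d3).
  exists r; first by rewrite !lt_min d20 d30 divr_gt0.
  move=> x' y'; rewrite !lt_min => /and3P[xd1 xd2 xd3] /and3P[yd1 yd2 yd3].
  have {}H1 : cabs (G (x' +i* y') - G (x +i* y)) < e / 2.
    apply: H1; apply: (le_lt_trans (cabs_le_ReIm _)).
    by rewrite ReD ReN ImD ImN /=; lra.
  have K1 := cabs_dist (G (x' +i* y')) (G (x +i* y)).
  have -> : phi x' y' - phi x y = cabs (G (x' +i* y')) - cabs (G (x +i* y)) +
    ((eta * x' ^+ 2 - eta * x ^+ 2) + (eta * y' ^+ 2 - eta * y ^+ 2)) by rewrite /phi; ring.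
  rewrite (le_lt_trans (ler_normD _ _))//.
  have := ler_normD (eta * x' ^+ 2 - eta * x ^+ 2) (eta * y' ^+ 2 - eta * y ^+ 2).
  by have := H2 _ xd2; have := H3 _ yd3; lra.
have G0p : cabs (G (p +i* q)) <= phi x0 y0.
  apply: le_trans (phiM _ _ pab qcd).
  by rewrite lerDl mulr_ge0 ?(ltW eta0)// addr_ge0// sqr_ge0.
have S_phi : eta * (x0 ^+ 2 + y0 ^+ 2) <= eta * S by rewrite ler_pM2l// SP.
pose w0 := x0 +i* y0.
have MG0 : M < cabs (G w0) by rewrite /w0; move: G0p; rewrite /phi; lra.
have nb : ~ [\/ x0 = a, x0 = b, y0 = c | y0 = d].
  by move=> /(GM _ _ x0P y0P); rewrite leNgt MG0.
have [ax xb cy yd] : [/\ a < x0, x0 < b, c < y0 & y0 < d].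
  split; rewrite lt_def; [have /andP[-> _] := x0P|have /andP[_ ->] := x0P|
    have /andP[-> _] := y0P|have /andP[_ ->] := y0P]; rewrite andbT;
  apply/eqP => e; apply: nb.
  - by apply: Or41.
  - by apply: Or42.
  - by apply: Or43.
  - by apply: Or44.
pose r := Num.min (Num.min (x0 - a) (b - x0)) (Num.min (y0 - c) (d - y0)).
have r0 : 0 < r by rewrite !lt_min !subr_gt0 ax xb cy yd.
have inr w : cabs (w - w0) <= r -> a <= complex.Re w <= b /\ c <= complex.Im w <= d.
  rewrite !le_min => /andP[/andP[h1 h2] /andP[h3 h4]].
  have := ge_cabs_Re (w - w0); have := ge_cabs_Im (w - w0).
  rewrite ReD ReN ImD ImN /= !ler_norml => /andP[i1 i2] /andP[i3 i4].
  by split; apply/andP; split; lra.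
have G00 : 0 < cabs (G w0) by exact: le_lt_trans MG0.
(* The linear term compensates the first-order variation of eta |w|^2, since on the circle |w|^2 =
   |w0|^2 + r^2 + 2 Re (conj w0 (w - w0)). On the circle Re h is then at most |G w0|^2 - eta r^2 |G
   w0|, whereas h equals |G w0|^2 at the centre. *)
pose h w := (G w0)^* * G w + (2 * eta * cabs (G w0))%:C * (w0^* * (w - w0)).
have : complex.Re (h w0) <= cabs (G w0) ^+ 2 - eta * r ^+ 2 * cabs (G w0).
  apply: (mean_value_le r0).
    move=> w /inr[wx wy]; apply: holD.
      by apply: holM; [exact: hol_cst|rewrite (cplxE w); exact: hG].
    apply: holM; first exact: hol_cst.
    apply: holM; first exact: hol_cst.
    by apply: holB; [exact: hol_id|exact: hol_cst].
  move=> w wr; have [wx wy] : a <= complex.Re w <= b /\ c <= complex.Im w <= d by apply: inr; rewrite wr.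
  have HG : complex.Re ((G w0)^* * G w) <= cabs (G w0) * cabs (G w).
    apply: le_trans (Re_le_cabs _) _; rewrite cabsM.
    by rewrite /cabs; case: (G w0) => s t /=; rewrite sqrrN.
  have := phiM _ _ wx wy; rewrite /phi -(cplxE w) -/w0 => Hphi.
  have E : complex.Re w ^+ 2 + complex.Im w ^+ 2 = x0 ^+ 2 + y0 ^+ 2 + r ^+ 2 +
      2 * complex.Re (w0^* * (w - w0)).
    rewrite -wr cabs_sqr ReM !ReD !ImD !ReN !ImN /=; ring.
  rewrite ReD [X in _ + X]ReM /= mul0r subr0.
  move: HG Hphi E G00; set X := complex.Re ((G w0)^* * G w).
  set Y := complex.Re (w0^* * (w - w0)).
  move: (cabs (G w0)) (cabs (G w)) => g0 gw HG Hphi E g00.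
  have : g0 * gw <= g0 * (g0 + eta * (x0 ^+ 2 + y0 ^+ 2) -
      eta * (complex.Re w ^+ 2 + complex.Im w ^+ 2)) by rewrite ler_pM2l//; lra.
  rewrite E => L; have : X <= g0 * (g0 + eta * (x0 ^+ 2 + y0 ^+ 2) -
      eta * (x0 ^+ 2 + y0 ^+ 2 + r ^+ 2 + 2 * Y)) by lra.
  by move=> /(lerD) /(_ (lexx (2 * eta * g0 * Y))) /le_trans; apply;
    rewrite le_eqVlt; apply/orP; left; apply/eqP; ring.
rewrite /h subrr !mulr0 addr0 conj_mul_self /= lerDl oppr_ge0.
apply/negP; rewrite -ltNge.
by apply: mulr_gt0 => //; apply: mulr_gt0 => //; exact: exprn_gt0.
Qed.

(** This is the theorem for a sector of opening [theta], written in w = log z: the left end of the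
    strip is the vertex, the right end is infinity, and the admissible growth has order [sigma]
    below pi / [theta]. *)
Lemma phragmen_lindelof_strip H (theta sigma M : R) :
  0 < theta -> 0 < sigma -> sigma * theta < pi -> 0 <= M ->
  (forall u v, 0 <= v <= theta -> hol H (u +i* v)) ->
  (forall u, cabs (H (u +i* 0)) <= M) ->
  (forall u, cabs (H (u +i* theta)) <= M) ->
  (forall e, 0 < e -> exists T, forall u v, 0 <= v <= theta -> u <= T ->
    cabs (H (u +i* v)) <= M + e) ->
  (forall dl e, 0 < dl -> 0 < e -> exists T, forall u v, 0 <= v <= theta -> T <= u ->
    cabs (H (u +i* v)) <= e * expR (dl * expR (sigma * u))) ->
  forall u v, 0 <= v <= theta -> cabs (H (u +i* v)) <= M.
Proof.
move=> th0 sg0 stpi M0 hH H0 Hth Hleft Hright u v v0th.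
set cs := cos (sigma * theta / 2).
have pi0 : 0 < pi :> R := pi_gt0 R.
have st0 : 0 < sigma * theta by rewrite mulr_gt0.
have cs0 : 0 < cs.
  by apply: cos_gt0_pihalf; apply/andP; split; lra.
have csP y : 0 <= y <= theta -> cs <= cos (sigma * (y - theta / 2)).
  move=> /andP[y0 yth]; rewrite -(cos_norm (sigma * _)).
  have ub : `|sigma * (y - theta / 2)| <= sigma * theta / 2.
    by rewrite normrM (gtr0_norm sg0) -mulrA ler_pM2l// ler_norml; apply/andP; split; lra.
  rewrite /cs leNgt ltr_cos -?leNgt// in_itv /=; apply/andP; split => //; lra.
have main dl e : 0 < dl -> 0 < e ->
    cabs (H (u +i* v)) <= (M + e) * expR (dl * expR (sigma * u)).
  move=> dl0 e0.
  (* In z = e^w this is the damping factor exp (- dl (z e^(- i theta / 2))^sigma). As sigma theta <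
     pi, the cosine in its modulus stays above [cs] > 0 on the whole strip. *)
  pose m w := cexp ((- dl)%:C * cexp (sigma%:C * (w - 0 +i* (theta / 2)))).
  pose G w := H w * m w.
  have mE x y : cabs (m (x +i* y)) =
      expR (- (dl * (expR (sigma * x) * cos (sigma * (y - theta / 2))))).
    have -> : m (x +i* y) = cexp ((- dl)%:C *
        cexp ((sigma * x) +i* (sigma * (y - theta / 2)))).
      by congr (cexp (_ * cexp _)); apply: cplx_eq => /=; ring.
    by rewrite cabs_cexp ReM /= mul0r subr0 mulNr.
  have m_le x y : 0 <= y <= theta ->
      cabs (m (x +i* y)) <= expR (- (dl * cs * expR (sigma * x))).
    move=> /csP yP; rewrite mE ler_expR lerN2 -mulrA ler_pM2l// mulrC.
    by rewrite ler_pM2l ?expR_gt0.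
  have m_le1 x y : 0 <= y <= theta -> cabs (m (x +i* y)) <= 1.
    move=> /(m_le x) /le_trans; apply; rewrite -expR0 ler_expR oppr_le0.
    by rewrite !mulr_ge0 ?expR_ge0// ltW.
  have [T1 HT1] := Hleft _ e0.
  have [T2 HT2] := Hright _ _ (mulr_gt0 dl0 cs0) e0.
  (* A rectangle so long that [M + e] bounds [G] on both vertical sides: on the left by the
     hypothesis at the vertex, on the right because the damping cancels the growth allowed there. *)
  pose u1 := Num.min T1 u; pose u2 := Num.max T2 u.
  have u1u : u1 <= u by rewrite ge_min lexx orbT.
  have uu2 : u <= u2 by rewrite le_max lexx orbT.
  have GM : cabs (G (u +i* v)) <= M + e.
    apply: (@maximum_principle G u1 u2 0 theta) => //.
    - exact: le_trans u1u uu2.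
    - exact: ltW.
    - by rewrite addr_ge0// ltW.
    - move=> x y _ yth; apply: holM; first exact: hH.
      apply: (@hol_comp _ _ cexp); last exact: hol_cexp.
      apply: holM; first exact: hol_cst.
      apply: (@hol_comp _ _ cexp); last exact: hol_cexp.
      apply: holM; first exact: hol_cst.
      by apply: holB; [exact: hol_id|exact: hol_cst].
    - move=> x y _ yth; rewrite cabsM.
      have Hm B : cabs (H (x +i* y)) <= B -> cabs (H (x +i* y)) * cabs (m (x +i* y)) <= B.
        by apply: le_trans; rewrite ler_piMr ?cabs_ge0// m_le1.
      case => E.
      + by apply: Hm; apply: HT1 => //; rewrite E ge_min lexx.
      + have /(ler_pM (cabs_ge0 _) (cabs_ge0 _)) : cabs (H (x +i* y)) <=
            e * expR (dl * cs * expR (sigma * x)).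
          by apply: HT2 => //; rewrite E le_max lexx.
        move=> /(_ _ _ (m_le x y yth)) /le_trans; apply.
        by rewrite -(mulrA e) -expRD subrr expR0 mulr1 lerDr.
      + by apply: Hm; rewrite E (le_trans (H0 _))// lerDl ltW.
      + by apply: Hm; rewrite E (le_trans (Hth _))// lerDl ltW.
    - by rewrite u1u uu2.
  have -> : H (u +i* v) = G (u +i* v) * (m (u +i* v))^-1.
    by rewrite /G mulfK// cexp_neq0.
  rewrite cabsM cabsV; apply: ler_pM => //; rewrite ?invr_ge0 ?cabs_ge0//.
  rewrite mE -expRN opprK ler_expR ler_pM2l// ler_piMr ?expR_ge0//.
rewrite leNgt; apply/negP => MH; set h := cabs (H _) in main MH.
(* One choice replaces the limit e, dl -> 0. With [e] half of the excess and dl expR (sigma u) = ln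
   k / 2, the bound reads k <= sqrt k for some k > 1. *)
pose e := (h - M) / 2.
have e0 : 0 < e by rewrite divr_gt0 ?subr_gt0.
have Meh : M + e < h by rewrite /e; lra.
have Me0 : 0 < M + e by rewrite ltr_wpDl.
pose k := h / (M + e).
have k1 : 1 < k by rewrite ltr_pdivlMr// mul1r.
have lk : 0 < ln k by rewrite ln_gt0.
have dl0 : 0 < ln k / 2 / expR (sigma * u) by rewrite !divr_gt0 ?expR_gt0.
have := main _ _ dl0 e0; rewrite divfK ?gt_eqF ?expR_gt0//.
apply/negP; rewrite -ltNge -ltr_pdivlMl// [_^-1 * h]mulrC -/k.
rewrite -[ltRHS]lnK ?posrE ?(lt_trans ltr01)// ltr_expR.
by rewrite ltr_pdivrMr// mulr_natr mulr2n ltrDl.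
Qed.

End maximum_principle.

(** * Growth of functions of exponential type *)

Section exponential_type.
Context {R : realType}.
Local Notation C := R[i].
Implicit Types (F h : C -> C) (u v x y r : R) (z w : C).

Lemma exponential_typeP (delta : R) F : exponential_type_le delta F <->
  (forall tau, delta < tau -> exists r, forall z, r < cabs z ->
    cabs (F z) <= expR (tau * cabs z)).
Proof.
split=> [Fd tau dtau|Fd].
- have : (limf_esup (fun z : C^o => ((cabs z)^-1)%:E * lne (cabs (F z))%:E)%E
      complex_infty < tau%:E)%E by apply: le_lt_trans Fd _; rewrite lte_fin.
  rewrite limf_esupE => /ereal_inf_lt[_ [V [r _ rV] <-] Vtau].
  (* The maximum with 0 excludes z = 0, where the factor 1 / |z| takes the default value 0. *)
  exists (Num.max 0 r) => z; rewrite gt_max => /andP[z0 rz].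
  have [Fz0|Fz0] := eqVneq (F z) 0; first by rewrite Fz0 cabs0 expR_ge0.
  have : (((cabs z)^-1)%:E * lne (cabs (F z))%:E <= tau%:E)%E.
    by apply: le_trans (ltW Vtau); apply: ereal_sup_ubound; exists z => //; exact: rV.
  rewrite lne_EFin ?cabs_gt0// -EFinM lee_fin ler_pdivrMl//.
  by rewrite -[X in _ -> X <= _]lnK ?posrE ?cabs_gt0// ler_expR mulrC.
- apply/lee_addgt0Pr => e e0; have [|r Hr] := Fd (delta + e); first by rewrite ltrDl.
  rewrite limf_esupE; apply: (@le_trans _ _ (ereal_sup
    ((fun z : C^o => ((cabs z)^-1)%:E * lne (cabs (F z))%:E)%E @` [set z | Num.max 0 r < cabs z]))).
    by apply: ereal_inf_lbound; exists [set z | Num.max 0 r < cabs z] => //; exists (Num.max 0 r).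
  apply: ge_ereal_sup => _ [z /= + <-]; rewrite gt_max => /andP[z0 rz].
  have [Fz0|Fz0] := eqVneq (F z) 0.
    by rewrite Fz0 cabs0 lexx gt0_muleNy ?lte_fin ?invr_gt0// leNye.
  rewrite [(cabs (F z) <= 0)%R]leNgt cabs_gt0 Fz0 /= -EFinM -EFinD lee_fin ler_pdivrMl// mulrC.
  by rewrite -ler_expR lnK ?posrE ?cabs_gt0//; exact: Hr.
Qed.

(** With r = expR u this compares exp (a r^rho) to exp (dl r^sigma), growth of two different orders.
    The ratio r^(sigma - rho) is bounded below by 1 + (sigma - rho) u, which gives an explicit
    threshold. *)
Lemma expR_dominates (a dl e rho sigma : R) : 0 < dl -> 0 < e -> 0 <= rho -> rho < sigma ->
  exists T, forall u, T <= u ->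
    expR (a * expR (rho * u)) <= e * expR (dl * expR (sigma * u)).
Proof.
move=> dl0 e0 rho0 rs; have sr0 : 0 < sigma - rho by rewrite subr_gt0.
exists (Num.max 0 ((`|a| + `|ln e|) / (dl * (sigma - rho)))) => u.
rewrite ge_max => /andP[u0]; rewrite ler_pdivrMr ?mulr_gt0// => Hu.
rewrite -{1}[e]lnK ?posrE// -expRD ler_expR.
have -> : sigma * u = rho * u + (sigma - rho) * u by ring.
rewrite expRD; set p := expR (rho * u).
have p1 : 1 <= p by rewrite -expR0 ler_expR mulr_ge0.
have p0 : 0 <= p by rewrite expR_ge0.
have q : 1 + (sigma - rho) * u <= expR ((sigma - rho) * u) := expR_ge1Dx _.
have q' : dl * (p * (1 + (sigma - rho) * u)) <= dl * (p * expR ((sigma - rho) * u)).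
  by rewrite ler_pM2l// ler_wpM2l.
have h1 : p * (`|a| + `|ln e|) <= p * (u * (dl * (sigma - rho))) by rewrite ler_wpM2l.
have h2 : a * p <= `|a| * p by rewrite ler_wpM2r// ler_norm.
have h3 : 1 * `|ln e| <= p * `|ln e| by rewrite ler_wpM2r.
have h4 : - ln e <= `|ln e| by rewrite -normrN ler_norm.
have h5 : 0 <= dl * p by rewrite mulr_ge0// ltW.
have E : dl * (p * (1 + (sigma - rho) * u)) = dl * p + p * (u * (dl * (sigma - rho))) by ring.
move: q'; rewrite E; lra.
Qed.

Lemma cexp_polar u v : cexp (u +i* v) = (expR u * cos v) +i* (expR u * sin v).
Proof. by []. Qed.

Lemma polar_halfplane z : z != 0 -> 0 <= complex.Im z ->
  exists u v, 0 <= v <= pi /\ z = cexp (u +i* v).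
Proof.
move=> z0 y0; have r0 : 0 < cabs z by rewrite cabs_gt0.
set x := complex.Re z; set y := complex.Im z in y0 *; set r := cabs z in r0.
have xr : -1 <= x / r <= 1.
  by rewrite -ler_norml normrM normfV (gtr0_norm r0) ler_pdivrMr// mul1r ge_cabs_Re.
exists (ln r), (acos (x / r)); split; first by rewrite acos_ge0// acos_lepi.
rewrite cexp_polar lnK ?posrE// acosK ?in_itv//= sin_acos//.
apply: cplx_eq => /=; first by rewrite mulrC divfK ?gt_eqF.
have -> : 1 - (x / r) ^+ 2 = (y / r) ^+ 2.
  rewrite !expr_div_n -[1](@divff _ (r ^+ 2)) ?expf_neq0 ?gt_eqF//.
  by rewrite -mulrBl; congr (_ / _); rewrite /r cabs_sqr addrAC subrr add0r.
by rewrite sqrtr_sqr ger0_norm ?divr_ge0 ?(ltW r0)// mulrC divfK ?gt_eqF.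
Qed.

Section half_plane.
Variables (F : C -> C) (A tau r0 : R).
Hypotheses (hF : forall z, hol F z) (A0 : 0 <= A) (tau0 : 0 <= tau)
  (F_real : forall x, cabs (F x%:C) <= A * (1 + x ^+ 2))
  (F_growth : forall z, r0 < cabs z -> cabs (F z) <= expR (tau * cabs z)).

(** The factor e^(i tau z) has modulus e^(- tau Im z) and cancels the growth along the positive
    imaginary axis. The division by (z + i)^2, whose zero lies in the lower half-plane, absorbs the
    quadratic growth on the real line, where |z + i|^2 = 1 + x^2. *)
Let h z := F z * cexp ((0 +i* tau) * z) / ((z + 0 +i* 1) * (z + 0 +i* 1)).

Let cabs_h z : cabs (h z) =
  cabs (F z) * expR (- (tau * complex.Im z)) / cabs (z + 0 +i* 1) ^+ 2.
Proof.
rewrite /h cabs_div !cabsM cabs_cexp expr2; congr (_ * expR _ / _).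
by rewrite ReM /= mul0r sub0r.
Qed.

Let den z : cabs (z + 0 +i* 1) ^+ 2 = complex.Re z ^+ 2 + (complex.Im z + 1) ^+ 2.
Proof. by rewrite cabs_sqr ReD ImD /= addr0. Qed.

Let den_ge1 z : 0 <= complex.Im z -> 1 <= cabs (z + 0 +i* 1) ^+ 2.
Proof.
move=> y0; rewrite den -[1]add0r lerD ?sqr_ge0//.
by rewrite -[leLHS](expr1n _ 2) lerXn2r ?nnegrE//; lra.
Qed.

Let h_le_F z : 0 <= complex.Im z -> cabs (h z) <= cabs (F z).
Proof.
move=> y0; rewrite cabs_h ler_pdivrMr; last exact: lt_le_trans ltr01 (den_ge1 y0).
apply: ler_pM; rewrite ?cabs_ge0 ?expR_ge0//.
by apply: le_trans (den_ge1 y0); rewrite -expR0 ler_expR oppr_le0 mulr_ge0.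
Qed.

Let hol_h z : 0 <= complex.Im z -> hol h z.
Proof.
move=> y0; apply: holM.
  apply: holM => //; apply: (@hol_comp _ _ cexp); last exact: hol_cexp.
  by apply: holM; [exact: hol_cst|exact: hol_id].
have hd : hol (fun w => w + 0 +i* 1) z by apply: holD; [exact: hol_id|exact: hol_cst].
apply: holV; last exact: holM.
by rewrite -cabs_eq0 cabsM -expr2 gt_eqF// (lt_le_trans ltr01)// den_ge1.
Qed.

Let h_real x : cabs (h x%:C) <= A.
Proof.
rewrite cabs_h den /= mulr0 oppr0 expR0 mulr1 add0r expr1n.
by rewrite ler_pdivrMr ?ltr_wpDl ?sqr_ge0// addrC.
Qed.

Let Im_cexp_ge0 u v : 0 <= v <= pi -> 0 <= complex.Im (cexp (u +i* v)).
Proof. by move=> /sin_ge0_pi s0; rewrite cexp_polar /= mulr_ge0 ?expR_ge0. Qed.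

Let h_left M e : A <= M -> 0 < e -> exists T, forall u v, 0 <= v <= pi -> u <= T ->
  cabs (h (cexp (u +i* v))) <= M + e.
Proof.
move=> AM e0; have /contC_cabs/(_ _ e0)[d d0 Hd] : {for 0, continuous (h : C^o -> C^o)}.
  by apply: hol_cont; exact: hol_h.
exists (ln (d / 2)) => u v v0 ud.
have eu : cabs (cexp (u +i* v) - 0) < d.
  rewrite subr0 cabs_cexp /=; apply: (@le_lt_trans _ _ (d / 2)).
    by rewrite -[leRHS]lnK ?ler_expR// posrE divr_gt0.
  by rewrite ltr_pdivrMr// mulr_natr mulr2n ltrDr.
have := Hd _ eu; have := cabsD (h (cexp (u +i* v)) - h 0) (h 0); rewrite subrK.
by have := h_real 0; rewrite (_ : 0%:C = 0)//; lra.
Qed.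

Let h_imag : exists2 M, A <= M & forall y, 0 <= y -> cabs (h (0 +i* y)) <= M.
Proof.
pose s := Num.max 0 r0; have s0 : 0 <= s by rewrite le_max lexx.
have cf : {within `[0, s]%classic, continuous (fun y => cabs (h (0 +i* y)))}.
  apply: continuous_in_subspaceT => y; rewrite inE /= in_itv /= => /andP[y0 _].
  have /hol_cont/contC_cabs H : hol h (0 +i* y) by apply: hol_h.
  apply/cvgrPdist_lt => e /H[d d0 Hd]; apply/nbhs_ballP; exists d => // t.
  rewrite /ball /= => yt; apply: le_lt_trans (cabs_dist _ _) _.
  rewrite cabsC; apply: Hd; apply: le_lt_trans (cabs_le_ReIm _) _.
  by rewrite /= subrr normr0 add0r distrC.
have [c _ cM] := EVT_max s0 cf.
(* The value at [c] serves on the initial segment of the axis, and 1 serves beyond [r0], where the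
   two exponentials cancel. *)
exists (Num.max A (Num.max 1 (cabs (h (0 +i* c))))); first by rewrite le_max lexx.
move=> y y0; rewrite !le_max; have [ys|sy] := leP y s.
  by rewrite (cM y) ?orbT// in_itv /= y0.
rewrite orbCA orbA orbC; apply/orP; right; apply/orP; left.
have yE : cabs (0 +i* y : C) = y.
  by apply/eqP; rewrite -(@eqrXn2 _ 2) ?cabs_ge0// cabs_sqr /= expr0n add0r.
have y1 : 0 <= complex.Im (0 +i* y : C) by [].
rewrite cabs_h ler_pdivrMr; last exact: lt_le_trans ltr01 (den_ge1 y1).
rewrite mul1r (le_trans _ (den_ge1 y1))//=.
have := F_growth (z := 0 +i* y); rewrite yE => /(_ _).
have r0y : r0 < y by apply: le_lt_trans sy; rewrite le_max lexx orbT.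
move=> /(_ r0y) /(ler_wpM2r (expR_ge0 (- (tau * y)))) /le_trans; apply.
by rewrite -expRD subrr expR0.
Qed.

(** Growth of order 1 is critical for the half-plane but not for a quadrant: sigma = 3 / 2 and theta
    = pi / 2 give sigma theta = 3 pi / 4. So the two quadrants are treated separately, with the
    bound on the imaginary axis as common boundary data. *)
Let h_bounded : exists2 M, A <= M & forall u v, 0 <= v <= pi -> cabs (h (cexp (u +i* v))) <= M.
Proof.
have [M AM HM] := h_imag; exists M => //.
have M0 : 0 <= M by exact: le_trans AM.
have pi0 : 0 < pi :> R := pi_gt0 R.
have right sh dl e : 0 <= sh <= pi / 2 -> 0 < dl -> 0 < e ->
    exists T, forall u v, 0 <= v <= pi / 2 -> T <= u ->
    cabs (h (cexp (u +i* (v + sh)))) <= e * expR (dl * expR (3 / 2 * u)).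
  move=> shP dl0 e0; have [|T HT] := @expR_dominates tau dl e 1 (3 / 2) dl0 e0 ler01.
    by lra.
  exists (Num.max T (ln (Num.max 1 r0 + 1))) => u v vP; rewrite ge_max => /andP[Tu ru].
  have vs : 0 <= v + sh <= pi by apply/andP; split; lra.
  apply: le_trans (h_le_F (Im_cexp_ge0 _ vs)) _; apply: le_trans (HT u Tu).
  have := F_growth (z := cexp (u +i* (v + sh))); rewrite cabs_cexp mul1r; apply.
  apply: (@lt_le_trans _ _ (Num.max 1 r0 + 1)).
    by rewrite ltr_pwDr// le_max lexx orbT.
  rewrite -[leLHS]lnK ?ler_expR// posrE ltr_wpDl// le_max ler01//.
have quad sh : 0 <= sh <= pi / 2 ->
    (forall u, cabs (h (cexp (u +i* sh))) <= M) ->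
    (forall u, cabs (h (cexp (u +i* (pi / 2 + sh)))) <= M) ->
    forall u v, 0 <= v <= pi / 2 -> cabs (h (cexp (u +i* (v + sh)))) <= M.
  move=> shP b1 b2 u v vP.
  pose H w := h (cexp (w + 0 +i* sh)).
  have HE x y : H (x +i* y) = h (cexp (x +i* (y + sh))).
    by rewrite /H; congr (h (cexp _)); apply: cplx_eq => /=; rewrite ?addr0.
  rewrite -HE; apply: (@phragmen_lindelof_strip _ H (pi / 2) (3 / 2) M) => //.
  - by rewrite divr_gt0.
  - by lra.
  - move=> x y yP; apply: (@hol_comp _ (fun w => cexp (w + 0 +i* sh)) h).
      apply: (@hol_comp _ _ cexp); last exact: hol_cexp.
      by apply: holD; [exact: hol_id|exact: hol_cst].
    apply: hol_h; rewrite (_ : _ + _ = x +i* (y + sh)); last by apply: cplx_eq => /=; rewrite ?addr0.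
    by apply: Im_cexp_ge0; apply/andP; split; lra.
  - by move=> x; rewrite HE add0r.
  - by move=> x; rewrite HE.
  - move=> e /(h_left AM)[T HT]; exists T => x y yP xT; rewrite HE; apply: HT => //.
    by apply/andP; split; lra.
  - move=> dl e dl0 e0; have [T HT] := right _ _ _ shP dl0 e0.
    by exists T => x y yP xT; rewrite HE; exact: HT.
have b0 u : cabs (h (cexp (u +i* 0))) <= M.
  by apply: le_trans AM; rewrite -[_ +i* 0]/(u%:C) cexp_real.
have b1 u : cabs (h (cexp (u +i* (pi / 2)))) <= M.
  by rewrite cexp_polar cos_pihalf mulr0; apply: HM; rewrite sin_pihalf mulr1 expR_ge0.
have b2 u : cabs (h (cexp (u +i* pi))) <= M.
  apply: le_trans AM; rewrite cexp_polar cospi sinpi mulr0 mulrN1.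
  exact: (h_real (- expR u)).
move=> u v /andP[v0 vpi]; have [vh|hv] := leP v (pi / 2).
  rewrite -[v]addr0; apply: quad => //; rewrite ?v0 ?vh//.
  - by rewrite lexx divr_ge0// ltW.
  - by move=> x; rewrite addr0.
rewrite -[v](subrK (pi / 2)); apply: quad => //.
- by rewrite lexx divr_ge0// ltW.
- by move=> x; rewrite -splitr.
- by apply/andP; split; lra.
Qed.

(** Once [h] is bounded, Phragmen-Lindelof applies to the whole half-plane with sigma = 1 / 2, and
    the bound improves to the one on the real line. *)
Let h_le u v : 0 <= v <= pi -> cabs (h (cexp (u +i* v))) <= A.
Proof.
have [M AM HM] := h_bounded; have M0 : 0 <= M by exact: le_trans AM.
have pi0 : 0 < pi :> R := pi_gt0 R.
apply: (@phragmen_lindelof_strip _ (fun w => h (cexp w)) pi (2^-1) A) => //.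
- by rewrite gtr_pMl// invf_lt1// ltr1n.
- move=> x y yP; apply: (@hol_comp _ cexp h); first exact: hol_cexp.
  by apply: hol_h; exact: Im_cexp_ge0.
- by move=> x; rewrite -[_ +i* 0]/(x%:C) cexp_real.
- move=> x; rewrite cexp_polar cospi sinpi mulr0 mulrN1; exact: (h_real (- expR x)).
- move=> e; exact: h_left.
- move=> dl e dl0 e0; have [|T HT] := @expR_dominates M dl e 0 (2^-1) dl0 e0 (lexx _).
    by rewrite invr_gt0.
  exists T => x y yP Tx; apply: le_trans (HT x Tx); apply: (le_trans (HM _ _ yP)).
  rewrite mul0r expR0 mulr1; apply: le_trans (expR_ge1Dx M).
  by rewrite lerDr.
Qed.

Lemma upper_half_plane_bound z : 0 <= complex.Im z ->
  cabs (F z) <= A * (1 + cabs z) ^+ 2 * expR (tau * cabs z).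
Proof.
move=> y0; have hA : cabs (h z) <= A.
  have [->|z0] := eqVneq z 0; first exact: (h_real 0).
  by have [u [v [vP ->]]] := polar_halfplane z0 y0; exact: h_le.
have d1 := lt_le_trans ltr01 (den_ge1 y0).
move: hA; rewrite cabs_h ler_pdivrMr// expRN ler_pdivrMr ?expR_gt0// => /le_trans; apply.
apply: ler_pM; rewrite ?mulr_ge0 ?exprn_ge0 ?cabs_ge0 ?expR_ge0//.
  rewrite ler_wpM2l// lerXn2r ?nnegrE ?addr_ge0 ?cabs_ge0//.
  apply: le_trans (cabsD _ _) _; rewrite addrC lerD2r.
  by apply: le_trans (cabs_le_ReIm _) _; rewrite /= normr0 add0r normr1.
by rewrite ler_expR ler_wpM2l// (le_trans (ler_norm _))// ge_cabs_Im.
Qed.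

End half_plane.

(** Reflection z -> - z turns the bound on the upper half-plane into one on the lower half-plane,
    for every exponent tau > delta. The constant does not depend on tau, so tau may tend to
    delta. *)
Lemma exponential_type_bound F A delta : entire F -> 0 <= A -> 0 <= delta ->
  exponential_type_le delta F -> (forall x, cabs (F x%:C) <= A * (1 + x ^+ 2)) ->
  forall z, cabs (F z) <= A * (1 + cabs z) ^+ 2 * expR (delta * cabs z).
Proof.
move=> hF A0 d0 /exponential_typeP Fd FA z.
have B0 : 0 <= A * (1 + cabs z) ^+ 2 by rewrite mulr_ge0// exprn_ge0// addr_ge0// cabs_ge0.
have main tau : delta < tau -> cabs (F z) <= A * (1 + cabs z) ^+ 2 * expR (tau * cabs z).
  move=> dt; have [r Hr] := Fd _ dt.
  have tau0 : 0 <= tau by rewrite (le_trans d0)// ltW.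
  have [y0|y0] := leP 0 (complex.Im z).
    by apply: (upper_half_plane_bound _ A0 tau0 FA Hr) => // w; exact: hF.
  have := @upper_half_plane_bound (fun w => F (- w)) A tau r _ A0 tau0 _ _ (- z).
  rewrite opprK cabsN; apply.
  - move=> w; apply: (@hol_comp _ (fun w => - w) F); last exact: hF.
    by apply: holN; exact: hol_id.
  - by move=> x; have := FA (- x); rewrite sqrrN rmorphN.
  - by move=> w rw; have := Hr (- w); rewrite cabsN => /(_ rw).
  - by rewrite ImN oppr_ge0 ltW.
rewrite leNgt; apply/negP => H; set B := A * _ in B0 main H.
have e1 : 0 < expR (delta * cabs z) := expR_gt0 _.
have [zz|z0] := eqVneq (cabs z) 0.
  have := main (delta + 1); rewrite ltrDl ltr01 => /(_ isT).
  by move: H; rewrite zz !mulr0 expR0; lra.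
have zp : 0 < cabs z by rewrite lt_def z0 cabs_ge0.
have [B00|Bp] := eqVneq B 0.
  have := main (delta + 1); rewrite ltrDl ltr01 => /(_ isT).
  by move: H; rewrite B00 !mul0r; lra.
have {}Bp : 0 < B by rewrite lt_def Bp.
have Be0 : 0 < B * expR (delta * cabs z) by exact: mulr_gt0.
have q1 : 1 < cabs (F z) / (B * expR (delta * cabs z)) by rewrite ltr_pdivlMr ?mul1r.
set q := cabs (F z) / _ in q1.
have lq : 0 < ln q by rewrite ln_gt0.
(* With this exponent the estimate becomes q <= sqrt q, which contradicts q > 1. *)
have := main (delta + ln q / 2 / cabs z); rewrite ltrDl !divr_gt0// => /(_ isT).
rewrite mulrDl divfK// expRD mulrA -ler_pdivrMl// [_^-1 * _]mulrC -/q.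
apply/negP; rewrite -ltNge -[ltRHS]lnK ?posrE ?(lt_trans ltr01)// ltr_expR.
by rewrite ltr_pdivrMr// mulr_natr mulr2n ltrDl.
Qed.

End exponential_type.

(** * Power series of functions of exponential type *)

Section cauchy_coefficients.
Context {R : realType}.
Local Notation C := R[i].
Implicit Types (F G g : C -> C) (u v x y r : R) (z w : C) (n N : nat).

Lemma hol_near F G z d : 0 < d -> (forall w, cabs (w - z) < d -> F w = G w) ->
  hol F z -> hol G z.
Proof.
move=> d0 FG /holP[D HD]; apply/holP; exists D => e /HD[d' d'0 H].
exists (Num.min d d'); first by rewrite lt_min d0.
move=> w; rewrite lt_min => /andP[wd wd']; rewrite -!FG//; first exact: H.
by rewrite subrr cabs0.
Qed.

(** Continuity of [g] is enough, which lets a mean be followed across a circle that meets a point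
    where holomorphy is not known. *)
Lemma mean_cont g u0 : (forall z, {for z, continuous (g : C^o -> C^o)}) ->
  {for u0, continuous (mean g)}.
Proof.
move=> cg; have pi20 := ltW (@twopi_gt0 R).
have u01 : u0 - 1 <= u0 + 1 by lra.
have [|xm [ym [_ _ gM]]] := @rect_EVT_max R (fun x y => `|complex.Re (g (x +i* y))|)
    (u0 - 1) (u0 + 1) 0 (2 * pi) u01 pi20.
  move=> x y _ _ e e0; have /contC_cabs/(_ _ e0)[d d0 Hd] := cg (x +i* y).
  exists (d / 2) => [|x' y' xx yy]; first by rewrite divr_gt0.
  apply: le_lt_trans (ler_dist_dist _ _) _; rewrite -ReN -ReD.
  apply: le_lt_trans (ge_cabs_Re _) _; apply: Hd.
  by apply: le_lt_trans (cabs_le_ReIm _) _; rewrite /= ; lra.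
have cl u : cont_line g u by move=> v; exact: cg.
apply: (@continuity_under_integral R _ _ lebesgue_measure
  (fun u v => complex.Re (g (u +i* v))) _ (measurable_itv `[0, (2 * pi)]) (u0 - 1) (u0 + 1)
  _ _ (cst `|complex.Re (g (xm +i* ym))|)).
- by move=> x _; apply: cont_on_integrable; exact: cont_line_on.
- apply: aeW => y _ x _; exact: (cont_u _).1.
- by apply: cont_on_integrable; exact: cont_on_cst.
- move=> x; rewrite /= in_itv /= => /andP[x1 x2]; apply: aeW => y; rewrite /= in_itv /= => y0.
  by apply: gM; rewrite ?(ltW x1) ?(ltW x2).
- by rewrite inE /= in_itv /=; apply/andP; split; lra.
Qed.

Lemma mean_lin g1 g2 k u : cont_line g1 u -> cont_line g2 u ->
  mean (fun w => g1 w + k%:C * g2 w) u = mean g1 u + k * mean g2 u.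
Proof.
move=> c1 c2; have k1 := cont_line_on (a := 0) (b := 2 * pi) c1.
have k2 := cont_line_on (a := 0) (b := 2 * pi) c2.
rewrite /mean -itgZ// -itgD//; last by move=> v vv; apply: cvgMr; exact: k2.
by apply: eq_itg => v _; rewrite ReD ReM /= mul0r subr0.
Qed.

Lemma eq_mean g1 g2 u : (forall v, g1 (u +i* v) = g2 (u +i* v)) -> mean g1 u = mean g2 u.
Proof. by move=> g12; apply: eq_itg => v _; rewrite g12. Qed.

Lemma hol_cont_line g u : (forall v, hol g (u +i* v)) -> cont_line g u.
Proof. by move=> hg v; exact: hol_cont. Qed.

(** The real part of Cauchy's integral of F(z) z^(- n - 1) dz / (2 pi i) over the unit circle, since
    dz / z = i dv there. When [F] is real on the real line this is its n-th Taylor coefficient. *)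
Definition cauchy_coef F n : R :=
  mean (fun w => F (cexp w) * (cexp w)^-1 ^+ n) 0 / (2 * pi).

Section entire.
Variable F : C -> C.
Hypothesis hF : entire F.

Let hol_F z : hol F z. Proof. exact: hF. Qed.

Let hol_g n w : hol (fun w => F (cexp w) * (cexp w)^-1 ^+ n) w.
Proof.
apply: holM; first by apply: (@hol_comp _ cexp F) => //; exact: hol_cexp.
by apply: holX; apply: holV; [exact: cexp_neq0|exact: hol_cexp].
Qed.

Lemma cauchy_coefE n u :
  mean (fun w => F (cexp w) * (cexp w)^-1 ^+ n) u = cauchy_coef F n * (2 * pi).
Proof.
rewrite /cauchy_coef (divfK (lt0r_neq0 (@twopi_gt0 R))).
have mc u1 u2 : u1 <= u2 -> mean (fun w => F (cexp w) * (cexp w)^-1 ^+ n) u1 =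
    mean (fun w => F (cexp w) * (cexp w)^-1 ^+ n) u2.
  move=> u12; apply: (mean_const u12) => [t v _|x]; first exact: hol_g.
  exact: (log_periodic (fun z => F z * z^-1 ^+ n)).
by have [/mc//|/ltW/mc ->] := leP u 0.
Qed.

Lemma cauchy_estimate B n r : 0 < r -> (forall z, cabs z = r -> cabs (F z) <= B) ->
  `|cauchy_coef F n| <= B / r ^+ n.
Proof.
move=> r0 FB; have p0 := @twopi_gt0 R.
rewrite -(ler_pM2r p0) -{1}(gtr0_norm p0) -normrM -(cauchy_coefE n (ln r)).
have B0 : 0 <= B by apply: le_trans (FB r%:C _); rewrite ?cabs_ge0// cabs_real gtr0_norm.
rewrite -[X in `|X|]subr0 -[X in `|_ - X|](mul0r (2 * pi)).
apply: mean_near.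
- by rewrite divr_ge0// exprn_ge0// ltW.
- by apply: hol_cont_line => v; exact: hol_g.
- move=> v _; rewrite subr0 cabsM cabsX cabsV cabs_cexp /= lnK ?posrE// exprVn.
  rewrite ler_pM2r ?invr_gt0 ?exprn_gt0//.
  by apply: FB; rewrite cabs_cexp /= lnK ?posrE.
Qed.

(** The N-th remainder of the geometric expansion of the Cauchy kernel: with z = e^w, z / (z - x) =
    sum_(n < N) (x / z)^n + (x / z)^N z / (z - x). *)
Let T x N w := F (cexp w) * ((x%:C / cexp w) ^+ N * (cexp w / (cexp w - x%:C))).

Let off_circle x u v : `|x| < expR u -> cexp (u +i* v) - x%:C != 0.
Proof.
move=> xu; rewrite subr_eq0; apply: contraTneq xu => E.
by rewrite -cabs_real -E cabs_cexp ltxx.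
Qed.

Let hol_T x N u v : `|x| < expR u -> hol (T x N) (u +i* v).
Proof.
move=> xu; apply: holM; first by apply: (@hol_comp _ cexp F) => //; exact: hol_cexp.
apply: holM.
  apply: holX; apply: holM; first exact: hol_cst.
  by apply: holV; [exact: cexp_neq0|exact: hol_cexp].
apply: holM; first exact: hol_cexp.
apply: holV; first exact: off_circle.
by apply: holB; [exact: hol_cexp|exact: hol_cst].
Qed.

Let T_sum x u N : `|x| < expR u ->
  mean (T x 0) u = (2 * pi) * (\sum_(0 <= n < N) cauchy_coef F n * x ^+ n) + mean (T x N) u.
Proof.
move=> xu; elim: N => [|N IH]; first by rewrite big_nil mulr0 add0r.
rewrite IH big_nat_recr//=; set P := 2 * pi; set S := \sum_(_ <= _ < _) _.
rewrite (mulrDr P S) -(addrA (P * S)); congr (_ + _); rewrite /P.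
have -> : mean (T x N) u =
    mean (fun w => T x N.+1 w + (x ^+ N)%:C * (F (cexp w) * (cexp w)^-1 ^+ N)) u.
  apply: eq_mean => v; rewrite /T; set z := cexp _; set f := F z.
  have z0 : z != 0 by exact: cexp_neq0.
  have zx : z - x%:C != 0 by exact: off_circle.
  rewrite exprS rmorphXn /= expr_div_n -exprVn.
  move: (x%:C ^+ N) (z^-1 ^+ N) => a b.
  by field; rewrite z0 zx.
rewrite mean_lin; last 2 first.
- by apply: hol_cont_line => v; exact: hol_T.
- by apply: hol_cont_line => v; exact: hol_g.
by rewrite cauchy_coefE addrC; congr (_ + _); ring.
Qed.

Let T_rem x u N B : `|x| < expR u ->
  (forall z, cabs z = expR u -> cabs (F z) <= B) ->
  `|mean (T x N) u| <= B * (expR u / (expR u - `|x|)) * (2 * pi) * (`|x| / expR u) ^+ N.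
Proof.
move=> xu FB; have p0 := @twopi_gt0 R; set r := expR u in xu FB *.
have r0 : 0 < r by exact: expR_gt0.
have B0 : 0 <= B by apply: le_trans (FB r%:C _); rewrite ?cabs_ge0// cabs_real gtr0_norm.
have rx : 0 < r - `|x| by rewrite subr_gt0.
rewrite [leRHS](_ : _ = B * ((`|x| / r) ^+ N * (r / (r - `|x|))) * (2 * pi)); last by ring.
rewrite -[X in `|X|]subr0 -[X in `|_ - X|](mul0r (2 * pi)).
apply: mean_near.
- have [r0' rx'] := (ltW r0, ltW rx).
  by apply: mulr_ge0 => //; apply: mulr_ge0; rewrite ?exprn_ge0 ?divr_ge0.
- by apply: hol_cont_line => v; exact: hol_T.
- move=> v _; rewrite subr0 /T !cabsM cabsX cabs_div !cabsV cabs_cexp cabs_real /= -/r.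
  have z0 : 0 < cabs (cexp (u +i* v) - x%:C) by rewrite cabs_gt0 off_circle.
  apply: ler_pM; rewrite ?cabs_ge0//.
  + by apply: mulr_ge0; rewrite ?exprn_ge0 ?divr_ge0 ?(ltW r0) ?(ltW z0).
  + by apply: FB; rewrite cabs_cexp.
  + rewrite ler_wpM2l ?exprn_ge0 ?divr_ge0 ?(ltW r0)//.
    rewrite ler_pM2l// lef_pV2 ?posrE//.
    have := cabsD (cexp (u +i* v) - x%:C) x%:C; rewrite subrK cabs_cexp cabs_real /= -/r.
    by lra.
Qed.

(** The remainder decreases like (|x| / expR u)^N. The limit is left as a Cauchy integral;
    [cauchy_formula] identifies it with the value at [x]. *)
Lemma cauchy_series x u B : `|x| < expR u ->
  (forall z, cabs z = expR u -> cabs (F z) <= B) ->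
  series (fun n => cauchy_coef F n * x ^+ n) @ \oo -->
    mean (fun w => F (cexp w) * (cexp w / (cexp w - x%:C))) u / (2 * pi).
Proof.
move=> xu FB; have p0 := @twopi_gt0 R.
have -> : mean (fun w => F (cexp w) * (cexp w / (cexp w - x%:C))) u = mean (T x 0) u.
  by apply: eq_mean => v; rewrite /T expr0 mul1r.
have -> : series (fun n => cauchy_coef F n * x ^+ n) =
    (fun N => mean (T x 0) u / (2 * pi) - mean (T x N) u / (2 * pi)).
  apply/funext => N; rewrite /series /= (T_sum N xu) -mulrBl addrK mulrC mulKf//.
  by rewrite gt_eqF.
rewrite -[X in _ --> X]subr0; apply: cvgB; first exact: cvg_cst.
rewrite -(mul0r (2 * pi)^-1); apply: cvgMl.
apply/cvgr0Pnorm_lt => e e0.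
have q1 : `| (`|x| / expR u) | < 1.
  by rewrite ger0_norm ?divr_ge0 ?expR_ge0// ltr_pdivrMr ?expR_gt0// mul1r.
have := cvg_geometric (B * (expR u / (expR u - `|x|)) * (2 * pi)) q1.
move=> /cvgr0Pnorm_lt/(_ _ e0); apply: filterS => N /=.
by apply: le_lt_trans; apply: le_trans (T_rem N xu FB) (ler_norm _).
Qed.

End entire.

(** This is [cauchy_series] for the constant function 1: the coefficients of positive index vanish
    by Cauchy's estimate on large circles, so the series reduces to its first term. *)
Lemma mean_kernel x u : `|x| < expR u ->
  mean (fun w => cexp w / (cexp w - x%:C)) u = 2 * pi.
Proof.
move=> xu; have p0 := @twopi_gt0 R.
have h1 : entire (cst (1 : C)) by move=> z _; exact: hol_cst.
have := @cauchy_series _ h1 x u 1 xu (fun z _ => eq_ind_r (fun t => t <= 1) (lexx 1) (@cabs1 R)).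
have -> : (fun n => cauchy_coef (cst 1) n * x ^+ n) = (fun n => (n == 0%N)%:R).
  apply/funext => -[|n].
    rewrite mulr1 /cauchy_coef; under eq_fun do rewrite mul1r expr0.
    by rewrite /mean itg_cst ?(ltW p0)// subr0 mul1r divff// gt_eqF.
  suff -> : cauchy_coef (cst 1) n.+1 = 0 by rewrite mul0r.
  apply/eqP; rewrite -normr_eq0 eq_le normr_ge0 andbT.
  apply/ler_addgt0Pr => e e0; rewrite add0r.
  (* With r >= 1 and r >= 1 / e one has 1 / r^(n + 1) <= 1 / r <= e. *)
  pose r := Num.max 1 e^-1.
  have r1 : 1 <= r by rewrite le_max lexx.
  have r0 : 0 < r by exact: lt_le_trans r1.
  have := @cauchy_estimate _ h1 1 n.+1 r r0 (fun z _ => eq_ind_r (fun t => t <= 1) (lexx 1) (@cabs1 R)).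
  move=> /le_trans; apply; rewrite div1r invf_ple ?posrE ?exprn_gt0//.
  apply: (@le_trans _ _ r); first by rewrite le_max lexx orbT.
  by rewrite exprS ler_peMr ?(ltW r0)// exprn_ege1.
have c1 : series (fun n => (n == 0%N)%:R : R) @ \oo --> (1 : R).
  apply: cvg_near_cst; exists 1%N => // -[//|n] _ /=.
  by rewrite /series /= big_nat_recl// big1 ?addr0.
move=> /(cvg_unique _)/(_ c1) => H.
have := congr1 (fun t => t * (2 * pi)) (H (@norm_hausdorff R R)).
rewrite /= (divfK (lt0r_neq0 p0)) mul1r => <-.
by apply: eq_mean => v; rewrite mul1r.
Qed.

(** Put H(z) = z (F(z) - F(x)) / (z - x), completed at x by the derivative. It is holomorphic off x
    and continuous at x. Its mean [J] is 0 on circles of radius below |x|, because H(0) = 0, and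
    constant on larger ones; continuity of [J] at radius |x| makes that constant 0. What remains of
    the Cauchy integral is F(x) times the mean of the kernel. *)
Lemma cauchy_formula F x u : entire F -> complex.Im (F x%:C) = 0 -> `|x| < expR u ->
  mean (fun w => F (cexp w) * (cexp w / (cexp w - x%:C))) u =
    complex.Re (F x%:C) * (2 * pi).
Proof.
move=> hF Fx xu; have p0 := @twopi_gt0 R.
have hol_F z : hol F z by exact: hF.
have [x0|x0] := eqVneq x 0.
  have := @mean_value _ F 0 (expR u) (expR_gt0 u) (fun w _ => hol_F w).
  rewrite x0 expRK => <-; apply: eq_mean => v.
  by rewrite add0r subr0 divff ?cexp_neq0// mulr1.
have [D HD] := (holP F x%:C).1 (hol_F _).
pose H z := z * (if z == x%:C then D else (F z - F x%:C) / (z - x%:C)).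
have hol_H z : z != x%:C -> hol H z.
  move=> zx; have zx' : z - x%:C != 0 by rewrite subr_eq0.
  apply: (@hol_near (fun z => z * ((F z - F x%:C) / (z - x%:C))) _ _ (cabs (z - x%:C))).
  - by rewrite cabs_gt0.
  - move=> w wz; rewrite /H; case: eqP => // wx.
    by move: wz; rewrite wx cabsC ltxx.
  - apply: holM; first exact: hol_id.
    apply: holM; first by apply: holB => //; exact: hol_cst.
    by apply: holV => //; apply: holB.
have cH z : {for z, continuous (H : C^o -> C^o)}.
  have [->|zx] := eqVneq z x%:C; last by apply: hol_cont; exact: hol_H.
  have ci : {for x%:C, continuous (id : C^o -> C^o)} by exact: cvg_id.
  suff cq : {for x%:C, continuous
      ((fun z => if z == x%:C then D else (F z - F x%:C) / (z - x%:C)) : C^o -> C^o)}.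
    exact: (@continuousM _ C^o _ _ _ ci cq).
  apply/contC_cabs => e e0; rewrite eqxx.
  have [d d0 Hd] := HD _ (divr_gt0 e0 (ltr0n R 2)).
  exists d => // w wd; case: eqP => [_|/eqP wx]; first by rewrite subrr cabs0.
  have wx' : w - x%:C != 0 by rewrite subr_eq0.
  have -> : (F w - F x%:C) / (w - x%:C) - D = (F w - F x%:C - D * (w - x%:C)) / (w - x%:C).
    by rewrite [RHS]mulrBl mulfK.
  rewrite cabs_div ltr_pdivrMr ?cabs_gt0//; apply: le_lt_trans (Hd _ wd) _.
  by rewrite ltr_pM2r ?cabs_gt0// ltr_pdivrMr// mulr_natr mulr2n ltrDr.
pose J := mean (fun w => H (cexp w)).
have cJ t : {for t, continuous J}.
  apply: mean_cont => z; apply: (@continuous_comp _ _ _ (cexp : C^o -> C^o) (H : C^o -> C^o)).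
    by apply: hol_cont; exact: hol_cexp.
  exact: cH.
pose u0 := ln `|x|.
have ax0 : 0 < `|x| by rewrite normr_gt0.
have neq t v : t != u0 -> cexp (t +i* v) != x%:C.
  apply: contra_neq => E; rewrite /u0 -cabs_real -E cabs_cexp expRK//.
have Jlt t : t < u0 -> J t = 0.
  move=> tu; have := @mean_value _ H 0 (expR t) (expR_gt0 t).
  have -> : H 0 = 0 by rewrite /H mul0r.
  rewrite expRK mul0r => <-.
    by apply: eq_mean => v; rewrite add0r.
  move=> w; rewrite subr0 => wt; apply: hol_H; apply: contraTneq wt => ->.
  by rewrite cabs_real -ltNge -[ltRHS]lnK ?posrE// ltr_expR.
have Ju0 : J u0 = 0.
  apply/eqP; rewrite -normr_eq0 eq_le normr_ge0 andbT.
  apply/ler_addgt0Pr => e e0; rewrite add0r.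
  have /cvgrPdist_lt/(_ _ e0)/nbhs_ballP[d /= d0 Hd] := cJ u0.
  have := Hd (u0 - d / 2); rewrite /ball /= opprB addrC subrK gtr0_norm ?divr_gt0//.
  rewrite ltr_pdivrMr// mulr_natr mulr2n ltrDr d0 => /(_ isT).
  by rewrite (Jlt (u0 - d / 2)) ?subr0 => [/ltW//|]; rewrite gtrBl divr_gt0.
have uu0 : u0 < u by rewrite -ltr_expR lnK ?posrE.
have Jgt t : u0 < t -> J t = J u.
  have Jc t1 t2 : u0 < t1 -> t1 <= t2 -> J t1 = J t2.
    move=> ut t12; apply: (mean_const t12) => [y v /andP[ty _]|y].
      apply: (@hol_comp _ cexp H); first exact: hol_cexp.
      by apply: hol_H; apply: neq; rewrite gt_eqF// (lt_le_trans ut).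
    exact: (log_periodic H).
  by move=> ut; have [tu|/ltW ut'] := leP t u; [exact: Jc|apply/esym; exact: Jc].
have Ju : J u = 0.
  apply/eqP; rewrite -normr_eq0 eq_le normr_ge0 andbT.
  apply/ler_addgt0Pr => e e0; rewrite add0r.
  have /cvgrPdist_lt/(_ _ e0)/nbhs_ballP[d /= d0 Hd] := cJ u0.
  have := Hd (u0 + d / 2); rewrite /ball /= opprD addrA subrr sub0r normrN gtr0_norm ?divr_gt0//.
  rewrite ltr_pdivrMr// mulr_natr mulr2n ltrDr d0 => /(_ isT).
  rewrite Ju0 sub0r normrN (Jgt (u0 + d / 2)) => [/ltW//|]; rewrite ltrDl divr_gt0//.
have Fxr : F x%:C = (complex.Re (F x%:C))%:C by apply: cplx_eq.
transitivity (mean (fun w => H (cexp w) + (complex.Re (F x%:C))%:C * (cexp w / (cexp w - x%:C))) u).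
  apply: eq_mean => v; have zx := neq u v (negbT (gt_eqF uu0)).
  rewrite /H (negbTE zx) -Fxr.
  by field; rewrite subr_eq0.
rewrite mean_lin; last 2 first.
- by move=> v; apply: hol_cont; apply: (@hol_comp _ cexp H); [exact: hol_cexp|
    apply: hol_H; apply: neq; rewrite gt_eqF].
- apply: hol_cont_line => v; apply: holM; first exact: hol_cexp.
  apply: holV; last by apply: holB; [exact: hol_cexp|exact: hol_cst].
  by rewrite subr_eq0; apply: neq; rewrite gt_eqF.
by rewrite -/(J u) Ju add0r mean_kernel.
Qed.

Theorem real_power_series F (A delta : R) : entire F -> real_on_reals F ->
  0 <= A -> 0 <= delta -> exponential_type_le delta F ->
  (forall x, cabs (F x%:C) <= A * (1 + x ^+ 2)) ->
  exists b : nat -> R,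
    (forall n r, 0 < r -> `|b n| <= A * (1 + r) ^+ 2 * expR (delta * r) / r ^+ n) /\
    (forall x, series (fun n => b n * x ^+ n) @ \oo --> complex.Re (F x%:C)).
Proof.
move=> hF Fr A0 d0 Fd FA; have H := exponential_type_bound hF A0 d0 Fd FA.
exists (cauchy_coef F); split=> [n r r0|x].
  by apply: cauchy_estimate => // z <-; exact: H.
have xu : `|x| < expR `|x| by apply: lt_le_trans (expR_ge1Dx _); rewrite ltrDr.
rewrite -[X in _ --> X](@mulfK _ (2 * pi)) ?gt_eqF ?twopi_gt0//.
rewrite -(cauchy_formula hF (Fr x) xu).
pose B := A * (1 + expR `|x|) ^+ 2 * expR (delta * expR `|x|).
by apply: (@cauchy_series F hF x _ B xu) => z zx; rewrite /B -zx.
Qed.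

End cauchy_coefficients.

(** * Entire functions given by real power series *)

Section power_series.
Context {R : realType}.
Local Notation C := R[i].
Implicit Types (b t : nat -> R) (x y r : R) (z w : C) (n N : nat).

(** Infinite radius of convergence, stated as boundedness of the terms at every radius. Using it at
    radius 2 r gives geometric domination at radius r. *)
Definition entire_coef b := forall r, 0 < r -> exists K, forall n, `|b n| * r ^+ n <= K.

Lemma geometric_sum_le (q : R) N : 0 <= q -> q < 1 ->
  \sum_(0 <= n < N) q ^+ n <= (1 - q)^-1.
Proof.
move=> q0 q1; have q1' : 0 < 1 - q by rewrite subr_gt0.
have -> : \sum_(0 <= n < N) q ^+ n = (1 - q ^+ N) / (1 - q).
  elim: N => [|N IH]; first by rewrite big_nil expr0 subrr mul0r.
  by rewrite big_nat_recr//= IH exprSr; field; rewrite gt_eqF.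
by rewrite -[leRHS]mul1r ler_pM2r ?invr_gt0// gerBl exprn_ge0.
Qed.

Lemma entire_coef_sum_le b (r : R) : entire_coef b -> 0 < r ->
  exists K, forall N, \sum_(0 <= n < N) `|b n| * r ^+ n <= K.
Proof.
move=> hb r0; have [|K HK] := hb (2 * r); first by rewrite mulr_gt0.
exists (K * (1 - 2^-1)^-1) => N.
have K0 : 0 <= K by apply: le_trans (HK 0%N); rewrite expr0 mulr1.
apply: (@le_trans _ _ (\sum_(0 <= n < N) K * 2^-1 ^+ n)).
  apply: ler_sum => n _; rewrite exprVn ler_pdivlMr ?exprn_gt0//.
  by rewrite -mulrA -exprMn [r * 2]mulrC.
rewrite -mulr_sumr ler_wpM2l//; apply: geometric_sum_le; first by rewrite invr_ge0.
by rewrite invf_lt1// ltr1n.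
Qed.

Lemma entire_coef_cvg b t (r : R) : entire_coef b -> 0 < r ->
  (forall n, `|t n| <= `|b n| * r ^+ n) -> cvgn (series t).
Proof.
move=> hb r0 tb; have [|K HK] := hb (2 * r); first by rewrite mulr_gt0.
have K0 : 0 <= K by apply: le_trans (HK 0%N); rewrite expr0 mulr1.
apply: normed_cvg; apply: (@series_le_cvg _ _ (geometric K 2^-1)) => [n|n|n|].
- exact: normr_ge0.
- by rewrite /= mulr_ge0// exprn_ge0// invr_ge0.
- apply: (le_trans (tb n)); rewrite /= exprVn ler_pdivlMr ?exprn_gt0//.
  by rewrite -mulrA -exprMn [r * 2]mulrC.
- by apply: is_cvg_geometric_series; rewrite ger0_norm ?invr_ge0// invf_lt1// ltr1n.
Qed.

Definition psum b N z : C := \sum_(0 <= n < N) (b n)%:C * z ^+ n.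

(** The real and imaginary parts are separate limits, so that convergence is a question about real
    series. *)
Definition cps b z : C :=
  (limn (series (fun n => b n * complex.Re (z ^+ n)))) +i*
  (limn (series (fun n => b n * complex.Im (z ^+ n)))).

Definition rps b x : R := limn (series (fun n => b n * x ^+ n)).

Lemma Re_psum b N z : complex.Re (psum b N z) = series (fun n => b n * complex.Re (z ^+ n)) N.
Proof.
rewrite /psum /series /=; elim: N => [|N IH]; first by rewrite !big_nil.
by rewrite !big_nat_recr//= ReD IH ReM /= mul0r subr0.
Qed.

Lemma Im_psum b N z : complex.Im (psum b N z) = series (fun n => b n * complex.Im (z ^+ n)) N.
Proof.
rewrite /psum /series /=; elim: N => [|N IH]; first by rewrite !big_nil.
by rewrite !big_nat_recr//= ImD IH ImM /= mul0r addr0.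
Qed.

Lemma psum_cvg b z : entire_coef b -> forall e, 0 < e ->
  \forall N \near \oo, cabs (psum b N z - cps b z) < e.
Proof.
move=> hb e e0; have z1 : 0 < cabs z + 1 by rewrite ltr_wpDl// cabs_ge0.
have zn n : cabs (z ^+ n) <= (cabs z + 1) ^+ n.
  by rewrite cabsX lerXn2r ?nnegrE ?cabs_ge0 ?(ltW z1)// lerDl.
have cR : cvgn (series (fun n => b n * complex.Re (z ^+ n))).
  apply: (entire_coef_cvg hb z1) => n; rewrite normrM ler_wpM2l//.
  exact: le_trans (ge_cabs_Re _) (zn n).
have cI : cvgn (series (fun n => b n * complex.Im (z ^+ n))).
  apply: (entire_coef_cvg hb z1) => n; rewrite normrM ler_wpM2l//.
  exact: le_trans (ge_cabs_Im _) (zn n).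
have e20 : 0 < e / 2 by rewrite divr_gt0.
move: cR cI => /cvgrPdist_lt/(_ _ e20) cR /cvgrPdist_lt/(_ _ e20) cI.
near=> N; apply: le_lt_trans (cabs_le_ReIm _) _.
rewrite ReD ReN ImD ImN Re_psum Im_psum /= distrC [X in _ + X]distrC.
rewrite [e]splitr; apply: ltrD.
- by near: N.
- by near: N.
Unshelve. all: by end_near. Qed.

Lemma cvg_cabs_le (u : nat -> C) (l : C) K :
  (forall e, 0 < e -> \forall N \near \oo, cabs (u N - l) < e) ->
  (forall N, cabs (u N) <= K) -> cabs l <= K.
Proof.
move=> ul uK; apply/ler_addgt0Pr => e /ul[N _ /(_ N (leqnn N)) uN].
rewrite -[l](subrK (u N)) (le_trans (cabsD _ _))// addrC lerD ?uK//.
by rewrite cabsC ltW.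
Qed.

Lemma cps_le b z (r K : R) : entire_coef b -> cabs z <= r ->
  (forall N, \sum_(0 <= n < N) `|b n| * r ^+ n <= K) -> cabs (cps b z) <= K.
Proof.
move=> hb zr HK; apply: (cvg_cabs_le (psum_cvg z hb)) => N; apply: le_trans (HK N).
have r0 : 0 <= r by exact: le_trans (cabs_ge0 z) zr.
rewrite /psum; elim: N => [|N IH]; first by rewrite !big_nil cabs0.
rewrite !big_nat_recr//= (le_trans (cabsD _ _))// lerD//.
by rewrite cabsM cabs_real cabsX ler_wpM2l// lerXn2r ?nnegrE ?cabs_ge0.
Qed.

Lemma leq_S_exp2 n : n.+1%:R <= 2 ^+ n :> R.
Proof. by rewrite -natrX ler_nat ltn_expl. Qed.

Lemma entire_coef_diffs b : entire_coef b -> entire_coef (pseries_diffs b).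
Proof.
move=> hb r r0; have r20 : 0 < 2 * r by rewrite mulr_gt0.
have [K HK] := hb _ r20; exists (K / (2 * r)) => n.
rewrite ler_pdivlMr//; apply: le_trans (HK n.+1).
rewrite /pseries_diffs normrM normr_nat exprSr [leRHS]mulrA ler_pM2r//.
rewrite exprMn [leRHS]mulrCA -[leLHS]mulrA ler_wpM2r ?mulr_ge0 ?exprn_ge0 ?(ltW r0)//.
exact: leq_S_exp2.
Qed.

(** Induction through w^(n+1) = w w^n leaves the extra term n z^(n-1) (w - z)^2, and n^2 + n <= (n +
    1)^2. As rho >= 1, the missing powers of rho can be added freely. *)
Lemma pow_taylor z w (rho : R) n : 1 <= rho -> cabs z <= rho -> cabs w <= rho ->
  cabs (w ^+ n - z ^+ n - n%:R * z ^+ n.-1 * (w - z)) <=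
    n%:R ^+ 2 * rho ^+ n * cabs (w - z) ^+ 2.
Proof.
move=> r1 zr wr; have r0 : 0 <= rho by exact: le_trans r1.
elim: n => [|n IH].
  by rewrite !expr0 subrr mul0r mul0r subr0 cabs0 expr0n /= !mul0r.
have -> : w ^+ n.+1 - z ^+ n.+1 - n.+1%:R * z ^+ n * (w - z) =
    w * (w ^+ n - z ^+ n - n%:R * z ^+ n.-1 * (w - z)) +
    n%:R * z ^+ n.-1 * (w - z) ^+ 2.
  case: n {IH} => [|n] /=; first by rewrite !expr0 !expr1; ring.
  by rewrite -[n.+2%:R]natr1 !exprS; ring.
apply: le_trans (cabsD _ _) _; rewrite [cabs (w * _)]cabsM [cabs (_ * (w - z) ^+ 2)]cabsM.
rewrite [cabs (n%:R * _)]cabsM [cabs ((w - z) ^+ 2)]cabsX.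
have nz : cabs (n%:R : C) = n%:R by rewrite -(rmorph_nat (real_complex R)) cabs_real normr_nat.
rewrite nz; set d := cabs (w - z) in IH *.
have d0 : 0 <= d := cabs_ge0 _.
have h1 : cabs w * cabs (w ^+ n - z ^+ n - n%:R * z ^+ n.-1 * (w - z)) <=
    rho * (n%:R ^+ 2 * rho ^+ n * d ^+ 2) by apply: ler_pM; rewrite ?cabs_ge0.
have h2 : cabs (z ^+ n.-1) <= rho ^+ n.+1.
  rewrite cabsX (@le_trans _ _ (rho ^+ n.-1))//.
    by rewrite lerXn2r ?nnegrE ?cabs_ge0.
  by rewrite ler_weXn2l// (leq_trans (leq_pred n))//.
have h3 : n%:R * cabs (z ^+ n.-1) * d ^+ 2 <= n%:R * rho ^+ n.+1 * d ^+ 2.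
  by rewrite ler_wpM2r ?exprn_ge0// ler_wpM2l.
apply: le_trans (lerD h1 h3) _; rewrite -[n.+1%:R]natr1.
have -> : rho * (n%:R ^+ 2 * rho ^+ n * d ^+ 2) + n%:R * rho ^+ n.+1 * d ^+ 2 =
  (n%:R ^+ 2 + n%:R) * (rho ^+ n.+1 * d ^+ 2) by rewrite (exprS rho n); ring.
rewrite -[leRHS]mulrA ler_wpM2r ?mulr_ge0 ?exprn_ge0//.
have : 0 <= n%:R :> R by [].
by move: (n%:R) => m m0; rewrite -subr_ge0 (_ : _ - _ = m + 1); [lra|ring].
Qed.

Lemma psum_diffs b N z : psum (pseries_diffs b) N z =
  \sum_(0 <= n < N.+1) (b n)%:C * (n%:R * z ^+ n.-1).
Proof.
rewrite big_nat_recl//= mul0r mulr0 add0r; apply: eq_bigr => n _.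
by rewrite /pseries_diffs rmorphM rmorph_nat /=; ring.
Qed.

Lemma cps_taylor b (rho : R) : entire_coef b -> 1 <= rho -> exists K, forall z w,
  cabs z <= rho -> cabs w <= rho ->
  cabs (cps b w - cps b z - cps (pseries_diffs b) z * (w - z)) <= K * cabs (w - z) ^+ 2.
Proof.
move=> hb r1; have r0 : 0 < rho by exact: lt_le_trans r1.
have r40 : 0 < 4 * rho by rewrite mulr_gt0.
(* The radius 4 rho absorbs the factor n^2 of [pow_taylor], since n^2 <= 4^n. *)
have [K HK] := entire_coef_sum_le hb r40; exists K => z w zr wr.
(* Differentiation lowers the degree by one: [N.+1] terms of the series go with [N] terms of the
   derived series. *)
apply: (@cvg_cabs_le (fun N => psum b N.+1 w - psum b N.+1 z -
    psum (pseries_diffs b) N z * (w - z))).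
  move=> e e0; have e30 : 0 < e / 3 by rewrite divr_gt0.
  have e40 : 0 < e / 3 / (cabs (w - z) + 1) by rewrite divr_gt0// ltr_wpDl// cabs_ge0.
  have [N1 _ cw] := psum_cvg w hb e30; have [N2 _ cz] := psum_cvg z hb e30.
  have [N3 _ cd] := psum_cvg z (entire_coef_diffs hb) e40.
  exists (maxn N1 (maxn N2 N3)) => // N; rewrite /= !geq_max => /and3P[N1N N2N N3N].
  have hw := cw N.+1 (leqW N1N); have hz := cz N.+1 (leqW N2N); have hd := cd N N3N.
  move: (psum b N.+1 w) (psum b N.+1 z) (psum (pseries_diffs b) N z)
    (cps b w) (cps b z) (cps (pseries_diffs b) z)    hw hz hd => u1 u2 u3 l1 l2 l3 hw hz hd.
  have -> : u1 - u2 - u3 * (w - z) - (l1 - l2 - l3 * (w - z)) =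
    (u1 - l1) - (u2 - l2) - (u3 - l3) * (w - z) by ring.
  apply: le_lt_trans (cabsB _ _) _; rewrite cabsM.
  have h12 := cabsB (u1 - l1) (u2 - l2).
  have h3 : cabs (u3 - l3) * cabs (w - z) <= e / 3.
    apply: (@le_trans _ _ (e / 3 / (cabs (w - z) + 1) * (cabs (w - z) + 1))).
      by apply: ler_pM; rewrite ?cabs_ge0 ?(ltW hd)// lerDl.
    by rewrite divfK// gt_eqF// ltr_wpDl// cabs_ge0.
  by move: hw hz h12 h3; clear; lra.
move=> N; rewrite psum_diffs /psum -!sumrB mulr_suml -sumrB.
apply: le_trans (ler_wpM2r (exprn_ge0 _ (cabs_ge0 _)) (HK N.+1)).
rewrite mulr_suml.
elim: N.+1 => [|n IH]; first by rewrite !big_nil cabs0.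
rewrite !big_nat_recr//= (le_trans (cabsD _ _))// lerD//.
have -> : (b n)%:C * w ^+ n - (b n)%:C * z ^+ n - (b n)%:C * (n%:R * z ^+ n.-1) * (w - z) =
  (b n)%:C * (w ^+ n - z ^+ n - n%:R * z ^+ n.-1 * (w - z)) by ring.
rewrite cabsM cabs_real -[leRHS]mulrA ler_wpM2l//; apply: le_trans (pow_taylor n r1 zr wr) _.
rewrite ler_wpM2r ?exprn_ge0 ?cabs_ge0// exprMn ler_wpM2r ?exprn_ge0 ?(ltW r0)//.
rewrite (_ : 4 = 2 ^+ 2); last by ring.
rewrite -exprM mulnC exprM lerXn2r ?nnegrE ?exprn_ge0//.
by apply: le_trans (leq_S_exp2 n); rewrite ler_nat.
Qed.

Lemma entire_cps b : entire_coef b -> entire (cps b).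
Proof.
move=> hb z _; apply/holP; exists (cps (pseries_diffs b) z) => e e0.
have r1 : 1 <= cabs z + 1 by rewrite lerDr cabs_ge0.
have [K HK] := cps_taylor hb r1.
have d0 : 0 < Num.min 1 (e / (`|K| + 1)) by rewrite lt_min ltr01 /= divr_gt0// ltr_wpDl.
exists (Num.min 1 (e / (`|K| + 1))) => // w; rewrite lt_min => /andP[w1 w2].
apply: le_trans (HK z w _ _) _.
- by rewrite lerDl.
- by rewrite -[w](subrK z) (le_trans (cabsD _ _))// addrC lerD2l ltW.
rewrite expr2 mulrA ler_wpM2r ?cabs_ge0//.
move: w2; rewrite ltr_pdivlMr ?ltr_wpDl// => w2.
have : K * cabs (w - z) <= `|K| * cabs (w - z) by rewrite ler_wpM2r ?cabs_ge0// ler_norm.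
have := cabs_ge0 (w - z); lra.
Qed.

Lemma cps_real b x : cps b x%:C = (rps b x)%:C.
Proof.
rewrite /cps /rps; apply: cplx_eq => /=.
  have -> // : (fun n => b n * complex.Re (x%:C ^+ n)) = (fun n => b n * x ^+ n).
  by apply/funext => n; rewrite -rmorphXn.
have -> : (fun n => b n * complex.Im (x%:C ^+ n)) = (fun=> 0).
  by apply/funext => n; rewrite -rmorphXn /= mulr0.
have -> : series (fun=> 0 : R) = (fun=> 0) by apply/funext => n; rewrite /series /= big1.
exact: lim_cst.
Qed.

Lemma rps_cvg b x : entire_coef b -> series (fun n => b n * x ^+ n) @ \oo --> rps b x.
Proof.
move=> hb; have x1 : 0 < `|x| + 1 by rewrite ltr_wpDl.
apply: (@entire_coef_cvg b _ _ hb x1) => n.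
by rewrite normrM normrX ler_wpM2l// lerXn2r ?nnegrE ?(ltW x1)// lerDl.
Qed.

Lemma is_derive_rps b x : entire_coef b ->
  is_derive x 1 (rps b) (rps (pseries_diffs b) x).
Proof.
move=> hb; apply: (@pseries_snd_diffs R b (`|x| + 1)).
- by apply/cvg_ex; eexists; exact: rps_cvg.
- by apply/cvg_ex; eexists; apply: rps_cvg; exact: entire_coef_diffs.
- by apply/cvg_ex; eexists; apply: rps_cvg; do 2 apply: entire_coef_diffs.
- by rewrite [X in _ < X]ger0_norm ?addr_ge0// ltrDl.
Qed.

(** With q = 1 + c t / 3 one has q^3 <= expR (c t) and 1 + a t <= k q. So K k^2 <= q is sufficient,
    and this holds for large t. *)
Lemma poly_le_expR (K a c : R) : 0 <= K -> 0 <= a -> 0 < c -> exists T : R, forall t : R, T <= t ->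
  K * (1 + a * t) ^+ 2 <= expR (c * t).
Proof.
move=> K0 a0 c0; pose k := 1 + 3 * a / c.
have k0 : 0 <= k by rewrite addr_ge0// divr_ge0 ?mulr_ge0// ltW.
exists (Num.max 0 (3 * (K * k ^+ 2) / c)) => t; rewrite ge_max => /andP[t0].
rewrite ler_pdivrMr// => Ht; pose q := 1 + c * t / 3.
have ct0 : 0 <= c * t by rewrite mulr_ge0// ltW.
have q0 : 0 <= q by rewrite /q; lra.
have qk : 1 + a * t <= k * q.
  have -> : k * q = 1 + a * t + (3 * a / c + c * t / 3).
    by rewrite /k /q; field; rewrite gt_eqF.
  by rewrite lerDl addr_ge0 ?divr_ge0 ?mulr_ge0// ltW.
have qe : q ^+ 3 <= expR (c * t).
  have -> : c * t = 3%:R * (c * t / 3) by field.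
  rewrite expRM_natl lerXn2r ?nnegrE ?expR_ge0//.
  by rewrite /q expR_ge1Dx.
apply: le_trans qe.
apply: (@le_trans _ _ (K * (k * q) ^+ 2)).
  by rewrite ler_wpM2l// lerXn2r ?nnegrE ?addr_ge0 ?mulr_ge0.
rewrite exprMn mulrA exprS ler_wpM2r ?exprn_ge0// /q; lra.
Qed.

(** A converse to Cauchy's estimates. At the radius r = (1 + eta) |z| the series at z is dominated
    by a geometric one of ratio 1 / (1 + eta), so the exponent delta rises only to delta (1 +
    eta). *)
Lemma exponential_type_cps b (A delta : R) : 0 <= A -> 0 <= delta ->
  (forall n r, 0 < r -> `|b n| <= A * (1 + r) ^+ 2 * expR (delta * r) / r ^+ n) ->
  entire_coef b /\ exponential_type_le delta (cps b).
Proof.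
move=> A0 d0 hb.
have eb : entire_coef b.
  move=> r r0; exists (A * (1 + r) ^+ 2 * expR (delta * r)) => n.
  by rewrite -ler_pdivlMr ?exprn_gt0//; exact: hb.
split => //; apply/exponential_typeP => tau dt.
(* This gives delta eta <= (tau - delta) / 2, also when delta = 0. The other half of tau - delta,
   called [c], absorbs the polynomial factor. *)
pose eta := (tau - delta) / (2 * (delta + 1)).
have d10 : 0 < 2 * (delta + 1) by rewrite mulr_gt0// ltr_wpDl.
have eta0 : 0 < eta by rewrite divr_gt0// subr_gt0.
have etaE : eta * (2 * (delta + 1)) = tau - delta by rewrite divfK ?gt_eqF.
pose c := (tau - delta) / 2; have c0 : 0 < c by rewrite divr_gt0// subr_gt0.
pose K := A * (1 + eta) / eta.
have e10 : 0 < 1 + eta by rewrite addr_gt0.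
have K0 : 0 <= K by rewrite /K divr_ge0 ?(ltW eta0)// mulr_ge0// ltW.
have [|T HT] := @poly_le_expR K (1 + eta) c K0 _ c0; first by rewrite addr_ge0// ltW.
exists (Num.max 0 T) => z; rewrite gt_max => /andP[z0 /ltW/HT Tz].
set s := cabs z in z0 Tz *; pose r := (1 + eta) * s.
have r0 : 0 < r by rewrite mulr_gt0// addr_gt0.
apply: (@le_trans _ _ (K * (1 + r) ^+ 2 * expR (delta * r))).
  apply: (@cps_le b z s) => // N.
  apply: (@le_trans _ _ (\sum_(0 <= n < N)
      A * (1 + r) ^+ 2 * expR (delta * r) * (1 + eta)^-1 ^+ n)).
    apply: ler_sum => n _; have -> : (1 + eta)^-1 = s / r.
      by rewrite /r invfM mulrCA divff ?mulr1// gt_eqF.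
    rewrite expr_div_n (_ : _ * (s ^+ n / r ^+ n) =
      A * (1 + r) ^+ 2 * expR (delta * r) / r ^+ n * s ^+ n); last by ring.
    by rewrite ler_wpM2r ?exprn_ge0 ?(ltW z0)//; exact: hb.
  rewrite -mulr_sumr.
  have -> : K * (1 + r) ^+ 2 * expR (delta * r) =
      A * (1 + r) ^+ 2 * expR (delta * r) * (1 - (1 + eta)^-1)^-1.
    have e1 : 1 + eta != 0 by rewrite gt_eqF// addr_gt0.
    have -> : 1 - (1 + eta)^-1 = eta / (1 + eta) by field.
    by rewrite invf_div /K; ring.
  apply: ler_wpM2l; first by rewrite !mulr_ge0 ?exprn_ge0 ?expR_ge0// addr_ge0// ltW.
  apply: geometric_sum_le; first by rewrite invr_ge0 addr_ge0// ltW.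
  by rewrite invf_lt1 ?addr_gt0// ltrDl.
apply: le_trans (ler_wpM2r (expR_ge0 _) Tz) _.
rewrite -expRD ler_expR /r mulrA -mulrDl ler_wpM2r ?(ltW z0)//.
by rewrite /c; lra.
Qed.

End power_series.

(** * The functions A, B and the kernel on the real line *)

Section bessel_series.
Context {R : realType}.
Local Notation C := R[i].
Variable nu : R.
Hypothesis nu_gtN1 : -1 < nu.
Implicit Types (x y t : R) (z : C) (n N : nat).

(** The coefficients refer to the variable z^2: A(z) is the sum of [acoef n] z^(2 n), and B(z) is z
    times the sum of [bcoef n] z^(2 n). *)
Definition acoef n : R :=
  (-1) ^+ n / (4 ^+ n * (n`!%:R * \prod_(1 <= j < n.+1) (nu + j%:R))).
Definition bcoef n : R :=
  (-1) ^+ n / (2 * 4 ^+ n * (n`!%:R * \prod_(1 <= j < n.+2) (nu + j%:R))).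

Let K : R := 1 + (nu + 1)^-1.

Let nu1 : 0 < nu + 1. Proof. by move: nu_gtN1; lra. Qed.

Lemma nuS_gt0 n : 0 < nu + n.+1%:R.
Proof. by rewrite -natr1 addrCA ltr_wpDl. Qed.

Let prod_gt0 n : 0 < \prod_(1 <= j < n.+1) (nu + j%:R).
Proof.
elim: n => [|n IH]; first by rewrite big_nil.
by rewrite big_nat_recr//= mulr_gt0// nuS_gt0.
Qed.

Lemma acoefS n : acoef n.+1 = - acoef n / (4 * n.+1%:R * (nu + n.+1%:R)).
Proof.
rewrite /acoef big_nat_recr//= factS natrM !exprS.
have := prod_gt0 n; have := nuS_gt0 n; have : (0 < n`!%:R :> R) by rewrite ltr0n fact_gt0.
have : 0 < n.+1%:R :> R by []; have : 0 < (4 : R) ^+ n by rewrite exprn_gt0.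
move: (4 ^+ n) (n.+1%:R) (n`!%:R) (\prod_(_ <= _ < _) _) ((-1) ^+ n) => q m f p s.
by move=> q0 m0 f0 m1 p0; field; rewrite !gt_eqF.
Qed.

Lemma bcoefE n : bcoef n = acoef n / (2 * (nu + n.+1%:R)).
Proof.
rewrite /acoef /bcoef big_nat_recr//=.
have := prod_gt0 n; have := nuS_gt0 n; have : (0 < n`!%:R :> R) by rewrite ltr0n fact_gt0.
have : 0 < (4 : R) ^+ n by rewrite exprn_gt0.
move: (4 ^+ n) (nu + n.+1%:R) (n`!%:R) (\prod_(_ <= _ < _) _) ((-1) ^+ n) => q m f p s.
by move=> q0 f0 m1 p0; field; rewrite !gt_eqF.
Qed.

Lemma pseries_diffs_acoef n : pseries_diffs acoef n = - 2^-1 * bcoef n.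
Proof.
rewrite /pseries_diffs acoefS bcoefE; have p0 := nuS_gt0 n.
have m0 : 0 < n.+1%:R :> R by [].
by move: (n.+1%:R) p0 m0 => m p0 m0; field; rewrite !gt_eqF.
Qed.

(** This compares A with the hyperbolic cosine. The numbers |acoef n| (2 n)! have successive ratios
    (n + 1/2) / (nu + n + 1), at most (n + 2) / (n + 1) for n >= 1. The terms 0 and 1 are computed;
    the latter, 1 / (2 (nu + 1)), explains the form of [K]. *)
Lemma acoef_le n : `|acoef n| * (2 * n)`!%:R <= K * n.+1%:R.
Proof.
have K1 : 1 <= K by rewrite /K lerDl invr_ge0 ltW.
have K0 : 0 < K by exact: lt_le_trans K1.
case: n => [|n].
  rewrite muln0 fact0 mulr1 mulr1 /acoef big_nil !expr0 fact0 !mulr1 div1r invr1.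
  by rewrite normr1.
elim: n => [|n IH].
  rewrite acoefS /acoef big_nil !expr0 fact0 !mulr1 divr1 mulN1r normrN muln1.
  rewrite ger0_norm ?invr_ge0 ?mulr_ge0 ?(ltW nu1)//.
  have -> : (4 * (nu + 1))^-1 * 2`!%:R = (nu + 1)^-1 / 2.
    by rewrite (_ : 2`!%:R = 2)//; field; rewrite gt_eqF.
  have : 0 <= (nu + 1)^-1 by rewrite invr_ge0 ltW.
  rewrite /K; lra.
move: n.+1 (ltn0Sn n) IH => k k0 IH.
rewrite acoefS mulnS !factS !natrM normrM normrN.
rewrite ger0_norm ?invr_ge0 ?mulr_ge0 ?(ltW (nuS_gt0 k))//.
have -> : (2 * k).+2%:R = 2 * k.+1%:R :> R by rewrite -natrM mulnS.
have -> : (2 * k).+1%:R = 2 * k%:R + 1 :> R by rewrite -natrM natr1.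
have p0 := nuS_gt0 k; have m2 : 1 <= k%:R :> R by rewrite ler1n.
move: IH p0; rewrite -[k.+2%:R]natr1 -[k.+1%:R]natr1.
move: (k%:R) m2 `|acoef k| ((2 * k)`!%:R) => m m2 a f IH p0.
have m1 : 0 < m + 1 by lra.
rewrite (_ : a / _ * _ = (a * f) * ((m + 2^-1) / (nu + (m + 1)))); last first.
  by field; rewrite !gt_eqF.
apply: le_trans (ler_wpM2r _ IH) _.
  by rewrite divr_ge0 ?(ltW p0)//; lra.
rewrite -mulrA ler_pM2l// mulrA ler_pdivrMr//.
have : 0 <= (nu + 1) * (m + 1 + 1) by rewrite mulr_ge0 ?(ltW nu1)//; lra.
have -> : (m + 1) * (m + 2^-1) = m * m + 3 / 2 * m + 2^-1 by field.
have -> : (m + 1 + 1) * (nu + (m + 1)) = m * m + 2 * m + (nu + 1) * (m + 1 + 1) by ring.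
lra.
Qed.


Lemma bcoef_le n : `|bcoef n| <= K * `|acoef n|.
Proof.
rewrite bcoefE normrM mulrC ler_wpM2r// ger0_norm ?invr_ge0 ?mulr_ge0 ?(ltW (nuS_gt0 n))//.
apply: (@le_trans _ _ (nu + 1)^-1); last by rewrite /K lerDr.
rewrite lef_pV2 ?posrE ?mulr_gt0 ?nuS_gt0// mulr_natl mulr2n.
have := nuS_gt0 n; have : 1 <= n.+1%:R :> R by rewrite ler1n.
lra.
Qed.

Lemma exp_even_sum_le x N : 0 <= x ->
  \sum_(0 <= n < N) x ^+ (2 * n) / (2 * n)`!%:R <= expR x.
Proof.
move=> x0; have c0 m : 0 <= exp_coeff x m by rewrite /exp_coeff /= divr_ge0 ?exprn_ge0.
apply: (@le_trans _ _ (series (exp_coeff x) (2 * N)%N)).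
  elim: N => [|N IH]; first by rewrite muln0 /series /= !big_nil.
  rewrite mulnS addSn add1n /series /= !big_nat_recr//=.
  by rewrite -addrA lerD// lerDl c0.
rewrite /expR; apply: nondecreasing_cvgn_le; last exact: is_cvg_series_exp_coeff.
by apply: nondecreasing_series => m _ _; exact: c0.
Qed.

(** The linear factor n + 1 of [acoef_le] is absorbed by q^(2 n), which leaves the even terms of the
    exponential series at q t. Thus A and B have exponential type at most q for every q > 1. *)
Lemma acoef_geometric (q : R) : 1 < q -> exists2 K', 0 <= K' & forall n t, 0 <= t ->
  `|acoef n| * (t ^+ 2) ^+ n <= K' * ((q * t) ^+ (2 * n) / (2 * n)`!%:R).
Proof.
move=> q1; have q0 : 0 < q - 1 by rewrite subr_gt0.
have K1 : 1 <= K by rewrite /K lerDl invr_ge0 ltW.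
have K0 : 0 <= K by exact: le_trans K1.
have nq n : n.+1%:R <= (1 + (q - 1)^-1) * q ^+ (2 * n).
  elim: n => [|n IH]; first by rewrite muln0 expr0 mulr1 lerDl invr_ge0 ltW.
  rewrite mulnS exprD -[n.+2%:R]natr1 mulrCA.
  have qn : 1 <= q ^+ (2 * n) by rewrite exprn_ege1// ltW.
  have qq : q <= q ^+ 2 by rewrite expr2 ler_peMr// ltW// (lt_trans ltr01).
  set c := 1 + (q - 1)^-1 in IH *.
  have cq : c * (q - 1) = q by rewrite /c mulrDl mulVf ?gt_eqF// mul1r subrK.
  have c0 : 0 <= c by rewrite addr_ge0// invr_ge0 ltW.
  have h1 : q * (c * q ^+ (2 * n)) <= q ^+ 2 * (c * q ^+ (2 * n)).
    by rewrite ler_wpM2r// mulr_ge0// (le_trans ler01).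
  apply: le_trans h1.
  have -> : q * (c * q ^+ (2 * n)) = c * q ^+ (2 * n) + c * (q - 1) * q ^+ (2 * n) by ring.
  rewrite lerD// cq; apply: le_trans (ler_wpM2l _ qn); rewrite ?mulr1; lra.
exists (K * (1 + (q - 1)^-1)).
  by rewrite mulr_ge0// addr_ge0// invr_ge0 ltW.
move=> n t t0; have f0 : 0 < (2 * n)`!%:R :> R by rewrite ltr0n fact_gt0.
rewrite -exprM mulrA ler_pdivlMr// mulrAC exprMn.
rewrite [leRHS](_ : _ = K * ((1 + (q - 1)^-1) * q ^+ (2 * n)) * t ^+ (2 * n)); last by ring.
rewrite ler_wpM2r ?exprn_ge0//; apply: le_trans (acoef_le n) _.
by rewrite ler_wpM2l.
Qed.

Lemma entire_acoef : entire_coef acoef.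
Proof.
move=> r r0; have [K' K'0 HK] := acoef_geometric (ltr1n R 2 : 1 < 2).
exists (K' * expR (2 * (1 + r))) => n.
have r1 : 0 <= 1 + r by rewrite addr_ge0// ltW.
apply: (@le_trans _ _ (`|acoef n| * ((1 + r) ^+ 2) ^+ n)).
  rewrite ler_wpM2l// lerXn2r ?nnegrE ?exprn_ge0 ?(ltW r0)//.
  by rewrite sqrrD expr1n mul1r; have := sqr_ge0 r; lra.
apply: le_trans (HK n _ r1) _; rewrite ler_wpM2l//.
have r2 : 0 <= 2 * (1 + r) by rewrite mulr_ge0.
apply: le_trans (exp_even_sum_le n.+1 r2).
by rewrite big_nat_recr//= lerDr sumr_ge0// => i _; rewrite divr_ge0// exprn_ge0.
Qed.

Lemma entire_bcoef : entire_coef bcoef.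
Proof.
move=> r r0; have [K' HK] := entire_acoef r0; exists (K * K') => n.
have K0 : 0 <= K by rewrite /K addr_ge0// invr_ge0 ltW.
apply: (@le_trans _ _ (K * `|acoef n| * r ^+ n)).
  by rewrite ler_wpM2r ?bcoef_le// exprn_ge0// ltW.
by rewrite -mulrA ler_wpM2l.
Qed.

Lemma bessel_growth (q : R) : 1 < q -> exists2 K', 0 <= K' & forall z,
  cabs (cps acoef (z ^+ 2)) <= K' * expR (q * cabs z) /\
  cabs (cps bcoef (z ^+ 2)) <= K' * expR (q * cabs z).
Proof.
move=> q1; have [K' K'0 HK] := acoef_geometric q1.
have K0 : 0 <= K by rewrite /K addr_ge0// invr_ge0 ltW.
have K1 : 1 <= K by rewrite /K lerDl invr_ge0 ltW.
exists (K * K'); first by rewrite mulr_ge0.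
move=> z; have z0 := cabs_ge0 z.
have qz0 : 0 <= q * cabs z by rewrite mulr_ge0// (le_trans ler01)// ltW.
have main N : \sum_(0 <= n < N) `|acoef n| * (cabs z ^+ 2) ^+ n <= K' * expR (q * cabs z).
  apply: le_trans (ler_wpM2l K'0 (exp_even_sum_le N qz0)).
  by rewrite mulr_sumr; apply: ler_sum => n _; exact: HK.
split.
  apply: (@cps_le _ acoef _ (cabs z ^+ 2)) => [||N].
  - exact: entire_acoef.
  - by rewrite cabsX.
  apply: le_trans (main N) _; rewrite -mulrA ler_peMl// mulr_ge0// expR_ge0.
apply: (@cps_le _ bcoef _ (cabs z ^+ 2)) => [||N].
- exact: entire_bcoef.
- by rewrite cabsX.
rewrite -mulrA; apply: le_trans (ler_wpM2l K0 (main N)).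
rewrite mulr_sumr; apply: ler_sum => n _.
by rewrite mulrA ler_wpM2r ?bcoef_le// !exprn_ge0.
Qed.

Lemma cvg_psum (b : nat -> R) z : entire_coef b -> (psum b N z @[N --> \oo]) --> (cps b z : C^o).
Proof. by move=> hb; apply/cvgC_cabs => e e0; exact: psum_cvg. Qed.

Lemma prod_complex (F : nat -> R) m n :
  \prod_(m <= j < n) (F j)%:C = (\prod_(m <= j < n) F j)%:C :> C.
Proof. by rewrite rmorph_prod. Qed.

Lemma A_E z : A_ nu z = cps acoef (z ^+ 2).
Proof.
rewrite /A_; set t := fun n : nat => _.
have -> : series t = (fun N => psum acoef N (z ^+ 2) : C^o).
  apply/funext => N; rewrite /series /psum /=; apply: eq_bigr => n _; rewrite /t.
  rewrite /acoef prod_complex -(rmorph_nat (real_complex R) n`!) -rmorphM exprM expr_div_n.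
  rewrite !rmorphM /= fmorphV !rmorphM /= !(rmorphXn, rmorphN1, rmorph_nat).
  rewrite expr_div_n (_ : 2 ^+ 2 = 4); last by ring.
  by rewrite !invfM; ring.
exact: (cvg_lim (@norm_hausdorff _ C^o) (cvg_psum entire_acoef)).
Qed.

Lemma B_E z : B_ nu z = z * cps bcoef (z ^+ 2).
Proof.
rewrite /B_; set t := fun n : nat => _.
have -> : series t = (fun N => z * psum bcoef N (z ^+ 2) : C^o).
  apply/funext => N; rewrite /series /psum /= mulr_sumr; apply: eq_bigr => n _; rewrite /t.
  rewrite /bcoef prod_complex -(rmorph_nat (real_complex R) n`!) -rmorphM (exprS (z / 2)) (exprM (z / 2)) (expr_div_n z 2 2).
  rewrite !rmorphM /= fmorphV !rmorphM /= !(rmorphXn, rmorphN1, rmorph_nat).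
  rewrite (expr_div_n (z ^+ 2)) (_ : 2 ^+ 2 = 4); last by ring.
  by rewrite !invfM; ring.
apply: (cvg_lim (@norm_hausdorff _ C^o)).
by apply: (@cvgMr C^o); exact: (cvg_psum entire_bcoef).
Qed.

End bessel_series.

Section derivative_sign.
Context {R : realType}.
Implicit Types (f df : R -> R) (a b x : R).

Lemma derive_cont f x d : is_derive x 1 f d -> {for x, continuous f}.
Proof. by move=> [fx _]; exact/differentiable_continuous/derivable1_diffP. Qed.

Lemma ge0_derive_le f df a b : a <= b ->
  (forall x, is_derive x 1 f (df x)) ->
  (forall x, a <= x <= b -> 0 <= df x) -> f a <= f b.
Proof.
rewrite le_eqVlt => /predU1P[->//|ab] fd df0.
have cf : {within `[a, b], continuous f}.
  by apply: continuous_subspaceT => x; exact: derive_cont.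
have [x] := MVT ab (fun x _ => fd x) cf; rewrite in_itv /= => /andP[ax xb] E.
rewrite -subr_ge0 E mulr_ge0 ?subr_ge0 ?(ltW ab)// df0//.
by rewrite !ltW.
Qed.

End derivative_sign.

(** * The differential system of A and B on the real line *)

Section bessel_real.
Context {R : realType}.
Local Notation C := R[i].
Variable nu : R.
Hypothesis nu_gtN1 : -1 < nu.
Implicit Types (x y t : R) (z : C) (n N : nat).

Definition Ar x : R := rps (acoef nu) (x ^+ 2).
(** This is B(x) / x with its value at 0 filled in. It gives the term (2 nu + 1) B(x) / x of the
    differential system a meaning at the origin. *)
Definition br x : R := rps (bcoef nu) (x ^+ 2).
Definition Br x : R := x * br x.

Let ha := entire_acoef nu_gtN1.
Let hb := entire_bcoef nu_gtN1.
Let nu1 : 0 < nu + 1. Proof. by move: nu_gtN1; lra. Qed.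

Lemma A_real x : A_ nu x%:C = (Ar x)%:C.
Proof. by rewrite A_E// -rmorphXn cps_real. Qed.

Lemma B_real x : B_ nu x%:C = (Br x)%:C.
Proof. by rewrite B_E// -rmorphXn cps_real -rmorphM. Qed.

Lemma rps_diffs_acoef y : rps (pseries_diffs (acoef nu)) y = - 2^-1 * rps (bcoef nu) y.
Proof.
rewrite {1}/rps; apply/cvg_lim => //.
have -> : (fun n => pseries_diffs (acoef nu) n * y ^+ n) =
    (fun n => - 2^-1 * (bcoef nu n * y ^+ n)).
  by apply/funext => n; rewrite pseries_diffs_acoef//; ring.
have -> : series (fun n => - 2^-1 * (bcoef nu n * y ^+ n)) =
    (fun N => - 2^-1 * series (fun n => bcoef nu n * y ^+ n) N).
  by apply/funext => N; rewrite /series /= mulr_sumr.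
by apply: cvgMr; exact: rps_cvg.
Qed.

(** Termwise this is 2 n b_n = a_n - (2 nu + 2) b_n, the relation [bcoefE]. It becomes B' = A - (2
    nu + 1) B / x, the companion of A' = - B. *)
Lemma rps_diffs_bcoef y : 2 * y * rps (pseries_diffs (bcoef nu)) y =
  rps (acoef nu) y - (2 * nu + 2) * rps (bcoef nu) y.
Proof.
have h1 : series (fun n => n%:R * bcoef nu n * y ^+ n.-1) @ \oo -->
    rps (pseries_diffs (bcoef nu)) y.
  apply: pseries_diffs_equiv; apply/cvg_ex; eexists; apply: rps_cvg.
  exact: entire_coef_diffs.
have h2 : (fun N => 2 * y * series (fun n => n%:R * bcoef nu n * y ^+ n.-1) N) @ \oo -->
    2 * y * rps (pseries_diffs (bcoef nu)) y by exact: cvgMr.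
have h3 : (fun N => series (fun n => acoef nu n * y ^+ n) N -
    (2 * nu + 2) * series (fun n => bcoef nu n * y ^+ n) N) @ \oo -->
    rps (acoef nu) y - (2 * nu + 2) * rps (bcoef nu) y.
  by apply: cvgB; [exact: rps_cvg|apply: cvgMr; exact: rps_cvg].
apply: (cvg_unique (@norm_hausdorff R R) h2).
rewrite (_ : (fun N => _) = (fun N => series (fun n => acoef nu n * y ^+ n) N -
    (2 * nu + 2) * series (fun n => bcoef nu n * y ^+ n) N))//.
apply/funext => N; rewrite /series /= !mulr_sumr -sumrB; apply: eq_bigr => n _.
have -> : acoef nu n = 2 * (nu + n.+1%:R) * bcoef nu n.
  by rewrite bcoefE// mulrC divfK// mulf_neq0// gt_eqF// nuS_gt0.
rewrite -[n.+1%:R]natr1; case: n => [|n] /=; first by ring.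
by rewrite exprS; ring.
Qed.

Lemma Br_diffs x : x * (2 * x * rps (pseries_diffs (bcoef nu)) (x ^+ 2)) =
  Ar x - (2 * nu + 2) * br x.
Proof. by rewrite -rps_diffs_bcoef; ring. Qed.

Lemma is_derive_rps_sq (c : nat -> R) x : entire_coef c ->
  is_derive x 1 (fun x => rps c (x ^+ 2)) (2 * x * rps (pseries_diffs c) (x ^+ 2)).
Proof.
move=> hc.
have d1 : is_derive x 1 (fun t : R => t ^+ 2) (2 * x).
  by apply: is_derive_eq; rewrite /GRing.scale /=; ring.
have d2 := is_derive_rps (x ^+ 2) hc.
by have := @is_derive1_comp R (rps c) (fun t => t ^+ 2) x _ _ d2 d1; rewrite mulrC.
Qed.

Lemma is_derive_Ar x : is_derive x 1 Ar (- Br x).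
Proof.
have := is_derive_rps_sq x ha; rewrite rps_diffs_acoef.
by rewrite (_ : 2 * x * _ = - Br x)// /Br /br; field.
Qed.

Lemma is_derive_br x : is_derive x 1 br (2 * x * rps (pseries_diffs (bcoef nu)) (x ^+ 2)).
Proof. exact: is_derive_rps_sq. Qed.

Lemma is_derive_Br x : is_derive x 1 Br (Ar x - (2 * nu + 1) * br x).
Proof.
have d := is_derive_br x; rewrite /Br.
apply: is_derive_eq; rewrite /GRing.scale /= Br_diffs; ring.
Qed.

Definition energy x : R := Ar x ^+ 2 + Br x ^+ 2.

(* This is [pi * K(x, x)], see [kr_diag]. *)
Definition kappa x : R := energy x - (2 * nu + 1) * (Ar x * br x).

Lemma energy_E x : cabs (E_ nu x%:C) ^+ 2 = energy x.
Proof.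
rewrite /E_ A_real B_real -?complexiE cabs_sqr ReD ImD ReN ImN ReM ImM /energy /=.
by ring.
Qed.

Lemma is_derive_energy x : is_derive x 1 energy (- 2 * (2 * nu + 1) * (Br x * br x)).
Proof.
have d1 := is_derive_Ar x; have d2 := is_derive_Br x; rewrite /energy.
by apply: is_derive_eq; rewrite /GRing.scale /=; ring.
Qed.

Lemma is_derive_kappa x : is_derive x 1 kappa (- 2 * (2 * nu + 1) * (Br x * br x) -
  (2 * nu + 1) * (Ar x * (2 * x * rps (pseries_diffs (bcoef nu)) (x ^+ 2)) - Br x * br x)).
Proof.
have d1 := is_derive_Ar x; have d2 := is_derive_br x; have d3 := is_derive_energy x.
rewrite /kappa; by apply: is_derive_eq; rewrite /GRing.scale /=; ring.
Qed.

Lemma ArN x : Ar (- x) = Ar x. Proof. by rewrite /Ar sqrrN. Qed.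
Lemma brN x : br (- x) = br x. Proof. by rewrite /br sqrrN. Qed.
Lemma BrN x : Br (- x) = - Br x. Proof. by rewrite /Br brN mulNr. Qed.
Lemma energyN x : energy (- x) = energy x. Proof. by rewrite /energy ArN BrN sqrrN. Qed.
Lemma kappaN x : kappa (- x) = kappa x. Proof. by rewrite /kappa energyN ArN brN. Qed.

Lemma rps0 (c : nat -> R) : rps c 0 = c 0%N.
Proof.
apply/cvg_lim => //; apply: cvg_near_cst; exists 1%N => // -[//|n] _.
rewrite /series /= big_nat_recl// expr0 mulr1 big1 ?addr0// => i _.
by rewrite exprS mul0r mulr0.
Qed.

Lemma kappa0 : kappa 0 = 2^-1 / (nu + 1).
Proof.
have a0 : acoef nu 0%N = 1 by rewrite /acoef big_nil !expr0 fact0 !mulr1 divr1.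
rewrite /kappa /energy /Br mul0r /Ar /br expr0n /= !rps0 bcoefE// a0 expr1n.
by field; rewrite gt_eqF.
Qed.

Lemma energy_ge0 x : 0 <= energy x.
Proof. by rewrite addr_ge0// sqr_ge0. Qed.

(* [(x ^ (2 nu + 2) kappa)' = x ^ (2 nu + 1) energy], written in the variable
   [t = ln x]. *)
Lemma is_derive_kappa_exp t :
  is_derive t 1 (fun t => expR ((2 * nu + 2) * t) * kappa (expR t))
    (expR ((2 * nu + 2) * t) * energy (expR t)).
Proof.
have d0 := is_derive1_comp (is_derive_kappa (expR t)) (is_derive_expR t).
have d1 : is_derive t 1 (fun t : R => (2 * nu + 2) * t) (2 * nu + 2).
  by apply: is_derive_eq; rewrite /GRing.scale /=; ring.
have d2 := is_derive1_comp (is_derive_expR ((2 * nu + 2) * t)) d1.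
have d3 := is_deriveM d2 d0.
apply: (is_derive_eq d3); rewrite /GRing.scale /=.
have := Br_diffs (expR t); rewrite /kappa /energy; have -> : Br (expR t) = expR t * br (expR t) by [].
move: (expR ((2 * nu + 2) * t)) (expR t) => e x.
move: (rps (pseries_diffs (bcoef nu)) (x ^+ 2)) (Ar x) (br x) => d A b H.
have {}H : A * (x * (2 * x * d)) = A * (A - (2 * nu + 2) * b) by rewrite H.
have -> : e * ((- 2 * (2 * nu + 1) * (x * b * b) -
     (2 * nu + 1) * (A * (2 * x * d) - x * b * b)) * x) =
   e * (- (2 * nu + 1) * (x * b) ^+ 2 - (2 * nu + 1) * (A * (x * (2 * x * d)))) by ring.
rewrite H; ring.
Qed.

(** By evenness take x > 0. As x^(2 nu + 2) kappa(x) is nondecreasing, a nonpositive value at x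
    would make kappa nonpositive on all of ]0, x], against continuity at 0, where kappa is 1 / (2
    (nu + 1)). *)
Lemma kappa_gt0 x : 0 < kappa x.
Proof.
have k0 : 0 < kappa 0 by rewrite kappa0 divr_gt0.
wlog x0 : x / 0 < x.
  by move=> H; case: (ltgtP x 0) => [x0|/H//|->//]; rewrite -kappaN; apply: H; rewrite oppr_gt0.
rewrite ltNge; apply/negP => kx.
have neg t : 0 < t -> t <= x -> kappa t <= 0.
  move=> t0 tx; have lt : ln t <= ln x by rewrite ler_ln ?posrE.
  have := ge0_derive_le lt is_derive_kappa_exp.
  rewrite !lnK ?posrE// => H.
  have : expR ((2 * nu + 2) * ln t) * kappa t <= 0.
    apply: (le_trans (H _)).
      by move=> s _; rewrite mulr_ge0 ?expR_ge0 ?energy_ge0.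
    by rewrite pmulr_rle0 ?expR_gt0.
  by rewrite pmulr_rle0 ?expR_gt0.
have /cvgrPdist_lt/(_ _ k0)/nbhs_ballP[d /= d0 Hd] := derive_cont (is_derive_kappa 0).
pose t := Num.min (d / 2) x.
have t0 : 0 < t by rewrite lt_min x0 divr_gt0.
have := Hd t; rewrite /ball /= sub0r normrN gtr0_norm// => /(_ _).
have td : t < d by rewrite gt_min ltr_pdivrMr// mulr_natr mulr2n ltrDr d0.
move=> /(_ td); have := neg t t0; rewrite ge_min lexx orbT => /(_ isT).
by rewrite ltr_norml => kt /andP[]; lra.
Qed.

Lemma energy_gt0 x : 0 < energy x.
Proof.
rewrite lt_def energy_ge0 andbT; apply/eqP => e0; have := kappa_gt0 x.
have A0 : Ar x = 0.
  by move/eqP: e0; rewrite /energy paddr_eq0 ?sqr_ge0// !sqrf_eq0 => /andP[/eqP].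
by rewrite /kappa e0 A0 mul0r mulr0 subr0 ltxx.
Qed.

(** The quotient energy(x) / x^2 is nonincreasing: its derivative in t = ln x is - 2 x^(-2) ((2 nu +
    2) B^2 + A^2), and nu > -1. *)
Lemma energy_le_sqr x : 1 <= x -> energy x <= energy 1 * x ^+ 2.
Proof.
move=> x1; have x0 : 0 < x by exact: lt_le_trans x1.
have d t : is_derive t 1 (fun t => - (expR (- 2 * t) * energy (expR t)))
    (2 * expR (- 2 * t) * ((2 * nu + 2) * Br (expR t) ^+ 2 + Ar (expR t) ^+ 2)).
  have d0 := is_derive1_comp (is_derive_energy (expR t)) (is_derive_expR t).
  have d1 : is_derive t 1 (fun t : R => - 2 * t) (- 2).
    by apply: is_derive_eq; rewrite /GRing.scale /=; ring.
  have d2 := is_derive1_comp (is_derive_expR (- 2 * t)) d1.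
  have d3 := is_deriveN (is_deriveM d2 d0).
  apply: (is_derive_eq d3); rewrite /GRing.scale /= /energy /Br; ring.
have := @ge0_derive_le R _ _ 0 (ln x) (ln_ge0 x1) d.
rewrite mulr0 expR0 mul1r lnK ?posrE// => H.
have {}H : - energy 1 <= - (expR (- 2 * ln x) * energy x).
  apply: H => t _; rewrite mulr_ge0 ?mulr_ge0 ?expR_ge0// addr_ge0 ?sqr_ge0//.
  by rewrite mulr_ge0 ?sqr_ge0//; move: nu1; lra.
have e2 : expR (- 2 * ln x) = (x ^+ 2)^-1.
  by rewrite mulNr expRN mulrC expRM_natr lnK.
move: H; rewrite lerN2 e2 mulrC ler_pdivrMr// exprn_gt0//.
Qed.

Let cont_energy : continuous energy.
Proof. by move=> x; exact: derive_cont (is_derive_energy x). Qed.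

Let cont_kappa : continuous kappa.
Proof. by move=> x; exact: derive_cont (is_derive_kappa x). Qed.

Lemma cont_Ar : continuous Ar.
Proof. by move=> x; exact: derive_cont (is_derive_Ar x). Qed.

Lemma cont_Br : continuous Br.
Proof. by move=> x; exact: derive_cont (is_derive_Br x). Qed.

Let ABb x : 0 < x -> `|Ar x * br x| <= energy x / x.
Proof.
move=> x0; rewrite ler_pdivlMr//.
have -> : `|Ar x * br x| * x = `|Ar x * br x * x| by rewrite [in RHS]normrM (gtr0_norm x0).
have -> : Ar x * br x * x = Ar x * Br x by rewrite /Br; ring.
rewrite /energy; move: (Ar x) (Br x) => a b; rewrite ler_norml.
have h1 : 0 <= a ^+ 2 + b ^+ 2 + 2 * (a * b) by have := sqr_ge0 (a + b); rewrite sqrrD; lra.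
have h2 : 0 <= a ^+ 2 + b ^+ 2 - 2 * (a * b) by have := sqr_ge0 (a - b); rewrite sqrrB; lra.
by have := sqr_ge0 a; have := sqr_ge0 b => ? ?; apply/andP; split; lra.
Qed.

(** On [0, 1] the bound is compactness. Beyond, |A b| <= energy / x bounds kappa by a multiple of
    the energy, which grows at most like x^2. *)
Lemma kappa_le : exists2 M, 0 < M & forall x, kappa x <= M * (1 + x ^+ 2).
Proof.
have c1 : {within `[0, 1], continuous kappa} by exact: continuous_subspaceT.
have [c _ Hc] := EVT_max ler01 c1.
pose M2 := (1 + `|2 * nu + 1|) * energy 1.
have M20 : 0 <= M2 by rewrite mulr_ge0 ?energy_ge0// addr_ge0.
exists (kappa c + M2); first by rewrite ltr_wpDr ?kappa_gt0.
move=> x; wlog x0 : x / 0 <= x.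
  by move=> H; have [/H//|/ltW x0] := leP 0 x; rewrite -(kappaN x) -(sqrrN x); apply: H; rewrite oppr_ge0.
have kc := kappa_gt0 c; have x20 := sqr_ge0 x.
have [x1|/ltW x1] := leP x 1.
  apply: (le_trans (Hc x _)); first by rewrite in_itv /= x0.
  rewrite mulrDr mulr1 -addrA lerDl addr_ge0// mulr_ge0// addr_ge0// ltW//.
have xp : 0 < x by exact: lt_le_trans x1.
have k1 : kappa x <= (1 + `|2 * nu + 1|) * energy x.
  rewrite /kappa [leRHS]mulrDl mul1r lerD2l -mulNr.
  apply: le_trans (ler_norm _) _; rewrite normrM normrN ler_wpM2l//.
  apply: le_trans (ABb xp) _; rewrite ler_pdivrMr// ler_peMr// energy_ge0//.
apply: (le_trans k1); apply: (@le_trans _ _ (M2 * x ^+ 2)).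
  rewrite /M2 -mulrA ler_wpM2l ?addr_ge0//; exact: energy_le_sqr.
have p1 := mulr_ge0 M20 x20; have p2 := mulr_ge0 (ltW kc) x20.
have -> : (kappa c + M2) * (1 + x ^+ 2) = kappa c + kappa c * x ^+ 2 + M2 + M2 * x ^+ 2 by ring.
by move: (kappa c) (kappa c * _) (M2 * _) kc p1 p2 M20 => a a' m' h1 h2 h3 h4; lra.
Qed.

Lemma kappa_ge : exists2 c, 0 < c & forall x, c * energy x <= kappa x.
Proof.
(* Past [X] the term (2 nu + 1) A b is at most half of the energy; on [0, X] a positive minimum of
   kappa against a maximum of the energy gives the constant. *)
pose X := 2 * `|2 * nu + 1| + 1.
have X0 : 0 < X by rewrite ltr_wpDl// mulr_ge0.
have c1 : {within `[0, X], continuous kappa} by exact: continuous_subspaceT.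
have c2 : {within `[0, X], continuous energy} by exact: continuous_subspaceT.
have [m _ Hm] := EVT_min (ltW X0) c1; have [M _ HM] := EVT_max (ltW X0) c2.
have M0 : 0 < energy M := energy_gt0 M.
exists (Num.min 2^-1 (kappa m / energy M)).
  by rewrite lt_min invr_gt0 ltr0n divr_gt0 ?kappa_gt0.
move=> x; wlog x0 : x / 0 <= x.
  by move=> H; have [/H//|/ltW x0] := leP 0 x; rewrite -(kappaN x) -(energyN x); apply: H; rewrite oppr_ge0.
have [xX|Xx] := leP x X.
  apply: (@le_trans _ _ (kappa m / energy M * energy x)).
    by rewrite ler_wpM2r ?energy_ge0// ge_min lexx orbT.
  apply: (@le_trans _ _ (kappa m)); last by apply: Hm; rewrite in_itv /= x0.
  rewrite mulrAC ler_pdivrMr// ler_pM2l ?kappa_gt0//.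
  by apply: HM; rewrite in_itv /= x0.
apply: (@le_trans _ _ (2^-1 * energy x)).
  by rewrite ler_wpM2r ?energy_ge0// ge_min lexx.
have xp : 0 < x by exact: lt_trans Xx.
have h : `|(2 * nu + 1) * (Ar x * br x)| <= 2^-1 * energy x.
  rewrite normrM; apply: (@le_trans _ _ (`|2 * nu + 1| * (energy x / x))).
    by rewrite ler_wpM2l// ABb.
  rewrite mulrA ler_pdivrMr// mulrAC [leLHS]mulrC mulrC ler_wpM2r ?energy_ge0//.
  by move: Xx; rewrite /X; have := normr_ge0 (2 * nu + 1); lra.
by move: h; rewrite /kappa ler_norml => /andP[]; lra.
Qed.

End bessel_real.

(** * The reproducing kernel on the real line *)

Section kernel.
Context {R : realType}.
Local Notation C := R[i].
Variables (nu : R) (K : C -> C -> C).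
Hypotheses (nu_gtN1 : -1 < nu) (K_reproducing : reproducing_kernel (E_ nu) K)
  (K_formula : forall w z : R[i],
    pi%:C * (z - w^*) * K w z = B_ nu z * A_ nu w^* - A_ nu z * B_ nu w^*).
Implicit Types (xi x y t : R) (z w : C).

Local Notation mu := (@lebesgue_measure R).
Local Notation A := (Ar nu).
Local Notation B := (Br nu).

Definition kr xi x : R := complex.Re (K xi%:C x%:C).

Lemma entire_K w : entire (K w).
Proof. by have [[]] := K_reproducing w. Qed.

Let conj_real x : (x%:C)^* = x%:C :> C.
Proof. exact: conjc_real. Qed.

Lemma kr_formula xi x : pi * (x - xi) * kr xi x = B x * A xi - A x * B xi /\
  (x != xi -> complex.Im (K xi%:C x%:C) = 0).
Proof.
have := K_formula xi%:C x%:C; rewrite conj_real !A_real// !B_real//.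
rewrite -!rmorphM -!rmorphB -!rmorphM /kr => /eqP; case: (K _ _) => a b.
rewrite eq_complex /= !mul0r subr0 addr0 => /andP[/eqP-> /eqP h]; split => // xxi.
by move/eqP: h; rewrite !mulf_eq0 gt_eqF ?pi_gt0// subr_eq0 (negbTE xxi) => /eqP.
Qed.

Let cont_K w x : {for x, continuous (fun y => complex.Re (K w y%:C))} /\
  {for x, continuous (fun y => complex.Im (K w y%:C))}.
Proof. by apply: cont_u; apply: hol_cont; exact: entire_K. Qed.

Lemma cont_kr xi : continuous (kr xi).
Proof. by move=> x; exact: (cont_K _ _).1. Qed.

(** Off the diagonal this is read off the formula for [K]; on the diagonal the formula degenerates
    to 0 = 0 and the value follows by continuity of [K xi%:C]. *)
Lemma K_real xi x : K xi%:C x%:C = (kr xi x)%:C.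
Proof.
apply: cplx_eq => //=; have [->|] := eqVneq x xi; last by case: (kr_formula xi x).
apply/eqP; rewrite -normr_eq0 eq_le normr_ge0 andbT.
apply/ler_addgt0Pr => e e0; rewrite add0r.
have /cvgrPdist_lt/(_ _ e0)/nbhs_ballP[d /= d0 Hd] := (cont_K xi%:C xi).2.
have d20 : 0 < d / 2 by rewrite divr_gt0.
have := Hd (xi + d / 2); rewrite /ball /= opprD addrA subrr sub0r normrN gtr0_norm//.
have [_ ->] := kr_formula xi (xi + d / 2).
  rewrite subr0 ltr_pdivrMr// mulr_natr mulr2n ltrDr d0 => /(_ isT).
  exact: ltW.
by rewrite gt_eqF// ltrDl.
Qed.

(** For x near xi, pi K(xi,x) is the difference quotient at xi of B(x) A(xi) - A(x) B(xi). Its limit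
    is B' A - A' B, and continuity of the kernel carries this to x = xi. *)
Lemma kr_diag xi : kr xi xi = kappa nu xi / pi.
Proof.
have pi0 := pi_gt0 R.
pose num x := B x * A xi - A x * B xi.
have dnum : is_derive xi 1 num (kappa nu xi).
  have d1 := is_derive_Ar nu_gtN1 xi; have d2 := is_derive_Br nu_gtN1 xi; rewrite /num.
  by apply: is_derive_eq; rewrite /GRing.scale /= /kappa /energy; ring.
apply/eqP; rewrite -subr_eq0 -normr_eq0 eq_le normr_ge0 andbT.
apply/ler_addgt0Pr => e e0; rewrite add0r.
have e20 : 0 < e / 2 by rewrite divr_gt0.
have [d1 d10 H1] := derive_littleo dnum (mulr_gt0 e20 pi0).
have /cvgrPdist_lt/(_ _ e20)/nbhs_ballP[d2 /= d20 H2] := @cont_kr xi xi.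
pose h := Num.min d1 d2 / 2.
have m0 : 0 < Num.min d1 d2 by rewrite lt_min d10.
have h0 : 0 < h by rewrite divr_gt0.
have hm : h < Num.min d1 d2 by rewrite ltr_pdivrMr// mulr_natr mulr2n ltrDr.
move: hm; rewrite lt_min => /andP[hd1 hd2].
have := H1 (xi + h); rewrite addrAC subrr add0r gtr0_norm// => /(_ hd1).
have := H2 (xi + h); rewrite /ball /= opprD addrA subrr sub0r normrN gtr0_norm// => /(_ hd2).
have [kf _] := kr_formula xi (xi + h).
have -> : num xi = 0 by rewrite /num; ring.
rewrite subr0 /num -kf addrAC subrr add0r.
have -> : pi * h * kr xi (xi + h) - kappa nu xi * h =
   (kr xi (xi + h) - kappa nu xi / pi) * (h * pi).
  have pN : pi != 0 :> R by rewrite gt_eqF.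
  by move: (kr _ _) (kappa _ _) (@pi R) pN => a b p pN; field.
rewrite normrM (gtr0_norm (mulr_gt0 h0 pi0)).
rewrite (_ : e / 2 * pi * h = e / 2 * (h * pi)); last by ring.
rewrite ler_pM2r ?mulr_gt0// => g1 g2.
rewrite -(subrK (kr xi (xi + h)) (kr xi xi)) -addrA.
by apply: le_trans (ler_normD _ _) _; rewrite [e]splitr lerD// ltW.
Qed.

Lemma kr_diag_gt0 xi : 0 < kr xi xi.
Proof. by rewrite kr_diag divr_gt0 ?kappa_gt0 ?pi_gt0. Qed.

Lemma kr_diag_le : exists2 M, 0 < M & forall x, kr x x <= M * (1 + x ^+ 2).
Proof.
have pi0 := pi_gt0 R; have [M M0 HM] := kappa_le nu_gtN1.
exists (M / pi) => [|x]; first by rewrite divr_gt0.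
by rewrite kr_diag mulrAC ler_pM2r ?invr_gt0.
Qed.

Lemma weightE x : weight (E_ nu) x = (energy nu x)^-1.
Proof. by rewrite /weight energy_E. Qed.

Lemma inv_kr_diag_le : exists2 M, 0 < M & forall x, (kr x x)^-1 <= M * cabs (E_ nu x%:C) ^- 2.
Proof.
have pi0 := pi_gt0 R; have [c c0 Hc] := kappa_ge nu_gtN1.
exists (pi / c) => [|x]; first by rewrite divr_gt0.
rewrite energy_E// kr_diag invf_div -mulrA ler_pM2l// -invfM.
by rewrite lef_pV2 ?posrE ?mulr_gt0 ?kappa_gt0 ?energy_gt0.
Qed.

Lemma cont_weight : continuous (weight (E_ nu)).
Proof.
move=> x; rewrite (_ : weight (E_ nu) = (fun x => (energy nu x)^-1)).
  apply: cvgV; first by rewrite gt_eqF// energy_gt0.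
  exact: derive_cont (is_derive_energy nu_gtN1 x).
by apply/funext => t; rewrite weightE.
Qed.

Lemma weight_ge0 x : 0 <= weight (E_ nu) x.
Proof. by rewrite weightE invr_ge0 energy_ge0. Qed.

Let measurable_cont (g : R -> R) : continuous g -> measurable_fun [set: R] g.
Proof. exact: continuous_measurable_fun. Qed.

Lemma kr_sqr_integrable xi :
  mu.-integrable [set: R] (fun t => (kr xi t ^+ 2 * weight (E_ nu) t)%:E).
Proof.
have [[_ fin _ _] _] := K_reproducing xi%:C.
apply/integrableP; split.
  apply/measurable_EFinP; apply: measurable_funM.
    by apply: measurable_funX; apply: measurable_cont; exact: cont_kr.
  exact: (measurable_cont cont_weight).
apply: le_lt_trans fin; rewrite le_eqVlt; apply/orP; left; apply/eqP.
apply: eq_integral => t _.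
rewrite gee0_abs; last by rewrite lee_fin mulr_ge0 ?weight_ge0// sqr_ge0.
by rewrite K_real cabs_real real_normK ?num_real.
Qed.

Lemma kr_mul_integrable xi x :
  mu.-integrable [set: R] (fun t => (kr xi t * kr x t * weight (E_ nu) t)%:E).
Proof.
have iD := integrableD measurableT (kr_sqr_integrable xi) (kr_sqr_integrable x).
apply: le_integrable iD => //.
  apply/measurable_EFinP; apply: measurable_funM; last exact: (measurable_cont cont_weight).
  by apply: measurable_funM; apply: measurable_cont; exact: cont_kr.
move=> t _; rewrite -EFinD !abse_EFin lee_fin -mulrDl !normrM.
rewrite (ger0_norm (weight_ge0 t)) ler_wpM2r ?weight_ge0//.
rewrite [leRHS]ger0_norm ?addr_ge0 ?sqr_ge0// -normrM ler_norml.
move: (kr xi t) (kr x t) => a b.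
have h1 := sqr_ge0 (a + b); have h2 := sqr_ge0 (a - b).
have h3 := sqr_ge0 a; have h4 := sqr_ge0 b.
by move: h1 h2; rewrite sqrrB sqrrD => h1 h2; apply/andP; split; lra.
Qed.

Lemma kr_reproducing xi x :
  kr xi x = (\int[mu]_t (kr xi t * kr x t * weight (E_ nu) t))%R.
Proof.
have [_ /(_ (K xi%:C)) H] := K_reproducing x%:C.
have [dB _] := K_reproducing xi%:C.
rewrite /kr H//=; apply: eq_Rintegral => t _.
by rewrite !K_real /= oppr0 mulr0 subr0.
Qed.

Lemma kr_sqr_integral xi :
  (\int[mu]_t (kr xi t ^+ 2 * weight (E_ nu) t)%:E)%E = (kr xi xi)%:E.
Proof.
rewrite kr_reproducing /Rintegral fineK.
  by apply: eq_integral => t _; rewrite expr2.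
exact: integrable_fin_num (kr_mul_integrable xi xi).
Qed.

Lemma kr_cauchy_schwarz xi x : kr xi x ^+ 2 <= kr xi xi * kr x x.
Proof.
(* The minimiser of the squared norm of K(xi, .) - l K(x, .) in H(E). *)
pose l := kr xi x / kr x x.
have kx0 := kr_diag_gt0 x.
have i1 := kr_mul_integrable xi xi; have i2 := kr_mul_integrable xi x.
have i3 := kr_mul_integrable x x.
have i2' : mu.-integrable [set: R] (EFin \o (fun t => 2 * l * (kr xi t * kr x t * weight (E_ nu) t))).
  exact: (integrableZl measurableT (2 * l) i2).
have i3' : mu.-integrable [set: R] (EFin \o (fun t => l ^+ 2 * (kr x t * kr x t * weight (E_ nu) t))).
  exact: (integrableZl measurableT (l ^+ 2) i3).
have i12 : mu.-integrable [set: R] (EFin \o (fun t =>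
    kr xi t * kr xi t * weight (E_ nu) t - 2 * l * (kr xi t * kr x t * weight (E_ nu) t))).
  exact: (integrableB measurableT i1 i2').
have : 0 <= (\int[mu]_t ((kr xi t * kr xi t * weight (E_ nu) t -
    2 * l * (kr xi t * kr x t * weight (E_ nu) t)) +
    l ^+ 2 * (kr x t * kr x t * weight (E_ nu) t)))%R.
  apply: Rintegral_ge0 => t _.
  rewrite [leRHS](_ : _ = (kr xi t - l * kr x t) ^+ 2 * weight (E_ nu) t); last by ring.
  by rewrite mulr_ge0 ?sqr_ge0 ?weight_ge0.
rewrite RintegralD// RintegralB// !RintegralZl// -!kr_reproducing.
have -> : kr xi xi - 2 * l * kr xi x + l ^+ 2 * kr x x = kr xi xi - kr xi x ^+ 2 / kr x x.
  by rewrite /l; field; rewrite gt_eqF.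
by rewrite subr_ge0 ler_pdivrMr.
Qed.

Lemma k_real xi x : k_ K xi x%:C = (kr xi x / kr xi xi)%:C.
Proof. by rewrite /k_ !K_real -fmorphV -rmorphM. Qed.

Lemma ksqE xi x : ksq K xi x = (kr xi x / kr xi xi) ^+ 2.
Proof. by rewrite /ksq k_real -rmorphXn. Qed.

Lemma ksq_ge0 xi x : 0 <= ksq K xi x.
Proof. by rewrite ksqE sqr_ge0. Qed.

Lemma KdiagE xi : Kdiag K xi = kr xi xi.
Proof. by []. Qed.

Lemma ksq_le xi x : ksq K xi x <= kr x x * (kr xi xi)^-1.
Proof.
have k0 := kr_diag_gt0 xi.
rewrite ksqE expr_div_n ler_pdivrMr ?exprn_gt0//.
rewrite expr2 mulrA divfK ?gt_eqF// [leRHS]mulrC; exact: kr_cauchy_schwarz.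
Qed.

Lemma entire_k_sqr xi : entire (fun z => k_ K xi z ^+ 2).
Proof.
move=> z _; apply: holX; apply: holM; last exact: hol_cst.
exact: entire_K.
Qed.

(** The formula gives K(xi,z) from A(z) and B(z), of type at most q, after division by z - xi, whose
    modulus is at least 1 for |z| > |xi| + 1. Here q is the midpoint of 1 and tau / 2, so that tau -
    2 q > 0 remains for the polynomial factor. *)
Lemma k_sqr_type xi : exponential_type_le 2 (fun z => k_ K xi z ^+ 2).
Proof.
apply/exponential_typeP => tau tau2; pose q := (1 + tau / 2) / 2.
have q1 : 1 < q by rewrite /q; lra.
have [M M0 HM] := bessel_growth nu_gtN1 q1.
have pi0 := pi_gt0 R; have k0 := kr_diag_gt0 xi.
pose D := M * (`|A xi| + `|B xi|) / (pi * kr xi xi).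
have D0 : 0 <= D.
  apply: divr_ge0; first by apply: mulr_ge0 => //; exact: addr_ge0.
  by apply: mulr_ge0; exact: ltW.
have c0 : 0 < tau - 2 * q by rewrite /q; lra.
have [T HT] := @poly_le_expR R (D ^+ 2) 1 _ (sqr_ge0 D) ler01 c0.
exists (Num.max T (`|xi| + 1)) => z; rewrite gt_max => /andP[Tz xz].
have zx1 : 1 <= cabs (z - xi%:C).
  have := cabs_dist z xi%:C; rewrite cabs_real => /(le_trans (ler_norm _)); lra.
have z0 := cabs_ge0 z.
have [HA HB] := HM z.
have Kz : cabs (K xi%:C z) <= M * expR (q * cabs z) * (1 + cabs z) * (`|A xi| + `|B xi|) / pi.
  have := congr1 cabs (K_formula xi%:C z).
  rewrite conj_real !cabsM cabs_real (gtr0_norm pi0) A_real// B_real// A_E// B_E// => E.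
  rewrite ler_pdivlMr//.
  apply: (@le_trans _ _ (pi * cabs (z - xi%:C) * cabs (K xi%:C z))).
    by rewrite mulrC -mulrA ler_pM2l// ler_peMl// cabs_ge0.
  rewrite E; apply: le_trans (cabsB _ _) _; rewrite !cabsM !cabs_real.
  set a := cabs (cps (acoef _) _) in HA *; set b := cabs (cps (bcoef _) _) in HB *.
  set m := M * _ in HA HB *.
  have m0 : 0 <= m by rewrite mulr_ge0 ?expR_ge0.
  have h1 : cabs z * b * `|A xi| <= cabs z * m * `|A xi| by rewrite ler_wpM2r// ler_wpM2l.
  have h2 : a * `|B xi| <= m * `|B xi| by rewrite ler_wpM2r.
  have h3 : 0 <= m * `|A xi| by rewrite mulr_ge0.
  have h4 : 0 <= m * cabs z * `|B xi| by rewrite !mulr_ge0.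
  have -> : m * (1 + cabs z) * (`|A xi| + `|B xi|) =
    cabs z * m * `|A xi| + m * `|B xi| + m * `|A xi| + m * cabs z * `|B xi| by ring.
  lra.
have kz : cabs (k_ K xi z) <= D * (1 + cabs z) * expR (q * cabs z).
  rewrite /k_ cabs_div K_real cabs_real (gtr0_norm k0) ler_pdivrMr//.
  apply: (le_trans Kz); rewrite le_eqVlt; apply/orP; left; apply/eqP.
  rewrite /D; move: (kr xi xi) (@pi R) k0 pi0 => a p a0 p0.
  by field; rewrite !gt_eqF.
rewrite cabsX; apply: (@le_trans _ _ ((D * (1 + cabs z) * expR (q * cabs z)) ^+ 2)).
  rewrite lerXn2r ?nnegrE ?cabs_ge0//.
  by apply: mulr_ge0; [apply: mulr_ge0 => //; exact: addr_ge0|exact: expR_ge0].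
rewrite exprMn -expRM_natl exprMn.
have := HT _ (ltW Tz); rewrite mul1r => /(ler_wpM2r (expR_ge0 (2%:R * (q * cabs z)))).
move=> /le_trans; apply; rewrite -expRD ler_expR.
by rewrite le_eqVlt; apply/orP; left; apply/eqP; ring.
Qed.

End kernel.

(** * Integrals of families of power series *)

Section coefficient_families.
Context {R : realType} d (T : measurableType d).
Implicit Types (mu : {measure set T -> \bar R}) (b : T -> nat -> R) (n : nat) (x r : R).

Lemma dominated_cvg_Rintegral mu (f_ : nat -> T -> R) (f g : T -> R) :
  (forall n, measurable_fun setT (f_ n)) -> mu.-integrable setT (EFin \o g) ->
  (forall t, f_ n t @[n --> \oo] --> f t) ->
  (forall n t, `|f_ n t| <= g t) ->
  mu.-integrable setT (EFin \o f) /\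
  (\int[mu]_t f_ n t)%R @[n --> \oo] --> (\int[mu]_t f t)%R.
Proof.
move=> mf ig fcvg fg.
have mf' n : measurable_fun setT (EFin \o f_ n) by exact/measurable_EFinP.
have fcvg' t : setT t -> (EFin \o f_ n) t @[n --> \oo] --> (EFin \o f) t.
  by move=> _; apply: cvg_EFin; [exact: nearW|exact: fcvg].
have fg' n t : setT t -> (`|(EFin \o f_ n) t| <= (EFin \o g) t)%E.
  by move=> _; rewrite /= lee_fin.
have fi : mu.-integrable setT (EFin \o f).
  apply: (le_integrable measurableT _ _ ig).
    by apply/measurable_EFinP; exact: (measurable_fun_cvg mf (fun t _ => fcvg t)).
  move=> t _; rewrite /= lee_fin; apply: le_trans (ler_norm _).
  have ft : `|f_ n t| @[n --> \oo] --> `|f t| by apply: cvg_norm; exact: fcvg.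
  rewrite -(cvg_lim (@norm_hausdorff R R) ft).
  by apply: limr_le; [apply/cvg_ex; eexists; exact: ft|exact: nearW].
split => //; rewrite /Rintegral; apply: fine_cvg.
rewrite fineK; last exact: integrable_fin_num fi.
by apply: (@dominated_cvg _ _ _ mu _ measurableT (fun n => EFin \o f_ n) _ (EFin \o g)).
Qed.

Lemma entire_coef_shift (c : nat -> R) : entire_coef c -> entire_coef (fun n => c n.+1).
Proof.
move=> hc r r0; have [K HK] := hc r r0; exists (K / r) => n.
by rewrite ler_pdivlMr// -mulrA -exprSr.
Qed.

Lemma rps_shift (c : nat -> R) x : entire_coef c ->
  rps c x = c 0%N + x * rps (fun n => c n.+1) x.
Proof.
move=> hc; apply/cvg_lim => //; rewrite -cvg_shiftS /=.
have -> : (fun N => series (fun n => c n * x ^+ n) N.+1) =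
    (fun N => c 0%N + x * series (fun n => c n.+1 * x ^+ n) N).
  apply/funext => N; rewrite /series /= big_nat_recl//= expr0 mulr1 mulr_sumr.
  by congr (_ + _); apply: eq_bigr => n _; rewrite (exprS x n); ring.
apply: cvgD; first exact: cvg_cst.
by apply: cvgMr; apply: rps_cvg; exact: entire_coef_shift.
Qed.

Lemma rps_at0 (c : nat -> R) : entire_coef c -> rps c m.+1%:R^-1 @[m --> \oo] --> c 0%N.
Proof.
move=> hc; have -> : c 0%N = rps c 0 by rewrite rps_shift// mul0r addr0.
have cr : {for 0, continuous (rps c)} := derive_cont (is_derive_rps 0 hc).
have h : m.+1%:R^-1 @[m --> \oo] --> (0 : R) by exact: cvg_harmonic.
exact: (cvg_comp _ _ h cr).
Qed.

(** The constant coefficient is the limit of the sums at x = 1 / (m + 1). Subtracting it and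
    dividing by x shifts the series by one index, which allows induction; hence the hypothesis
    concerns x different from 0. *)
Lemma measurable_coef b : (forall t, entire_coef (b t)) ->
  (forall x, x != 0 -> measurable_fun setT (fun t => rps (b t) x)) ->
  forall n, measurable_fun setT (fun t => b t n).
Proof.
move=> hb mb n; elim: n b hb mb => [|n IH] b hb mb.
  apply: (@measurable_fun_cvg _ _ _ setT (fun m t => rps (b t) m.+1%:R^-1)) => [m|t _].
    by apply: mb; rewrite invr_neq0.
  exact: rps_at0.
have m0 : measurable_fun setT (fun t => b t 0%N).
  apply: (@measurable_fun_cvg _ _ _ setT (fun m t => rps (b t) m.+1%:R^-1)) => [m|t _].
    by apply: mb; rewrite invr_neq0.
  exact: rps_at0.
apply: (IH (fun t n => b t n.+1)) => [t|x x0]; first exact: entire_coef_shift.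
have -> : (fun t => rps (fun n => b t n.+1) x) = (fun t => x^-1 * (rps (b t) x - b t 0%N)).
  by apply/funext => t; rewrite (rps_shift x (hb t)) addrAC subrr add0r mulKf.
by apply: measurable_funM => //; apply: measurable_funB => //; exact: mb.
Qed.

Section exchange.
Variables (mu : {measure set T -> \bar R}) (b : T -> nat -> R) (a : T -> R) (w : R -> R).
Hypotheses (mb : forall n, measurable_fun setT (fun t => b t n))
  (ia : mu.-integrable setT (EFin \o a)) (a0 : forall t, 0 <= a t)
  (w0 : forall r, 0 <= w r)
  (ba : forall t n r, 0 < r -> `|b t n| <= a t * (w r / r ^+ n)).

Lemma integrable_coef n : mu.-integrable setT (EFin \o (b ^~ n)).
Proof.
have i1 : mu.-integrable setT (EFin \o (fun t => w 1 * a t)).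
  exact: (integrableZl measurableT (w 1) ia).
apply: (le_integrable measurableT _ _ i1); first exact/measurable_EFinP.
move=> t _; rewrite /= lee_fin; apply: le_trans (ba t n ltr01) _.
by rewrite expr1n divr1 mulrC ler_norm.
Qed.

(** The dependence on n and r is a factor of the bound independent of t, so it survives integration
    unchanged. *)
Lemma integral_coef_le n r : 0 < r ->
  `|(\int[mu]_t b t n)%R| <= (\int[mu]_t a t)%R * (w r / r ^+ n).
Proof.
move=> r0; apply: le_trans (le_normr_Rintegral measurableT (integrable_coef n)) _.
rewrite -RintegralZr//; apply: le_Rintegral => //.
- exact: (integrable_norm (integrable_coef n)).
- have -> : EFin \o (fun t => a t * (w r / r ^+ n)) = EFin \o (fun t => (w r / r ^+ n) * a t).
    by apply/funext => t /=; rewrite mulrC.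
  exact: (integrableZl measurableT (w r / r ^+ n) ia).
- by move=> t _; exact: ba.
Qed.

Lemma integral_rps x : mu.-integrable setT (EFin \o (fun t => rps (b t) x)) /\
  series (fun n => (\int[mu]_t b t n)%R * x ^+ n) @ \oo --> (\int[mu]_t rps (b t) x)%R.
Proof.
have hb t : entire_coef (b t).
  move=> r r0; exists (a t * w r) => n.
  by rewrite -ler_pdivlMr ?exprn_gt0// -mulrA; exact: ba.
(* At this radius |x| / r <= 1 / 2, so every partial sum is dominated by 2 w(r) a(t). *)
pose r := 2 * (`|x| + 1).
have x1 : 0 < `|x| + 1 by rewrite ltr_wpDl.
have r0 : 0 < r by rewrite mulr_gt0.
have ig : mu.-integrable setT (EFin \o (fun t => 2 * w r * a t)).
  exact: (integrableZl measurableT (2 * w r) ia).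
have [|t|N t|i1 i2] := @dominated_cvg_Rintegral mu
  (fun N t => series (fun n => b t n * x ^+ n) N) (fun t => rps (b t) x) _ _ ig.
- move=> N; rewrite /series /=; apply: measurable_sum => n.
  by apply: measurable_funM.
- exact: rps_cvg.
- rewrite /series /=; apply: le_trans (ler_norm_sum _ _ _) _.
  apply: (@le_trans _ _ (\sum_(0 <= n < N) a t * w r * 2^-1 ^+ n)).
    apply: ler_sum => n _; rewrite normrM normrX.
    apply: le_trans (ler_wpM2r _ (ba t n r0)) _; first by rewrite exprn_ge0.
    rewrite [leLHS](_ : _ = a t * w r * (`|x| ^+ n / r ^+ n)); last by ring.
    rewrite ler_wpM2l ?mulr_ge0// -expr_div_n.
    rewrite lerXn2r ?nnegrE ?divr_ge0 ?(ltW r0)// ?invr_ge0//.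
    rewrite ler_pdivrMr// /r mulrA mulVf// mul1r lerDl//.
  rewrite -mulr_sumr [leRHS](_ : _ = a t * w r * 2); last by ring.
  rewrite ler_wpM2l ?mulr_ge0//; apply: le_trans (geometric_sum_le _ _ _) _.
  - by rewrite invr_ge0.
  - by rewrite invf_lt1// ltr1n.
  - by rewrite (_ : 1 - 2^-1 = 2^-1) ?invrK//; field.
split => //.
rewrite (_ : series _ = (fun N => \int[mu]_t series (fun n => b t n * x ^+ n) N)%R)//.
apply/funext => N; rewrite /series /=; elim: N => [|N IH].
  rewrite big_nil; under eq_Rintegral do rewrite big_nil.
  by rewrite Rintegral_cst// mul0r.
rewrite big_nat_recr//= IH.
under [RHS]eq_Rintegral do rewrite big_nat_recr//=.
have ic n : mu.-integrable setT (EFin \o (fun t => b t n * x ^+ n)).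
  have := integrableZl measurableT (x ^+ n) (integrable_coef n).
  by apply: eq_integrable => // t _; rewrite /= mulrC.
rewrite RintegralD//; last first.
  rewrite (_ : EFin \o _ = (fun t => \sum_(0 <= n < N) (b t n * x ^+ n)%:E)%E).
    by apply: integrable_sum => // n _; exact: ic.
  by apply/funext => t; rewrite /= sumEFin.
by rewrite RintegralZr//; exact: integrable_coef.
Qed.

End exchange.

End coefficient_families.

(** * Integration against df *)

Section signed_integral.
Context d (T : measurableType d) (R : realType).
Variables (V P N : {measure set T -> \bar R}).
Hypothesis VE : forall A, measurable A -> V A = (P A + N A)%E.
Implicit Types (g h : T -> R).

Lemma ge0_integral_V (h : T -> \bar R) : measurable_fun setT h -> (forall x, 0 <= h x)%E ->
  (\int[V]_x h x = \int[P]_x h x + \int[N]_x h x)%E.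
Proof.
move=> mh h0; rewrite -ge0_integral_measure_add//.
by apply: eq_measure_integral => A mA _; rewrite [RHS]measure_addE; exact: VE.
Qed.

Lemma integrable_P (h : T -> \bar R) : V.-integrable setT h -> P.-integrable setT h.
Proof.
move=> /integrableP[mh hfin]; apply/integrableP; split => //.
apply: le_lt_trans hfin; rewrite ge0_integral_V//; last exact: measurableT_comp.
by rewrite leeDl// integral_ge0.
Qed.

Lemma integrable_N (h : T -> \bar R) : V.-integrable setT h -> N.-integrable setT h.
Proof.
move=> /integrableP[mh hfin]; apply/integrableP; split => //.
apply: le_lt_trans hfin; rewrite ge0_integral_V//; last exact: measurableT_comp.
by rewrite leeDr// integral_ge0.
Qed.

Definition int_signed h : R := (\int[P]_x h x)%R - (\int[N]_x h x)%R.

Lemma int_signedD g h : V.-integrable setT (EFin \o g) -> V.-integrable setT (EFin \o h) ->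
  int_signed (fun x => g x + h x) = int_signed g + int_signed h.
Proof.
move=> ig ih; rewrite /int_signed !RintegralD//; try exact: integrable_P;
  try exact: integrable_N; ring.
Qed.

Lemma int_signed_le h : V.-integrable setT (EFin \o h) ->
  `|int_signed h| <= (\int[V]_x `|h x|)%R.
Proof.
move=> ih; have ip := integrable_P ih; have im := integrable_N ih.
rewrite /int_signed; apply: le_trans (ler_normB _ _) _.
have -> : (\int[V]_x `|h x|)%R = (\int[P]_x `|h x|)%R + (\int[N]_x `|h x|)%R.
  rewrite /Rintegral ge0_integral_V//; last first.
    by apply/measurable_EFinP; apply: measurableT_comp => //; move/integrableP : ih => [/measurable_EFinP].
  by rewrite fineD//; apply: integrable_fin_num => //; exact: integrable_norm.
by rewrite lerD//; exact: le_normr_Rintegral.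
Qed.

End signed_integral.

Section symmetric_limit.
Context {R : realType}.
Implicit Types (h : R -> R).

(** Dominated convergence concerns sequences, so the limit at +oo is tested along arbitrary
    sequences tending to +oo. *)
Lemma cvg_Rintegral_itv (mu : {measure set (measurableTypeR R) -> \bar R}) h :
  mu.-integrable setT (EFin \o h) ->
  (\int[mu]_(x in `[- r, r]) h x)%R @[r --> +oo] --> (\int[mu]_x h x)%R.
Proof.
move=> ih; apply/cvg_pinftyP => u uoo.
have mh : measurable_fun setT h by move/integrableP : ih => [/measurable_EFinP].
have -> : (fun n => \int[mu]_(x in `[- u n, u n]) h x)%R =
    (fun n => \int[mu]_x (h \_ `[- u n, u n]) x)%R.
  by apply/funext => n; rewrite Rintegral_mkcond.
have [] // := @dominated_cvg_Rintegral R _ _ mu (fun n => h \_ `[- u n, u n]) h (fun x => `|h x|).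
- by move=> n; apply/(measurable_restrictT h) => //; exact: measurable_funS mh.
- exact: integrable_norm.
- move=> t; apply: cvg_near_cst; have /cvgryPge/(_ `|t|) := uoo.
  apply: filterS => n un; rewrite patchE mem_set//= in_itv /=.
  by rewrite -ler_norml.
- by move=> n t; rewrite patchE; case: ifPn => // _; rewrite normr0.
Qed.

End symmetric_limit.

Section stieltjes.
Context {R : realType}.
Variables (f : R -> R) (fbv : locally_bounded_variation f) (frc : right_continuous f).
Implicit Types (g h : R -> R) (x : R).

Local Notation V := (dV fbv frc).
Local Notation P := (dpos fbv frc).
Local Notation N := (dneg fbv frc).

(** Both sides have mass V_f(b) - V_f(a) on ]a, b], and a Stieltjes measure is determined by these
    values. *)
Lemma dV_add (A : set (measurableTypeR R)) : measurable A -> V A = (P A + N A)%E.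
Proof.
move=> mA; have := @lebesgue_stieltjes_measure_unique R (V_cumulative fbv frc) (measure_add P N) _ A mA.
rewrite -[(P A + N A)%E](measure_addE P N); apply=> X [[a b] _ <-] /=; have [ab|ba] := leP a b.
  transitivity ((pos_var f b - pos_var f a)%:E + (neg_var f b - neg_var f a)%:E)%E.
    by rewrite stieltjes_itv//= -EFinD; congr EFin; rewrite /pos_var /neg_var; lra.
  by rewrite [RHS]measure_addE; congr (_ + _)%E; apply/esym; exact: stieltjes_itv.
by rewrite set_itv_ge ?bnd_simp -?leNgt ?ltW// !measure0.
Qed.

(** Absolute integrability turns the symmetric improper integral into a difference of two integrals
    over the whole line. *)
Lemma df_integralE h : V.-integrable setT (EFin \o h) ->
  df_integral fbv frc h = int_signed P N h.
Proof.
move=> ih; apply: (cvg_lim (@norm_hausdorff R R)).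
have h1 := cvg_Rintegral_itv (integrable_P dV_add ih).
have h2 := cvg_Rintegral_itv (integrable_N dV_add ih).
exact: (cvgB h1 h2).
Qed.

(** Tonelli on the diagonal of the plane: the integral of V {x} over x equals the dV-integral of the
    Lebesgue measure of points, which is 0. *)
Lemma ae_dV_set1 : {ae (@lebesgue_measure R), forall x, V [set x] = 0%E}.
Proof.
pose D : set (R * R) := [set p | p.1 = p.2].
have mD : measurable D.
  have -> : D = (fun p : R * R => p.1 - p.2) @^-1` [set 0].
    by apply/seteqP; split => -[x y] /=; [rewrite /D /= => ->; rewrite subrr|move=> /subr0_eq].
  rewrite -[X in measurable X]setTI.
  have : measurable_fun setT (fun p : R * R => p.1 - p.2) by exact: measurable_funB.
  by apply => //; exact: measurable_set1.
pose W := lebesgue_stieltjes_measure (V_cumulative fbv frc).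
have sD x : xsection D x = [set x] /\ ysection D x = [set x].
  split; apply/seteqP; split => y; rewrite /= ?/xsection ?/ysection /= ?inE /D //=.
have mi : measurable_fun setT (fun x => W (xsection D x)) by exact: measurable_fun_xsection.
have := indic_fubini_tonelli (@lebesgue_measure R) W mD.
rewrite indic_fubini_tonelli_FE// indic_fubini_tonelli_GE//.
rewrite [RHS]integral0_eq => [|y _ /=]; last by rewrite (sD y).2 lebesgue_measure_set1.
move=> h; have : (\int[@lebesgue_measure R]_x `|W (xsection D x)| = 0)%E.
  by rewrite -[RHS]h; apply: eq_integral => x _; rewrite gee0_abs.
move=> /(ae_eq_integral_abs (@lebesgue_measure R) measurableT mi).1.
by apply: filterS => x /(_ I) /=; rewrite (sD x).1.
Qed.

End stieltjes.

(** * Real functions with Taylor coefficients of exponential type *)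

Section expandable.
Context {R : realType}.
Local Notation C := R[i].
Variable delta : R.
Hypothesis delta0 : 0 <= delta.
Implicit Types (g h : R -> R) (x r : R).

(** Restrictions to the real line of entire functions whose coefficients obey Cauchy's estimates for
    the growth A (1 + r)^2 e^(delta r). Unlike the bare type condition, this form passes directly
    through sums and integrals. *)
Definition expandable g := exists c A, [/\ 0 <= A,
  forall n r, 0 < r -> `|c n| <= A * ((1 + r) ^+ 2 * expR (delta * r) / r ^+ n) &
  forall x, series (fun n => c n * x ^+ n) @ \oo --> g x].

Let w r : R := (1 + r) ^+ 2 * expR (delta * r).

Let w0 r : 0 <= w r.
Proof. by rewrite mulr_ge0 ?sqr_ge0 ?expR_ge0. Qed.

Lemma expandable_entire g : expandable g -> exists F : C -> C,
  [/\ entire F, exponential_type_le delta F & forall x, F x%:C = (g x)%:C].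
Proof.
move=> [c [A [A0 cA cg]]]; exists (cps c).
have [|hc ct] := @exponential_type_cps R c A delta A0 delta0.
  by move=> n r r0; have := cA n r r0; rewrite !mulrA.
split; [exact: entire_cps|exact: ct|move=> x].
by rewrite cps_real//; congr (_%:C); apply: (cvg_lim (@norm_hausdorff R R)); exact: cg.
Qed.

Lemma expandable_cont g : expandable g -> continuous g.
Proof.
move=> [c [A [A0 cA cg]]] x.
have [|hc _] := @exponential_type_cps R c A delta A0 delta0.
  by move=> n r r0; have := cA n r r0; rewrite !mulrA.
have -> : g = rps c.
  by apply/funext => y; apply/esym/(cvg_lim (@norm_hausdorff R R)); exact: cg.
exact: derive_cont (is_derive_rps x hc).
Qed.

Lemma expandableD g h : expandable g -> expandable h -> expandable (fun x => g x + h x).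
Proof.
move=> [c [A [A0 cA cg]]] [e [B [B0 eB eh]]]; exists (fun n => c n + e n), (A + B).
split; first exact: addr_ge0.
  move=> n r r0; rewrite mulrDl; apply: le_trans (ler_normD _ _) _.
  by rewrite lerD ?cA ?eB.
move=> x; rewrite (_ : series _ = series (fun n => c n * x ^+ n) + series (fun n => e n * x ^+ n)).
  by apply: cvgD; [exact: cg|exact: eh].
apply/funext => n; rewrite /series /= fctE -big_split /=.
by apply: eq_bigr => i _; rewrite mulrDl.
Qed.

Lemma expandableZ k g : expandable g -> expandable (fun x => k * g x).
Proof.
move=> [c [A [A0 cA cg]]]; exists (fun n => k * c n), (`|k| * A).
split; first by rewrite mulr_ge0.
  by move=> n r r0; rewrite normrM -[leRHS]mulrA ler_wpM2l// cA.
move=> x; rewrite (_ : series _ = (fun n => k * series (fun n => c n * x ^+ n) n)).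
  by apply: cvgMr; exact: cg.
apply/funext => n; rewrite /series /= mulr_sumr; by apply: eq_bigr => i _; rewrite mulrA.
Qed.

Lemma expandable_cst k : expandable (fun=> k).
Proof.
exists (fun n => if n is 0%N then k else 0), `|k|; split => //.
  move=> [|n] r r0; last by rewrite normr0 mulr_ge0// divr_ge0 ?w0// exprn_ge0// ltW.
  rewrite expr0 divr1 ler_peMr//.
  have h1 : 1 <= (1 + r) ^+ 2 by rewrite exprn_ege1// lerDl ltW.
  have h2 : 1 <= expR (delta * r) by rewrite -expR0 ler_expR mulr_ge0// ltW.
  by rewrite -[leLHS]mulr1 ler_pM.
move=> x; rewrite -cvg_shiftS; apply: cvg_near_cst; apply: nearW => n.
rewrite /series /= big_nat_recl//= expr0 mulr1 big1 ?addr0// => i _.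
by rewrite mul0r.
Qed.

Lemma expandable_integral d (T : measurableType d) (mu : {measure set T -> \bar R})
    (G : T -> C -> C) (a : T -> R) :
  mu.-integrable setT (EFin \o a) -> (forall t, 0 <= a t) ->
  (forall t, entire (G t)) -> (forall t, real_on_reals (G t)) ->
  (forall t, exponential_type_le delta (G t)) ->
  (forall t x, `|complex.Re (G t x%:C)| <= a t * (1 + x ^+ 2)) ->
  (forall x, measurable_fun setT (fun t => complex.Re (G t x%:C))) ->
  (forall x, mu.-integrable setT (EFin \o (fun t => complex.Re (G t x%:C)))) /\
  expandable (fun x => (\int[mu]_t complex.Re (G t x%:C))%R).
Proof.
move=> ia a0 eG rG tG Ga mG.
have bE t : exists b : nat -> R,
    (forall n r, 0 < r -> `|b n| <= a t * (w r / r ^+ n)) /\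
    (forall x, series (fun n => b n * x ^+ n) @ \oo --> complex.Re (G t x%:C)).
  have [x|b [b1 b2]] := real_power_series (eG t) (rG t) (a0 t) delta0 (tG t).
    rewrite (_ : G t x%:C = (complex.Re (G t x%:C))%:C) ?cabs_real//.
    by apply: cplx_eq => //=; exact: rG.
  exists b; split => // n r r0; apply: le_trans (b1 n r r0) _.
  by rewrite /w !mulrA.
(* The coefficient sequences are chosen independently for each t; their measurability in t is
   recovered afterwards from the sums at real points. *)
have [b bP] := choice bE.
have ba t n r : 0 < r -> `|b t n| <= a t * (w r / r ^+ n) by exact: (bP t).1.
have hb t : entire_coef (b t).
  move=> r r0; exists (a t * w r) => n.
  by rewrite -ler_pdivlMr ?exprn_gt0// -mulrA; exact: ba.
have bR t x : rps (b t) x = complex.Re (G t x%:C).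
  by apply: (cvg_lim (@norm_hausdorff R R)); exact: (bP t).2.
have mb n : measurable_fun setT (fun t => b t n).
  apply: measurable_coef => // x _.
  by rewrite (_ : (fun t => _) = (fun t => complex.Re (G t x%:C)))//; apply/funext => t.
have I x := integral_rps mb ia a0 w0 ba x.
have E x : (fun t => rps (b t) x) = (fun t => complex.Re (G t x%:C)).
  by apply/funext => t; exact: bR.
split=> [x|]; first by have [+ _] := I x; rewrite E.
exists (fun n => (\int[mu]_t b t n)%R), (\int[mu]_t a t)%R; split.
- exact: Rintegral_ge0.
- by move=> n r r0; exact: (integral_coef_le mb ia ba).
- by move=> x; have [_] := I x; rewrite E.
Qed.

End expandable.

(** * The interpolating functions *)

Section interpolation.
Context {R : realType}.
Local Notation C := R[i].
Variables (nu : R) (K : C -> C -> C).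
Hypotheses (nu_gtN1 : -1 < nu) (K_reproducing : reproducing_kernel (E_ nu) K)
  (K_formula : forall w z : R[i],
    pi%:C * (z - w^*) * K w z = B_ nu z * A_ nu w^* - A_ nu z * B_ nu w^*).
Implicit Types (xi x y t : R) (z w : C).

Let krp xi : 0 < kr K xi xi.
Proof. exact: (kr_diag_gt0 nu_gtN1 K_reproducing K_formula). Qed.

Let cont_inv_diag : continuous (fun xi => (kr K xi xi)^-1).
Proof.
have E : (fun x => kr K x x) = (fun x => kappa nu x * pi^-1).
  by apply/funext => x; exact: (kr_diag nu_gtN1 K_reproducing K_formula).
move=> xi; have : {for xi, continuous (fun x => kr K x x)}.
  by rewrite E; apply: cvgMl; exact: derive_cont (is_derive_kappa nu_gtN1 xi).
by apply: cvgV; rewrite gt_eqF.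
Qed.

Lemma measurable_inv_kr_diag : measurable_fun setT (fun xi => (kr K xi xi)^-1).
Proof. exact: continuous_measurable_fun. Qed.

Lemma measurable_inv : measurable_fun [set: R] (fun t : R => t^-1).
Proof.
rewrite -(setUv [set 0 : R]); apply/measurable_funU => //; first exact: measurableC.
split; first exact: measurable_fun_set1.
apply: open_continuous_measurable_fun.
  by rewrite openC; exact: (@closed_eq R 0).
by move=> t; rewrite inE /= => /eqP t0; exact: inv_continuous.
Qed.

(** Off the diagonal the kernel is an explicit quotient. On the diagonal that quotient is 0, by the
    default inverse of 0, while [ksq] is 1; the indicator of the diagonal makes up the
    difference. *)
Lemma measurable_ksq2 : measurable_fun setT (fun p : R * R => ksq K p.1 p.2).
Proof.
pose D : set (R * R) := [set p | p.1 = p.2].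
pose q (p : R * R) := (Br nu p.2 * Ar nu p.1 - Ar nu p.2 * Br nu p.1)
  * (pi^-1 * (p.2 - p.1)^-1).
have mD : measurable D.
  have -> : D = (fun p : R * R => p.1 - p.2) @^-1` [set 0].
    by apply/seteqP; split => -[x y] /=; [rewrite /D /= => ->; rewrite subrr|move=> /subr0_eq].
  rewrite -[X in measurable X]setTI.
  have : measurable_fun setT (fun p : R * R => p.1 - p.2) by exact: measurable_funB.
  by apply => //; exact: measurable_set1.
have m1 (g : R -> R) : continuous g -> measurable_fun setT (fun p : R * R => g p.1).
  by move=> cg; apply: measurableT_comp => //; exact: continuous_measurable_fun.
have m2 (g : R -> R) : continuous g -> measurable_fun setT (fun p : R * R => g p.2).
  by move=> cg; apply: measurableT_comp => //; exact: continuous_measurable_fun.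
have E (p : R * R) : ksq K p.1 p.2 = (q p * (kr K p.1 p.1)^-1) ^+ 2 + \1_D p.
  case: p => xi x; rewrite (ksqE nu_gtN1 K_reproducing K_formula) /=.
  have [->|xxi] := eqVneq xi x.
    rewrite divff ?gt_eqF// expr1n (_ : q (x, x) = 0); last by rewrite /q /= subrr invr0 !mulr0.
    by rewrite mul0r expr0n /= add0r indicE mem_set.
  rewrite indicE memNset; last exact/eqP.
  rewrite addr0; congr ((_ / _) ^+ 2); rewrite /q /=.
  have [<- _] := kr_formula nu_gtN1 K_formula xi x.
  have pi0 : (@pi R) != 0 by rewrite gt_eqF ?pi_gt0.
  have p0 : x - xi != 0 by rewrite subr_eq0 eq_sym.
  by move: (@pi R) pi0 => p pp; field; rewrite pp p0.
rewrite (_ : (fun p => _) = (fun p => (q p * (kr K p.1 p.1)^-1) ^+ 2 + \1_D p)); last exact/funext.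
apply: measurable_funD; last exact: measurable_indic.
have cA := cont_Ar nu_gtN1; have cB := cont_Br nu_gtN1.
apply: measurable_funX; apply: measurable_funM; last exact: (m1 _ cont_inv_diag).
apply: measurable_funM.
  by apply: measurable_funB; apply: measurable_funM;
    [exact: (m2 _ cB)|exact: (m1 _ cA)|exact: (m2 _ cA)|exact: (m1 _ cB)].
apply: measurable_funM => //; apply: measurableT_comp; first exact: measurable_inv.
exact: measurable_funB.
Qed.

Lemma measurable_ksq x : measurable_fun setT (fun xi => ksq K xi x).
Proof. exact: (measurableT_comp measurable_ksq2 (measurable_pair2 x)). Qed.

Section ell.
Variable ell : R -> C -> C.
Hypotheses (ell_entire : forall xi : R, entire (ell xi))
  (ell_real : forall xi : R, real_on_reals (ell xi))
  (ell_type : forall xi : R, exponential_type_le 2 (ell xi))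
  (ell_bound : forall xi x : R,
    `|Num.sg (x - xi) - complex.Re (ell xi x%:C)| <= ksq K xi x)
  (ell_measurable : measurable_fun [set: R * R]
    (fun p : R * R => complex.Re (ell p.1 p.2%:C))).

(** The value -1 at 0 matches the half-open intervals of Stieltjes measures: 0 is counted in ]x, 0]
    but not in ]0, x]. *)
Definition side xi : R := if 0 < xi then 1 else -1.

Definition ell_shift xi z : C := ell xi z + (side xi)%:C.

Lemma entire_ell_shift xi : entire (ell_shift xi).
Proof. by move=> z _; apply: holD; [exact: ell_entire|exact: hol_cst]. Qed.

Lemma ell_shiftE xi x : complex.Re (ell_shift xi x%:C) = complex.Re (ell xi x%:C) + side xi.
Proof. by rewrite ReD. Qed.

Lemma ell_shift_real xi : real_on_reals (ell_shift xi).
Proof. by move=> x; rewrite /ell_shift ImD ell_real /= addr0. Qed.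

Lemma ell_shift_type xi : exponential_type_le 2 (ell_shift xi).
Proof.
apply/exponential_typeP => tau tau2; pose s := (2 + tau) / 2.
have s2 : 2 < s by rewrite /s; lra.
have [r Hr] := (exponential_typeP _ _).1 (ell_type xi) s s2.
(* Beyond [T] the factor 2 from the sum of two exponentials is absorbed in passing from s to tau. *)
pose T := ln 2 / (tau - s).
have ts : 0 < tau - s by rewrite /s; lra.
exists (Num.max (Num.max r 0) T) => z; rewrite !gt_max => /andP[/andP[zr z0] zT].
apply: le_trans (cabsD _ _) _.
have h1 : cabs (side xi)%:C <= expR (s * cabs z).
  rewrite cabs_real (_ : `|side xi| = 1); last by rewrite /side; case: ifP => _; rewrite ?normrN normr1.
  by rewrite -expR0 ler_expR mulr_ge0 ?ltW//; lra.
apply: le_trans (lerD (Hr z zr) h1) _.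
rewrite (_ : tau * cabs z = (tau - s) * cabs z + s * cabs z); last by ring.
rewrite expRD -mulr2n -[leLHS]mulr_natl ler_wpM2r ?expR_ge0//.
rewrite -[leLHS](@lnK R) ?posrE// ler_expR mulrC -ler_pdivrMr//; exact: ltW.
Qed.

Lemma sg_side_eq0 xi x : `|x| < `|xi| -> Num.sg (x - xi) + side xi = 0.
Proof.
rewrite /side => h; case: ltP => xi0.
  rewrite ltr0_sg ?addNr// subr_lt0; apply: le_lt_trans (ler_norm x) _.
  by rewrite (gtr0_norm xi0) in h.
rewrite gtr0_sg ?subrr// subr_gt0; move: h; rewrite (ler0_norm xi0) => h.
by move: (lerNnormlW (lexx `|x|)); lra.
Qed.

(** For |xi| <= |x| the sum of the two signs is at most 2, and 1 <= M (1 + xi^2) / K(xi,xi) <= M (1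
    + x^2) / K(xi,xi). Adding the error of l_xi gives the constant 3 = 2 + 1. *)
Lemma interpolation_bound : exists2 M, 0 < M & forall xi x,
  ksq K xi x <= M * (kr K xi xi)^-1 * (1 + x ^+ 2) /\
  `|complex.Re (ell_shift xi x%:C)| <= M * (kr K xi xi)^-1 * (1 + x ^+ 2).
Proof.
have [M M0 HM] := kr_diag_le nu_gtN1 K_reproducing K_formula.
exists (3 * M) => [|xi x]; first by rewrite mulr_gt0.
have D0 : 0 < (kr K xi xi)^-1 by rewrite invr_gt0.
have x20 := sqr_ge0 x.
have B0 : 0 <= M * (1 + x ^+ 2) * (kr K xi xi)^-1.
  by rewrite !mulr_ge0// ?ltW// ltr_wpDr.
have b1 : ksq K xi x <= M * (1 + x ^+ 2) * (kr K xi xi)^-1.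
  apply: le_trans (ksq_le nu_gtN1 K_reproducing K_formula xi x) _.
  by rewrite ler_wpM2r ?HM ?ltW.
rewrite [3 * M * _ * _](_ : _ = 3 * (M * (1 + x ^+ 2) * (kr K xi xi)^-1)); last by ring.
split; first by move: b1 B0; move: (ksq _ _ _) (_ * _) => u v; lra.
rewrite ell_shiftE (_ : _ + _ = (Num.sg (x - xi) + side xi)
  - (Num.sg (x - xi) - complex.Re (ell xi x%:C))); last by ring.
apply: le_trans (ler_normB _ _) _.
have b2 : `|Num.sg (x - xi) + side xi| <= 2 * (M * (1 + x ^+ 2) * (kr K xi xi)^-1).
  have [h|h] := ltP `|x| `|xi|; first by rewrite sg_side_eq0// normr0 mulr_ge0.
  apply: (@le_trans _ _ 2).
    apply: le_trans (ler_normD _ _) _; rewrite -[leRHS]/(1 + 1); apply: lerD.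
      by rewrite normr_sg; case: (_ == _).
    by rewrite /side; case: ifP => _; rewrite ?normrN normr1.
  rewrite ler_peMr// ler_pdivlMr// mul1r; apply: le_trans (HM xi) _.
  by rewrite ler_pM2l// lerD2l -(real_normK (num_real xi)) -(real_normK (num_real x)) lerXn2r.
have b3 := ell_bound xi x; move: b1 b2 b3.
move: (`|_ - _|) (`|_ + _|) (ksq _ _ _) (M * _ * _) => u v s t; lra.
Qed.

Lemma measurable_side : measurable_fun [set: R] side.
Proof. by apply: measurable_fun_ifT => //; exact: measurable_fun_ltr. Qed.

Lemma measurable_ell x : measurable_fun setT (fun xi => complex.Re (ell xi x%:C)).
Proof.
exact: (measurableT_comp ell_measurable (measurable_pair2 x)).
Qed.

Lemma measurable_ell_shift x : measurable_fun setT (fun xi => complex.Re (ell_shift xi x%:C)).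
Proof.
rewrite (_ : (fun xi => _) = (fun xi => complex.Re (ell xi x%:C) + side xi)).
  by apply: measurable_funD; [exact: measurable_ell|exact: measurable_side].
by apply/funext => xi; rewrite ell_shiftE.
Qed.

Lemma measurable_sgn_err x : measurable_fun setT (sgn_err ell x).
Proof.
apply: measurable_funB; last exact: measurable_ell.
rewrite (_ : (fun xi => _) = (fun xi => if x < xi then -1 else if xi < x then 1 else 0)).
  by do 2 (apply: measurable_fun_ifT => //; first exact: measurable_fun_ltr).
apply/funext => xi; case: ltgtP => h; last by rewrite h subrr sgr0.
  by rewrite ltr0_sg// subr_lt0.
by rewrite gtr0_sg// subr_gt0.
Qed.

End ell.
End interpolation.

(** * Integrals of sign functions and comparison almost everywhere *)

Lemma Rintegral_indic d (T : measurableType d) (R : realType)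
    (mu : {measure set T -> \bar R}) (A : set T) (r : R) :
  measurable A -> mu A = r%:E ->
  mu.-integrable setT (EFin \o (\1_A : T -> R)) /\ (\int[mu]_t \1_A t)%R = r.
Proof.
move=> mA mr; split; last by rewrite /Rintegral integral_indic// setIT mr.
apply/integrableP; split; first exact/measurable_EFinP.
rewrite (eq_integral (fun t => (\1_A t)%:E)) => [|t _]; last by rewrite gee0_abs// lee_fin.
by rewrite integral_indic// setIT mr ltry.
Qed.

Section comparison.
Context {R : realType}.
Implicit Types (g h : R -> R) (x : R).

(** The integrand is 2 times the indicator of ]0, x] if x >= 0, and - 2 times that of ]x, 0] if x <
    0, each minus the indicator of {x}; the last one has integral 0 because x is no atom. *)
Lemma sg_side_integral (g : cumulative R R) x :
  lebesgue_stieltjes_measure g [set x] = 0%E ->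
  (\int[lebesgue_stieltjes_measure g]_xi (Num.sg (x - xi) + side xi))%R = 2 * (g x - g 0).
Proof.
set mu := lebesgue_stieltjes_measure g => mu0.
have i1 (A : set (measurableTypeR R)) r : measurable A -> mu A = r%:E ->
    mu.-integrable setT (EFin \o \1_A) /\ (\int[mu]_xi \1_A xi)%R = r.
  by move=> mA mr; exact: (Rintegral_indic (mu := mu)).
have [ix Ix] := i1 [set x] 0 (measurable_set1 x) mu0.
have step (A : set (measurableTypeR R)) k r : measurable A -> mu A = r%:E ->
    (forall xi, Num.sg (x - xi) + side xi = k * \1_A xi - \1_[set x] xi) ->
    (\int[mu]_xi (Num.sg (x - xi) + side xi))%R = k * r.
  move=> mA mr E; have [iA IA] := i1 A r mA mr.
  under eq_Rintegral do rewrite E; rewrite RintegralB//; last first.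
    exact: (integrableZl measurableT k iA).
  by rewrite RintegralZl// IA Ix subr0.
have [x0|x0] := leP 0 x.
  apply: (step `]0, x]%classic) => //; first exact: stieltjes_itv.
  move=> xi; rewrite /side !indicE; have [->|xxi] := eqVneq xi x.
    rewrite subrr sgr0 add0r (mem_set (_ : [set x] x))//.
    move: x0; rewrite le_eqVlt => /predU1P[<-|x0].
      rewrite ltxx memNset; last by rewrite /= in_itv /= ltxx.
      by rewrite mulr0 sub0r.
    rewrite x0 mem_set; last by rewrite /= in_itv /= x0 lexx.
    by rewrite /= ; ring.
  rewrite (memNset (_ : ~ [set x] xi)) ?subr0; last exact/eqP.
  case: (ltP 0 xi) => xi0.
    case: (ltgtP xi x) xxi => // h _.
      rewrite gtr0_sg ?subr_gt0// mem_set; last by rewrite /= in_itv /= xi0 ltW.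
      by rewrite /= ; ring.
    rewrite ltr0_sg ?subr_lt0// memNset ?mulr0 ?addNr//.
    by rewrite /= in_itv /= xi0 leNgt h.
  rewrite gtr0_sg ?subrr ?memNset ?mulr0//.
    by rewrite /= in_itv /= ltNge xi0.
  by rewrite subr_gt0 lt_neqAle xxi (le_trans xi0).
rewrite (_ : 2 * _ = (-2) * (g 0 - g x)); last by ring.
apply: (step `]x, 0]%classic) => //; first by apply: stieltjes_itv; exact: ltW.
move=> xi; rewrite /side !indicE; have [->|xxi] := eqVneq xi x.
  rewrite subrr sgr0 add0r (mem_set (_ : [set x] x))// ltNge (ltW x0) /=.
  by rewrite memNset ?mulr0 ?sub0r//= in_itv /= ltxx.
rewrite (memNset (_ : ~ [set x] xi)) ?subr0; last exact/eqP.
case: (ltP 0 xi) => xi0.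
  rewrite ltr0_sg ?subr_lt0 ?(lt_trans x0)// addNr memNset ?mulr0//.
  by rewrite /= in_itv /= leNgt xi0 andbF.
case: (ltgtP xi x) xxi => // h _.
  rewrite gtr0_sg ?subr_gt0// subrr memNset ?mulr0//.
  by rewrite /= in_itv /= ltNge ltW.
rewrite ltr0_sg ?subr_lt0// mem_set; last by rewrite /= in_itv /= h.
by rewrite /= ; ring.
Qed.

(** A violation at x persists on some interval ]x, x + d[, which has positive measure. *)
Lemma ae_le_right_continuous g h : right_continuous g -> right_continuous h ->
  {ae (@lebesgue_measure R), forall x, g x <= h x} -> forall x, g x <= h x.
Proof.
move=> rg rh [A [mA A0 gA]] x; rewrite leNgt; apply/negP => hg.
have e0 : 0 < (g x - h x) / 2 by rewrite divr_gt0// subr_gt0.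
have : \forall y \near x^'+, h y < g y.
  have /cvgrPdist_lt/(_ _ e0) n1 := rg x; have /cvgrPdist_lt/(_ _ e0) n2 := rh x.
  near=> y; have : `|g x - g y| < (g x - h x) / 2 by near: y.
  have : `|h x - h y| < (g x - h x) / 2 by near: y.
  by rewrite !ltr_norml => /andP[] ? ? /andP[] ? ?; lra.
rewrite near_withinE => /nbhs_ballP[d /= d0 Hd].
have sub : `]x, (x + d)[ `<=` A.
  move=> y; rewrite /= in_itv /= => /andP[xy yd]; apply: gA => /=.
  apply/negP; rewrite -ltNge; apply: Hd => //=.
  by rewrite /ball /= ltr_distlC; apply/andP; split; lra.
have : (lebesgue_measure `]x, (x + d)%R[%classic <= 0 :> \bar R)%E.
  by rewrite -A0; apply: le_measure; rewrite ?inE.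
rewrite lebesgue_measure_itv /= lte_fin ltrDl d0 -EFinB lee_fin addrAC subrr add0r.
by rewrite leNgt d0.
Unshelve. all: by end_near. Qed.

End comparison.

(** * Integral transforms of the interpolating functions *)

Section transforms.
Context {R : realType}.
Local Notation C := R[i].
Variables (nu : R) (K : C -> C -> C) (ell : R -> C -> C).
Hypotheses (nu_gtN1 : -1 < nu) (K_reproducing : reproducing_kernel (E_ nu) K)
  (K_formula : forall w z : R[i],
    pi%:C * (z - w^*) * K w z = B_ nu z * A_ nu w^* - A_ nu z * B_ nu w^*)
  (ell_entire : forall xi : R, entire (ell xi))
  (ell_real : forall xi : R, real_on_reals (ell xi))
  (ell_type : forall xi : R, exponential_type_le 2 (ell xi))
  (ell_bound : forall xi x : R,
    `|Num.sg (x - xi) - complex.Re (ell xi x%:C)| <= ksq K xi x)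
  (ell_measurable : measurable_fun [set: R * R]
    (fun p : R * R => complex.Re (ell p.1 p.2%:C))).
Implicit Types (xi x : R).

Local Notation T := (measurableTypeR R).
Local Notation inv_Kdiag := (fun xi => (Kdiag K xi)^-1).

Let Kdiag_gt0 xi : 0 < Kdiag K xi.
Proof. exact: (kr_diag_gt0 nu_gtN1 K_reproducing K_formula). Qed.

Let ksq0 xi x : 0 <= ksq K xi x.
Proof. exact: (ksq_ge0 nu_gtN1 K_reproducing K_formula). Qed.

Let measurable_invK : measurable_fun [set: T] inv_Kdiag.
Proof. exact: (measurable_inv_kr_diag nu_gtN1 K_reproducing K_formula). Qed.

Section measure.
Variable V : {measure set T -> \bar R}.

Lemma inv_Kdiag_fin : (\int[V]_xi (cabs (E_ nu xi%:C) ^- 2)%:E < +oo)%E ->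
  (\int[V]_xi (inv_Kdiag xi)%:E < +oo)%E.
Proof.
move=> fin; have [M M0 HM] := inv_kr_diag_le nu_gtN1 K_reproducing K_formula.
have mw : measurable_fun [set: T] (fun xi => cabs (E_ nu xi%:C) ^- 2).
  exact: continuous_measurable_fun (cont_weight nu_gtN1).
have w0 xi : 0 <= cabs (E_ nu xi%:C) ^- 2 by exact: (weight_ge0 nu_gtN1).
apply: (@le_lt_trans _ _ (\int[V]_xi (M%:E * (cabs (E_ nu xi%:C) ^- 2)%:E))%E).
  apply: ge0_le_integral => //.
  - by move=> xi _; rewrite lee_fin invr_ge0 ltW.
  - exact/measurable_EFinP.
  - by apply/measurable_EFinP; exact: measurable_funM.
  - by move=> xi _; rewrite -EFinM lee_fin; exact: HM.
rewrite ge0_integralZl//; last by rewrite lee_fin ltW.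
- by rewrite lte_mul_pinfty// lee_fin ltW.
- exact/measurable_EFinP.
- by move=> xi _; rewrite lee_fin.
Qed.

Hypothesis fin : (\int[V]_xi (inv_Kdiag xi)%:E < +oo)%E.

Lemma inv_Kdiag_integrable : V.-integrable setT (EFin \o inv_Kdiag).
Proof.
apply/integrableP; split; first exact/measurable_EFinP.
rewrite [ltLHS](_ : _ = \int[V]_xi (inv_Kdiag xi)%:E)%E//; apply: eq_integral => xi _.
by rewrite /= ger0_norm// invr_ge0 ltW.
Qed.

Let a M xi := M * inv_Kdiag xi.

Let ia M : V.-integrable setT (EFin \o a M).
Proof. exact: (integrableZl measurableT M inv_Kdiag_integrable). Qed.

Let a0 M xi : 0 < M -> 0 <= a M xi.
Proof. by move=> M0; rewrite mulr_ge0 ?invr_ge0// ltW. Qed.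

(** The measure is arbitrary among those that integrate 1 / K(xi,xi), because the result is applied
    to the positive and the negative variation of f as well as to dV_f. *)
Lemma ell_shift_transform :
  (forall x, V.-integrable setT (EFin \o (fun xi => complex.Re (ell_shift ell xi x%:C)))) /\
  expandable 2 (fun x => (\int[V]_xi complex.Re (ell_shift ell xi x%:C))%R).
Proof.
have [M M0 HM] := interpolation_bound nu_gtN1 K_reproducing K_formula ell_bound.
apply: (@expandable_integral R 2 (ler0n R 2) _ T V (ell_shift ell) _ (ia M)).
- by move=> xi; exact: a0.
- by move=> xi; exact: entire_ell_shift.
- by move=> xi; exact: ell_shift_real.
- by move=> xi; exact: ell_shift_type.
- by move=> xi x; have [_] := HM xi x.
- by move=> x; exact: measurable_ell_shift.
Qed.

Lemma ksq_transform :
  (forall x, V.-integrable setT (EFin \o (fun xi => ksq K xi x))) /\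
  expandable 2 (fun x => (\int[V]_xi ksq K xi x)%R).
Proof.
have [M M0 HM] := interpolation_bound nu_gtN1 K_reproducing K_formula ell_bound.
apply: (@expandable_integral R 2 (ler0n R 2) _ T V (fun xi z => k_ K xi z ^+ 2) _ (ia M)).
- by move=> xi; exact: a0.
- by move=> xi; exact: (entire_k_sqr K_reproducing).
- move=> xi x; rewrite (k_real nu_gtN1 K_reproducing K_formula) -rmorphXn //.
- by move=> xi; exact: (k_sqr_type nu_gtN1 K_reproducing K_formula).
- by move=> xi x; have [+ _] := HM xi x; rewrite ger0_norm//; exact: ksq0.
- by move=> x; exact: (measurable_ksq nu_gtN1 K_reproducing K_formula).
Qed.

Lemma sgn_err_integrable x : V.-integrable setT (EFin \o sgn_err ell x).
Proof.
apply: (le_integrable measurableT _ _ (ksq_transform.1 x)).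
  by apply/measurable_EFinP; exact: measurable_sgn_err.
move=> xi _; rewrite /= lee_fin (ger0_norm (ksq0 xi x)); exact: ell_bound.
Qed.

End measure.

Lemma ksq_integral_weight (V : {sigma_finite_measure set T -> \bar R}) :
  (\int[V]_xi (inv_Kdiag xi)%:E < +oo)%E ->
  (\int[@lebesgue_measure R]_x ((\int[V]_xi ksq K xi x)%R * weight (E_ nu) x)%:E =
   \int[V]_xi (inv_Kdiag xi)%:E)%E.
Proof.
move=> fin; have [iK _] := ksq_transform fin.
have mk := measurable_ksq2 nu_gtN1 K_reproducing K_formula.
have cw := cont_weight nu_gtN1.
have w0 x : 0 <= weight (E_ nu) x := weight_ge0 nu_gtN1 x.
pose F (p : T * T) := (ksq K p.1 p.2 * weight (E_ nu) p.2)%:E.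
have F0 p : (0 <= F p)%E by rewrite lee_fin mulr_ge0.
have mF : measurable_fun setT F.
  apply/measurable_EFinP; apply: measurable_funM; first exact: mk.
  by apply: measurableT_comp => //; exact: continuous_measurable_fun.
(* Integrability in xi for each x lets the real-valued inner integral be replaced by the extended
   one, to which Tonelli applies. *)
transitivity (\int[@lebesgue_measure R]_x \int[V]_xi F (xi, x))%E.
  apply: eq_integral => x _; rewrite /F /= EFinM /Rintegral fineK; last first.
    exact: integrable_fin_num (iK x).
  rewrite -ge0_integralZr//.
  - by apply/measurable_EFinP; exact: (measurable_ksq nu_gtN1 K_reproducing K_formula).
  - by move=> xi _; rewrite lee_fin.
  - by rewrite lee_fin.
transitivity (\int[V]_xi \int[@lebesgue_measure R]_x F (xi, x))%E.
  exact: esym (@fubini_tonelli _ _ _ _ _ V (@lebesgue_measure R) F mF F0).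
apply: eq_integral => xi _; have k0 := Kdiag_gt0 xi.
transitivity (\int[@lebesgue_measure R]_x
    (((Kdiag K xi) ^- 2)%:E * (kr K xi x ^+ 2 * weight (E_ nu) x)%:E))%E.
  apply: eq_integral => x _; rewrite /F /= (ksqE nu_gtN1 K_reproducing K_formula) -EFinM.
  by congr EFin; rewrite expr_div_n mulrA [X in _ = X * _]mulrC.
have mG : measurable_fun [set: R] (fun x => (kr K xi x ^+ 2 * weight (E_ nu) x)%:E).
  apply/measurable_EFinP; apply: measurable_funM; last exact: continuous_measurable_fun.
  by apply: measurable_funX; apply: continuous_measurable_fun; exact: (cont_kr K_reproducing).
have G0 x : (0 <= (kr K xi x ^+ 2 * weight (E_ nu) x)%:E)%E by rewrite lee_fin mulr_ge0// sqr_ge0.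
have c0 : (0 <= ((Kdiag K xi) ^- 2)%:E)%E by rewrite lee_fin invr_ge0 sqr_ge0.
rewrite (ge0_integralZl (@lebesgue_measure R) measurableT mG (fun x _ => G0 x) c0).
rewrite (kr_sqr_integral nu_gtN1 K_reproducing K_formula) -EFinM; congr EFin.
by rewrite -exprVn expr2 -mulrA -KdiagE mulVf ?mulr1// gt_eqF.
Qed.

End transforms.

(** * The minorant and the majorant of f *)

Lemma int_signed_sg_side {R : realType} (f : R -> R) (fbv : locally_bounded_variation f)
    (frc : right_continuous f) (x : R) : dV fbv frc [set x] = 0%E ->
  int_signed (dpos fbv frc) (dneg fbv frc) (fun xi => Num.sg (x - xi) + side xi) =
  2 * (f x - f 0).
Proof.
rewrite dV_add; last exact: measurable_set1.
have := measure_ge0 (dpos fbv frc) [set x]; have := measure_ge0 (dneg fbv frc) [set x].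
move=> n0 p0 /eqP; rewrite padde_eq0// => /andP[/eqP p1 /eqP n1].
rewrite /int_signed (sg_side_integral p1) (sg_side_integral n1) /= /pos_var /neg_var.
by field.
Qed.

Theorem theorem22 (R : realType) (nu : R) (nu_gtN1 : -1 < nu)
  (K : R[i] -> R[i] -> R[i])
  (K_reproducing : reproducing_kernel (E_ nu) K)
  (K_formula : forall w z : R[i],
    pi%:C * (z - w^*) * K w z = B_ nu z * A_ nu w^* - A_ nu z * B_ nu w^*)
  (ell : R -> R[i] -> R[i])
  (ell_entire : forall xi : R, entire (ell xi))
  (ell_real : forall xi : R, real_on_reals (ell xi))
  (ell_type : forall xi : R, exponential_type_le 2 (ell xi))
  (ell_bound : forall xi x : R,
    `|Num.sg (x - xi) - complex.Re (ell xi x%:C)| <= ksq K xi x)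
  (ell_measurable : measurable_fun [set: R * R]
    (fun p : R * R => complex.Re (ell p.1 p.2%:C)))
  (f : R -> R) (fbv : locally_bounded_variation f) (frc : right_continuous f)
  (dV_finite :
    (\int[dV fbv frc]_xi (cabs (E_ nu xi%:C) ^- 2)%:E < +oo)%E) :
  (forall x : R,
    (dV fbv frc).-integrable [set: R] (fun xi => (sgn_err ell x xi)%:E) /\
    (dV fbv frc).-integrable [set: R] (fun xi => (ksq K xi x)%:E)) /\
  (exists L M : R[i] -> R[i],
    [/\ entire L /\ exponential_type_le 2 L,
        entire M /\ exponential_type_le 2 M &
        {ae @lebesgue_measure R, forall x : R,
          L x%:C = (L1 fbv frc K ell x)%:C /\ M x%:C = (M1 fbv frc K ell x)%:C}] /\
    [/\ real_on_reals L /\ real_on_reals M,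
        forall x : R, complex.Re (L x%:C) <= f x <= complex.Re (M x%:C),
        (\int[@lebesgue_measure R]_x
            ((complex.Re (M x%:C) - complex.Re (L x%:C)) *
              cabs (E_ nu x%:C) ^- 2)%:E
          <= \int[dV fbv frc]_xi ((Kdiag K xi)^-1)%:E)%E &
        (\int[dV fbv frc]_xi ((Kdiag K xi)^-1)%:E < +oo)%E]).
Proof.
pose V := dV fbv frc; pose P := dpos fbv frc; pose N := dneg fbv frc.
have VE := dV_add fbv frc.
have finV := inv_Kdiag_fin nu_gtN1 K_reproducing K_formula dV_finite.
have mD : measurable_fun [set: measurableTypeR R] (EFin \o (fun xi => (Kdiag K xi)^-1)).
  by apply/measurable_EFinP; exact: (measurable_inv_kr_diag nu_gtN1 K_reproducing K_formula).
have D0 xi : (0 <= ((Kdiag K xi)^-1)%:E)%E.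
  by rewrite lee_fin invr_ge0 ltW//; exact: (kr_diag_gt0 nu_gtN1 K_reproducing K_formula).
have DE := ge0_integral_V VE mD D0.
have finP : (\int[P]_xi ((Kdiag K xi)^-1)%:E < +oo)%E.
  by apply: le_lt_trans finV; rewrite DE leeDl//; apply: integral_ge0 => xi _; exact: D0.
have finN : (\int[N]_xi ((Kdiag K xi)^-1)%:E < +oo)%E.
  by apply: le_lt_trans finV; rewrite DE leeDr//; apply: integral_ge0 => xi _; exact: D0.
have [_ eP] := ell_shift_transform nu_gtN1 K_reproducing K_formula ell_entire ell_real
  ell_type ell_bound ell_measurable finP.
have [_ eN] := ell_shift_transform nu_gtN1 K_reproducing K_formula ell_entire ell_real
  ell_type ell_bound ell_measurable finN.
have [iS _] := ell_shift_transform nu_gtN1 K_reproducing K_formula ell_entire ell_real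
  ell_type ell_bound ell_measurable finV.
have [iK eK] := ksq_transform nu_gtN1 K_reproducing K_formula ell_bound finV.
have iE := sgn_err_integrable nu_gtN1 K_reproducing K_formula ell_bound ell_measurable finV.
split=> [x|]; first by split; [exact: iE|exact: iK].
pose Ks x : R := (\int[V]_xi ksq K xi x)%R.
(* The minorant is s = -1/2 and the majorant s = 1/2. The constant [f 0] comes from the integral 2
   (f(x) - f(0)) of the sum of the two signs. *)
pose G s x := f 0 + 2^-1 * ((\int[P]_xi complex.Re (ell_shift ell xi x%:C))%R +
  (-1) * (\int[N]_xi complex.Re (ell_shift ell xi x%:C))%R) + s * Ks x.
have eG s : expandable 2 (G s).
  exact: (expandableD (expandableD (expandable_cst (ler0n R 2) (f 0))
    (expandableZ 2^-1 (expandableD eP (expandableZ (-1) eN)))) (expandableZ s eK)).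
have GE s x : V [set x] = 0%E ->
    G s x = f x - 2^-1 * df_integral fbv frc (sgn_err ell x) + s * Ks x.
  move=> Vx; have h := int_signed_sg_side Vx.
  have hD := int_signedD VE (iE x) (iS x).
  have E : (fun xi => sgn_err ell x xi + complex.Re (ell_shift ell xi x%:C)) =
      (fun xi => Num.sg (x - xi) + side xi).
    by apply/funext => xi; rewrite ell_shiftE /sgn_err; ring.
  rewrite E h in hD; rewrite (df_integralE (iE x)) /G.
  have -> : (\int[P]_xi complex.Re (ell_shift ell xi x%:C))%R +
      (-1) * (\int[N]_xi complex.Re (ell_shift ell xi x%:C))%R =
      int_signed P N (fun xi => complex.Re (ell_shift ell xi x%:C)) by rewrite mulN1r.
  move: hD; move: (int_signed _ _ _) (int_signed _ _ _) (Ks x) => u v k hD; lra.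
(* The pointwise error bound by [ksq] integrates to this one, which is exactly what places f(x)
   between the two functions wherever they agree with L_1 and M_1. *)
have Kle x : `|df_integral fbv frc (sgn_err ell x)| <= Ks x.
  rewrite (df_integralE (iE x)); apply: le_trans (int_signed_le VE (iE x)) _.
  apply: le_Rintegral => //; first exact: integrable_norm (iE x).
  by move=> xi _; exact: ell_bound.
(* A property holding off the atoms of dV_f holds almost everywhere. *)
have aeV (Q : R -> Prop) : (forall x, V [set x] = 0%E -> Q x) ->
    {ae @lebesgue_measure R, forall x, Q x}.
  move=> VQ; have [A [mA A0 VA]] := ae_dV_set1 fbv frc; exists A; split => // x nQ.
  by apply: VA => Vx; exact: nQ (VQ x Vx).
have GL x : G (- 2^-1) x <= f x.
  apply: (ae_le_right_continuous (g := G (- 2^-1))) => //.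
    by move=> y; apply: cvg_at_right_filter; exact: (expandable_cont _ (eG _)).
  apply: aeV => y Vy; rewrite GE//.
  by have := Kle y; rewrite ler_norml => /andP[]; move: (df_integral _ _ _) (Ks y) => u v; lra.
have GM x : f x <= G 2^-1 x.
  apply: (ae_le_right_continuous (h := G 2^-1)) => //.
    by move=> y; apply: cvg_at_right_filter; exact: (expandable_cont _ (eG _)).
  apply: aeV => y Vy; rewrite GE//.
  by have := Kle y; rewrite ler_norml => /andP[]; move: (df_integral _ _ _) (Ks y) => u v; lra.
have [L [L1e L2 L3]] := expandable_entire (ler0n R 2) (eG (- 2^-1)).
have [M [M1e M2 M3]] := expandable_entire (ler0n R 2) (eG 2^-1).
exists L, M; split; split=> //.
- apply: aeV => x Vx; rewrite L3 M3 !GE// /L1 /M1.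
  by split=> //; congr (_%:C); rewrite mulNr.
- by split=> x; rewrite ?L3 ?M3.
- by move=> x; rewrite L3 M3 /= GL GM.
rewrite -(ksq_integral_weight nu_gtN1 K_reproducing K_formula ell_bound finV).
(* The difference of majorant and minorant is exactly [Ks], so the inequality is in fact an
   equality. *)
rewrite le_eqVlt; apply/orP; left; apply/eqP; apply: eq_integral => x _.
rewrite L3 M3 /=; congr ((_ * _)%:E); rewrite /G -/(Ks x).
by move: (Ks x) (f 0 + _) => k u; field.
Qed.
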